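(* Let $V$ be a $\mathbb{Z}_{\ge0}$-graded vertex operator algebra over $\mathbb{C}$ satisfying Zhu's finiteness condition and let $M=\bigoplus_{n=0}^\infty M_{(r+n)}$ be a $V$-module. Let $P$ be a projective commutant of $M$ and let $\phi$ be a symmetric linear function on $P$. Then the pseudo-trace function $S_M^{P,\phi}$ is a one-point function.
   Context: Let $(V,Y,|0\rangle,\omega)$ be a $\mathbb{Z}_{\ge 0}$-graded vertex operator algebra of central charge $c_V$, $Y(a,z)=\sum_{n\in\mathbb{Z}}a_{(n)}z^{-n-1}$, and write $|a|=n$ for $a\in V_n$. For a weak $V$-module $M$ and homogeneous $a\in V$ put $J_n(a)=a_{(|a|-1+n)}$ on $M$, extended linearly in $a$; $L_n=\omega_{(n+1)}$. Weak modules and modules. A weak $V$-module is a vector space $M$ with a linear map $a\mapsto Y_M(a,z)=\sum_n a_{(n)}z^{-n-1}\in\mathrm{End}_{\mathbb{C}}(M)[[z,z^{-1}]]$ such that for all $a\in V,u\in M$ one has $a_{(n)}u=0$ for $n$ large, $Y_M(|0\rangle,z)=\mathrm{id}_M$, and the Borcherds identity holds. A $V$-module is a weak $V$-module $M$ that is finitely generated as a weak module and such that for every $u\in M$ there is an integer $m$ with $J_{n_1}(a^1)\cdots J_{n_r}(a^r)u=0$ for all $a^1,\dots,a^r\in V$ whenever $n_1+\dots+n_r\ge m$. Zhu's finiteness condition: $V/C_2(V)$ is finite-dimensional, where $C_2(V)=\mathrm{span}\{a_{(-2)}b\mid a,b\in V\}$. The notation $M=\bigoplus_{n=0}^\infty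 M_{(r+n)}$ means: there are $r\in\mathbb{C}$ and an integer $d\ge0$ such that $M_{(r)}\neq0$, $M_{(r+n)}$ is the generalized $L_0$-eigenspace of eigenvalue $r+n$, $(L_0-r-n)^{d+1}M_{(r+n)}=0$ and $\dim_{\mathbb{C}}M_{(r+n)}<\infty$ for all $n\ge0$. Projective commutant: a subalgebra $P$ of $\mathrm{End}_V(M)$ such that $M$ is projective as a left $P$-module. Under Zhu's finiteness condition $P$ is finite-dimensional and each $M_{(r+n)}$ is a finite-dimensional projective left $P$-module. Pseudo-trace maps: a symmetric linear function on an algebra $A$ is a linear $\phi:A\to\mathbb{C}$ with $\phi(ab)=\phi(ba)$. For a finite-dimensional $\mathbb{C}$-algebra $A$ and a finitely generated projective left $A$-module $W$, an $A$-coordinate system is a finite family $u_i\in W$, $f_i\in\mathrm{Hom}_A(W,A)$ with $w=\sum_i f_i(w)u_i$ for all $w\in W$; the pseudo-trace map $\phi_W:\mathrm{End}_A(W)\to\mathbb{C}$ is $\phi_W(\alpha)=\sum_i\phi(f_i(\alpha(u_i)))$ (independent of the choice of coordinate system). Pseudo-trace function: with $q=e^{2\pi i\tau}$, $q^s=e^{2\pi i\tau s}$, set $q^{L_0}=\sum_{j=0}^d\frac1{j!}(L_0-r-n)^jq^{r+n}(2\pi i\tau)^j$ on $M_{(r+n)}$, and $$S_M^{P,\phi}(a,\tau)=\sum_{n=0}^\infty\phi_{M_{(r+n)}}\bigl(J_0(a)q^{L_0-c_V/24}\bigr)\qquad(a\in V,\ \tau\in\mathscr{H}),$$ extended to $V\otimes\mathbb{C}[G_4,G_6]$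 by $S(\sum_ia_i\otimes f_i,\tau)=\sum_if_i(\tau)S(a_i,\tau)$. One-point functions. Let $\mathscr{H}=\{\tau\in\mathbb{C}\mid \mathrm{Im}\,\tau>0\}$, $G_{2k}(\tau)=\sum_{(m,n)\ne(0,0)}(m\tau+n)^{-2k}$ for $k\ge2$, and $G_2(\tau)=\frac{\pi^2}{3}+\sum_{m\ne0}\sum_{n\in\mathbb{Z}}(m\tau+n)^{-2}$. Put $Y[a,z]=Y(a,e^{2\pi i z}-1)e^{2\pi i|a|z}=\sum_n a_{[n]}z^{-n-1}$ for homogeneous $a$ (extended linearly), $\tilde\omega=(2\pi i)^2(\omega-\frac{c_V}{24}|0\rangle)$, $L_{[n]}=\tilde\omega_{[n+1]}$, $V_{[n]}=\{a\in V\mid L_{[0]}a=na\}$. Let $O_q(V)$ be the $\mathbb{C}[G_4,G_6]$-submodule of $V\otimes\mathbb{C}[G_4,G_6]$ generated by $a_{[0]}b$ and $a_{[-2]}b+\sum_{k\ge2}(2k-1)a_{[2k-2]}b\otimes G_{2k}(\tau)$ for homogeneous $a\in V$ and $b\in V$. A one-point function is a map $S:V\otimes\mathbb{C}[G_4,G_6]\times\mathscr{H}\to\mathbb{C}$ such that: (1) $S(a,\tau)$ is holomorphic in $\tau\in\mathscr{H}$ for each $a\in V\otimes\mathbb{C}[G_4,G_6]$; (2) $S(\sum_i a_i\otimes f_i(\tau),\tau)=\sum_i f_i(\tau)S(a_i,\tau)$ for $a_i\in V$, $f_i\in\mathbb{C}[G_4,G_6]$; (3) $S(a,\tau)=0$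 for $a\in O_q(V)$; (4) for $a\in V_{[n]}$, $S(L_{[-2]}a,\tau)=(2\pi i)^2q\frac{d}{dq}S(a,\tau)+\sum_{k\ge1}G_{2k}(\tau)S(L_{[2k-2]}a,\tau)$. *)

(* Defs.v *)
(* The complex numbers are R[i], R : realType,
   with the topology and the normed module structure of R[i]^o. *)
From HB Require Import structures.
From mathcomp Require Import all_boot all_order all_algebra.
From mathcomp Require Import complex.
From mathcomp Require Import all_classical all_reals all_analysis.
From mathcomp Require Import showcase.summability.

Set Implicit Arguments.
Unset Strict Implicit.
Unset Printing Implicit Defensive.

Import Order.TTheory GRing.Theory Num.Theory.
Import numFieldNormedType.Exports.

Local Open Scope classical_set_scope.
Local Open Scope ring_scope.

Section LinearAlgebra.
Variables (C : fieldType) (U : lmodType C).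

Definition span (X : set U) : set U :=
  [set u | exists n (c : 'I_n -> C) (x : 'I_n -> U),
     (forall i, X (x i)) /\ u = \sum_i c i *: x i].

Definition finite_dim (W : set U) : Prop :=
  exists n (e : 'I_n -> U), forall u, W u ->
    exists c : 'I_n -> C, u = \sum_i c i *: e i.

Definition finite_codim (W : set U) : Prop :=
  exists n (e : 'I_n -> U), forall u,
    exists c : 'I_n -> C, W (u - \sum_i c i *: e i).

(* U is the internal direct sum of the W n. *)
Definition is_direct_sum (W : nat -> set U) : Prop :=
  forall u, exists! w : nat -> U,
    [/\ forall n, W n (w n), finite_set [set n | w n != 0]
      & u = \sum_(n \in [set: nat]) w n].

Definition gen_eigenspace (T : U -> U) (l : C) : set U :=
  [set u | exists k, iter k (fun v => T v - l *: v) u = 0].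

End LinearAlgebra.

Section ComplexFunctions.
Variable R : realType.
Local Notation C := R[i].

Definition cexp (z : C) : C :=
  ((expR (complex.Re z) * cos (complex.Im z)) +i*
   (expR (complex.Re z) * sin (complex.Im z)))%C.

Definition two_pi_i : C := (0 +i* (2 * pi))%C.

Definition upper_half : Type := {tau : C | 0 < complex.Im tau}.

Definition qpow (tau : upper_half) (s : C) : C := cexp (two_pi_i * val tau * s).

(* Functions on the upper half-plane are extended by 0 to C in order to be
   differentiated; the half-plane being open, this does not affect derivatives
   at its points. *)
Definition extend0 (f : upper_half -> C) : C^o -> C^o :=
  fun z => if insub z is Some tau then f tau else 0.

Definition holomorphic (f : upper_half -> C) : Prop :=
  forall tau : upper_half, derivable (extend0 f) (val tau : C^o) 1.

Definition ddtau (f : upper_half -> C) (tau : upper_half) : C :=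
  derive1 (extend0 f) (val tau).

(* q d/dq with q = exp (2 pi i tau) *)
Definition qddq (f : upper_half -> C) (tau : upper_half) : C :=
  two_pi_i^-1 * ddtau f tau.

(* [eisenstein k] is G_{2k} for k >= 1.  The sums are unordered sums, i.e.
   limits along the directed set of finite subsets of the index set. *)
Definition lattice_term (k : nat) (tau : C) (m n : int) : C^o :=
  if (m, n) == (0, 0) then 0 else (m%:~R * tau + n%:~R) ^- (2 * k)%N.

Definition eisenstein (k : nat) (tau : upper_half) : C :=
  if k == 1%N then
    (pi ^+ 2 / 3)%:C%C +
    summability.sum (fun m : int => if m == 0 then 0 : C^o else
      summability.sum (fun n : int => lattice_term 1 (val tau) m n))
  else
    summability.sum (fun mn : int * int =>
      lattice_term k (val tau) mn.1 mn.2).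

(* C[G_4, G_6], as a ring of functions on the upper half-plane *)
Definition modular_ring : set (upper_half -> C) :=
  [set f | exists p : {poly {poly C}},
     forall tau, f tau = p.[(eisenstein 3 tau)%:P].[eisenstein 2 tau]].

Definition binz (s : int) (i : nat) : C :=
  (\prod_(j < i) (s - j%:Z)%:~R) / (i`!)%:R.

(* The coefficient of w^j in ((e^w - 1) / w)^s * e^(k w), obtained from the
   binomial expansion of (1 + u)^s, u = (e^w - 1) / w - 1; since u has zero
   constant term, only powers u^i with i <= j and the coefficients of the
   series up to w^j contribute. *)
Definition exp_coef (s : int) (k j : nat) : C :=
  let u : {poly C} := (\poly_(i < j.+1) ((i.+1)`!)%:R^-1) - 1 in
  let e : {poly C} := \poly_(i < j.+1) (k%:R ^+ i / (i`!)%:R) in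
  ((\sum_(i < j.+1) binz s i *: u ^+ i) * e)`_j.

End ComplexFunctions.

Section VertexAlgebra.
Variable R : realType.
Local Notation C := R[i].

(* [act a n u] is a_(n) u, and [nprod] is the special case where a, u are both in
   V.  By truncation, the sums over nat in the Borcherds identity have finite
   support. *)
Record weak_module_axioms (V M : lmodType C) (nprod : V -> int -> V -> V)
    (vac : V) (act : V -> int -> M -> M) : Prop := WeakModuleAxioms {
  act_linearl : forall n u, linear (fun a => act a n u);
  act_linearr : forall a n, linear (act a n);
  act_trunc : forall a u, exists N : int, forall n, N <= n -> act a n u = 0;
  act_vac : forall n u, act vac n u = if n == -1 then u else 0;
  act_borcherds : forall a b u (p q r : int),
    \sum_(i \in [set: nat])
      binz R p i *: act (nprod a (r + i%:Z) b) (p + q - i%:Z) u =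
    \sum_(i \in [set: nat])
      ((-1) ^+ i * binz R r i) *:
        (act a (p + r - i%:Z) (act b (q + i%:Z) u) -
         (-1) ^ r *: act b (q + r - i%:Z) (act a (p + i%:Z) u))
}.

(* [hcomp k] is the projection of V = \bigoplus_(k >= 0) V_k onto V_k, and
   L_n = omega_(n+1). *)
Record voa (V : lmodType C) : Type := Voa {
  nprod : V -> int -> V -> V;
  vac : V;
  conf : V;
  charge : C;
  hcomp : nat -> V -> V;
  prod_weak_module : weak_module_axioms nprod vac nprod;
  prod_creation : forall a, nprod a (-1) vac = a;
  prod_creation0 : forall a n, 0 <= n -> nprod a n vac = 0;
  comp_linear : forall k, linear (hcomp k);
  comp_proj : forall k l a, hcomp k (hcomp l a) = if k == l then hcomp l a else 0;
  comp_fin : forall a, finite_set [set k | hcomp k a != 0];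
  comp_sum : forall a, a = \sum_(k \in [set: nat]) hcomp k a;
  comp_finite_dim : forall k, finite_dim (range (hcomp k));
  virasoro : forall (m n : int) b,
    nprod conf (m + 1) (nprod conf (n + 1) b) -
    nprod conf (n + 1) (nprod conf (m + 1) b) =
    (m - n)%:~R *: nprod conf (m + n + 1) b +
    (if m + n == 0 then ((m ^+ 3 - m)%:~R / 12 * charge) *: b else 0);
  L0_grading : forall k a, nprod conf 1 (hcomp k a) = k%:R *: hcomp k a;
  L1_derivation : forall a n b,
    nprod (nprod conf 0 a) n b = - n%:~R *: nprod a (n - 1) b
}.

Variables (V : lmodType C) (A : voa V).

Definition homogeneous (k : nat) (a : V) : Prop := hcomp A k a = a.

Definition C2 : set V := span [set x | exists a b, x = nprod A a (-2) b].

Definition zhu_finite : Prop := finite_codim C2.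

(* Y(a, e^(2 pi i z) - 1) e^(2 pi i |a| z) = \sum_n a_[n] z^(-n-1): with
   w = 2 pi i z, the term a_(m) (e^w - 1)^(-m-1) e^(|a| w) contributes to
   z^(-n-1) = z^(-m-1+j) for m = n + j, j >= 0. *)
Definition sq_prod (a : V) (n : int) (b : V) : V :=
  \sum_(k \in [set: nat]) \sum_(j \in [set: nat])
    (two_pi_i R ^ (- n - 1) * exp_coef R (- (n + j%:Z) - 1) k j) *:
      nprod A (hcomp A k a) (n + j%:Z) b.

Definition sq_conf : V :=
  two_pi_i R ^+ 2 *: (conf A - (charge A / 24) *: vac A).

Definition sq_L (n : int) (a : V) : V := sq_prod sq_conf (n + 1) a.

(* For a space F of functions on a set H, V (x) F embeds in the space of
   functions H -> V by a (x) f |-> (tau |-> f tau *: a).  Elements of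
   V (x) C[G_4, G_6] are represented as such functions; a in V, i.e. a (x) 1, is
   the constant function. *)
Definition tensor_modular : set (upper_half R -> V) :=
  [set v | exists n (a : 'I_n -> V) (f : 'I_n -> upper_half R -> C),
     (forall i, @modular_ring R (f i)) /\
     v = fun tau => \sum_i f i tau *: a i].

Definition Oq_gen : set (upper_half R -> V) :=
  [set v | exists k a b, homogeneous k a /\
     (v = (fun=> sq_prod a 0 b) \/
      v = fun tau => sq_prod a (-2) b +
        \sum_(l \in [set l | (2 <= l)%N])
          ((2 * l - 1)%:R * eisenstein l tau) *:
            sq_prod a (2 * l%:Z - 2) b)].

Definition Oq : set (upper_half R -> V) :=
  [set v | exists n (f : 'I_n -> upper_half R -> C)
                    (g : 'I_n -> upper_half R -> V),
     (forall i, @modular_ring R (f i) /\ Oq_gen (g i)) /\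
     v = fun tau => \sum_i f i tau *: g i tau].

Record one_point_function (S : (upper_half R -> V) -> upper_half R -> C) :
    Prop := OnePointFunction {
  opf_holomorphic : forall v, tensor_modular v -> holomorphic (S v);
  opf_linear : forall n (a : 'I_n -> V) (f : 'I_n -> upper_half R -> C),
    (forall i, @modular_ring R (f i)) ->
    forall tau, S (fun t => \sum_i f i t *: a i) tau =
                \sum_i f i tau * S (fun=> a i) tau;
  opf_Oq : forall v, Oq v -> forall tau, S v tau = 0;
  opf_qddq : forall (n : int) (a : V), sq_L 0 a = n%:~R *: a ->
    forall tau, S (fun=> sq_L (-2) a) tau =
      two_pi_i R ^+ 2 * qddq (S (fun=> a)) tau +
      \sum_(k \in [set k | (1 <= k)%N])
        eisenstein k tau * S (fun=> sq_L (2 * k%:Z - 2) a) tau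
}.

Section Modules.
Variables (M : lmodType C) (act : V -> int -> M -> M).

Definition J (n : int) (a : V) (u : M) : M :=
  \sum_(k \in [set: nat]) act (hcomp A k a) (k%:Z - 1 + n) u.

Definition Lop (n : int) (u : M) : M := act (conf A) (n + 1) u.

Definition weak_submodule (N : set M) : Prop :=
  [/\ N 0, forall c u v, N u -> N v -> N (c *: u + v)
    & forall a n u, N u -> N (act a n u)].

Record is_module : Prop := IsModule {
  module_weak : weak_module_axioms (nprod A) (vac A) act;
  module_fin_gen : exists n (e : 'I_n -> M),
    forall N, weak_submodule N -> (forall i, N (e i)) -> forall u, N u;
  module_bounded : forall u, exists m : int, forall s : seq (int * V),
    m <= \sum_(x <- s) x.1 -> foldr (fun x => J x.1 x.2) u s = 0
}.

Definition graded_piece (r : C) (n : nat) : set M :=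
  gen_eigenspace (Lop 0) (r + n%:R).

Definition L0_nil (r : C) (n : nat) (u : M) : M := Lop 0 u - (r + n%:R) *: u.

Record is_graded (r : C) (d : nat) : Prop := IsGraded {
  graded_sum : is_direct_sum (graded_piece r);
  graded_bot : exists u, graded_piece r 0 u /\ u <> 0;
  graded_nil : forall n u, graded_piece r n u -> iter d.+1 (L0_nil r n) u = 0;
  graded_finite_dim : forall n, finite_dim (graded_piece r n)
}.

(* q^(L_0 - c_V/24) on M_(r+n) *)
Definition qL0 (r : C) (d n : nat) (tau : upper_half R) (u : M) : M :=
  qpow tau (- (charge A / 24)) *:
  \sum_(j < d.+1)
    ((j`!)%:R^-1 * qpow tau (r + n%:R) * (two_pi_i R * val tau) ^+ j) *:
      iter j (L0_nil r n) u.

Section Commutant.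
(* A subalgebra of End_V(M) is given as an algebra P with an injective morphism
   rho into End_V(M), which makes M a left P-module. *)
Variables (P : algType C) (rho : P -> M -> M).

Record commutant_subalgebra : Prop := CommutantSubalgebra {
  rho_End : forall x, linear (rho x);
  rho_commute : forall x a n u, rho x (act a n u) = act a n (rho x u);
  rho_linear : forall u, linear (rho ^~ u);
  rho1 : forall u, rho 1 u = u;
  rhoM : forall x y u, rho (x * y) u = rho x (rho y u);
  rho_inj : injective rho
}.

Definition P_projective : Prop :=
  forall (X Y : lmodType P) (g : {linear X -> Y}) (f : M -> Y),
    (forall y, exists x, g x = y) ->
    (forall p u v, f (rho p u + v) = p *: f u + f v) ->
    exists2 h : M -> X,
      (forall p u v, h (rho p u + v) = p *: h u + h v) &
      forall u, g (h u) = f u.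

Definition projective_commutant : Prop :=
  commutant_subalgebra /\ P_projective.

(* P-coordinate systems of a P-submodule W of M; elements of Hom_P(W, P) are
   functions on M of which only the restrictions to W matter. *)
Definition coordinate_system (W : set M) n (u : 'I_n -> M) (f : 'I_n -> M -> P) :
    Prop :=
  [/\ forall i, W (u i),
      forall i p v w, W v -> W w -> f i (rho p v + w) = p * f i v + f i w
    & forall w, W w -> w = \sum_i rho (f i w) (u i)].

(* The choice of coordinate system is immaterial. *)
Definition pseudo_trace (phi : P -> C) (W : set M) (alpha : M -> M) : C :=
  xget 0 [set t | exists n (u : 'I_n -> M) (f : 'I_n -> M -> P),
    coordinate_system W u f /\ t = \sum_i phi (f i (alpha (u i)))].

Definition pseudo_trace_term (phi : P -> C) (r : C) (d : nat) (a : V)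
    (tau : upper_half R) (n : nat) : C^o :=
  pseudo_trace phi (graded_piece r n) (fun u => J 0 a (qL0 r d n tau u)).

Definition pseudo_trace_function (phi : P -> C) (r : C) (d : nat) (a : V)
    (tau : upper_half R) : C :=
  lim (series (pseudo_trace_term phi r d a tau) @ \oo).

(* The extension to V (x) C[G_4, G_6]: by linearity in a, its value at
   v = \sum_i f_i (x) a_i is \sum_i f_i(tau) S(a_i, tau) = S(v(tau), tau). *)
Definition pseudo_trace_function_ext (phi : P -> C) (r : C) (d : nat)
    (v : upper_half R -> V) (tau : upper_half R) : C :=
  pseudo_trace_function phi r d (v tau) tau.

End Commutant.
End Modules.
End VertexAlgebra.

(* Main.v *)
Require Import Defs.
From HB Require Import structures.
From mathcomp Require Import all_boot all_order all_algebra.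
From mathcomp Require Import complex.
From mathcomp Require Import all_classical all_reals all_analysis.
From mathcomp Require Import finmap ring lra zify.
From mathcomp Require Import showcase.summability.
Set Implicit Arguments.
Unset Strict Implicit.
Unset Printing Implicit Defensive.
Import Order.TTheory GRing.Theory Num.Theory.
Import numFieldNormedType.Exports.
Local Open Scope classical_set_scope.
Local Open Scope ring_scope.

(** Cyclicity and a finiteness argument reduce the statement to identities of q-series.

    The pseudo-trace over a graded piece behaves like a trace: it is linear, and, because
    [phi] is symmetric, it is cyclic, even for pairs of maps between two different pieces
    ([ctrace_cyclic], [trace_functionals]).  Zhu's argument for traces uses nothing else.
    Projectivity of [M] over [P] serves to produce coordinate systems of the pieces
    ([projective_coordinates]).

    Let o(a) = J_0(a), let N be the nilpotent part of L_0, and let [ch j n a] be the trace of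
    o(a) N^j over the n-th piece.  Expanding q^(L_0) in powers of N, the pseudo-trace function
    is q^(r - c/24) times the sum over j <= d of (2 pi i tau)^j / j! times the q-series with
    coefficients [ch j n a] ([ptrace_qseries]).

    By the commutator formula and cyclicity, the traces of J_(-m)(b) J_m(a) are sums of
    geometric series in q^m ([tr_lower_raise], [tr_raise_lower]).  The Borcherds identity writes
    the zero modes of Zhu's products of a and b through such pairs of modes, whence a recursion
    for traces ([zhu_recursion]).  The sum over m produces divisor sums, and the change of
    variable z = exp w - 1 produces Bernoulli numbers; together they are the coefficients of the
    Eisenstein series.  One case of the recursion says, together with the vanishing of
    the trace of a_[0] b, that the trace vanishes on O_q(V) ([trace_sq0],
    [trace_sqm2]); the other one, for a = omega, is the differential equation, since o(omega) is
    L_0 and acts on the n-th piece as r + n + N ([trace_conf]).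

    These are identities of formal q-series.  As for convergence, Zhu's finiteness condition
    implies that the vectors of large weight are sums of vectors a_(-2) b, and a_(-2) b is
    a_[-2] b up to lower weight.  By [trace_sqm2] and induction on the weight, all the traces
    are therefore combinations of the traces of finitely many vectors, with coefficients that
    are q-series converging in the unit disc ([zhu_generated]).  For these finitely many vectors
    the differential equation becomes a first-order linear system with a regular singularity at
    q = 0, whose formal solutions converge in the unit disc as well ([subexp_system]).  The
    equation for N^j involves N^(j+1) as an inhomogeneous term, and N^(d+1) = 0, so that one
    descends from j = d ([ch_subexp]).  The q-series can now be multiplied and differentiated
    termwise, and the formal identities become the conditions on one-point functions
    ([ptrace_Oq], [ptrace_qddq]).

    The q-expansions of the Eisenstein series ([eisenstein_q]) come from the partial fraction
    expansion of (pi / sin (pi z))^2, obtained by Herglotz' trick ([Esum_Dfun]): expanding it at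
    tau gives Lipschitz' formula for the rows of the lattice sum ([lipschitz]), and expanding it
    at 0 gives the values of the zeta function at even integers ([zeta_bern1]). *)

(** * Unordered sums of complex families *)

Section ComplexModulus.
Variable R : realType.
Local Notation C := R[i].

(** The real-valued modulus: unlike the norm of [R[i]], it lives in a totally
    ordered field, where linear arithmetic is available. *)
Definition cabs (z : C) : R := ComplexField.Normc.normc z.

Lemma normE (z : C) : `|z| = (cabs z)%:C%C.
Proof. by []. Qed.

Lemma cabs_ge0 z : 0 <= cabs z.
Proof. by case: z => a b; rewrite /cabs /= sqrtr_ge0. Qed.

Lemma cabs0 : cabs 0 = 0.
Proof. exact: ComplexField.Normc.normc0. Qed.

Lemma cabs1 : cabs 1 = 1.
Proof. exact: ComplexField.Normc.normc1. Qed.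

Lemma cabs0_eq z : cabs z = 0 -> z = 0.
Proof. exact: ComplexField.Normc.eq0_normc. Qed.

Lemma cabs_gt0 z : z != 0 -> 0 < cabs z.
Proof.
move=> z0; rewrite lt_neqAle cabs_ge0 andbT eq_sym.
by apply: contra z0 => /eqP /cabs0_eq ->.
Qed.

Lemma cabsM x y : cabs (x * y) = cabs x * cabs y.
Proof. exact: ComplexField.Normc.normcM. Qed.

Lemma cabsV x : cabs x^-1 = (cabs x)^-1.
Proof. exact: ComplexField.Normc.normcV. Qed.

Lemma cabsX x n : cabs (x ^+ n) = cabs x ^+ n.
Proof. by elim: n => [|n IH]; rewrite ?expr0 ?cabs1// !exprS cabsM IH. Qed.

Lemma cabsN x : cabs (- x) = cabs x.
Proof. by apply: complexI; rewrite -!normE normrN. Qed.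

Lemma cabsD x y : cabs (x + y) <= cabs x + cabs y.
Proof. exact: le_normcD. Qed.

Lemma cabs_subD x y : cabs (x - y) <= cabs x + cabs y.
Proof. by rewrite -(cabsN y) cabsD. Qed.

Lemma cabs_ge_sub x y : cabs x - cabs y <= cabs (x + y).
Proof.
rewrite lerBlDr -(cabsN y); apply: le_trans (cabsD _ _).
by rewrite addrK.
Qed.

Lemma cabs_sum (I : Type) (s : seq I) (p : pred I) (F : I -> C) :
  cabs (\sum_(i <- s | p i) F i) <= \sum_(i <- s | p i) cabs (F i).
Proof.
elim/big_rec2: _ => [|i y x _ h]; first by rewrite cabs0.
exact: le_trans (cabsD _ _) (lerD (lexx _) h).
Qed.

Lemma cabsR (x : R) : cabs x%:C%C = `|x|.
Proof. by rewrite /cabs /= expr0n /= addr0 sqrtr_sqr. Qed.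

Lemma natC (n : nat) : (n%:R : C) = (n%:R : R)%:C%C.
Proof. by rewrite (rmorph_nat (real_complex R)). Qed.

Lemma intC (n : int) : (n%:~R : C) = (n%:~R : R)%:C%C.
Proof. by rewrite (rmorph_int (real_complex R)). Qed.

Lemma cabs_nat n : cabs n%:R = n%:R.
Proof. by rewrite natC cabsR ger0_norm. Qed.

Lemma cabs_sqr z : cabs z ^+ 2 = complex.Re z ^+ 2 + complex.Im z ^+ 2.
Proof. by case: z => a b; rewrite /cabs /= sqr_sqrtr ?addr_ge0 ?sqr_ge0. Qed.

Lemma Re_le_cabs z : `|complex.Re z| <= cabs z.
Proof.
rewrite -sqrtr_sqr; case: z => a b; rewrite /cabs /= ler_sqrt ?lerDl ?sqr_ge0//.
by rewrite addr_ge0 ?sqr_ge0.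
Qed.

Lemma Im_le_cabs z : `|complex.Im z| <= cabs z.
Proof.
rewrite -sqrtr_sqr; case: z => a b; rewrite /cabs /= ler_sqrt ?lerDr ?sqr_ge0//.
by rewrite addr_ge0 ?sqr_ge0.
Qed.

Lemma cabs_i : cabs 'i%C = 1.
Proof. by rewrite /cabs /= expr0n /= add0r expr1n sqrtr1. Qed.

Lemma cabs_le_ReIm z : cabs z <= `|complex.Re z| + `|complex.Im z|.
Proof.
rewrite {1}[z]complexE; apply: (le_trans (cabsD _ _)).
by rewrite cabsM cabs_i mul1r !cabsR.
Qed.

Lemma cabs_inj_eps x y : (forall e : R, 0 < e -> cabs (x - y) < e) -> x = y.
Proof.
move=> h; apply/eqP; rewrite -subr_eq0; apply/negPn/negP => /cabs_gt0 /h.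
by rewrite ltxx.
Qed.

End ComplexModulus.

Arguments cabs {R} z : simpl never.

Section UnorderedSum.
Variable R : realType.
Local Notation C := R[i].

Section Basic.
Variable I : choiceType.
Implicit Types (f g : I -> C) (A B : {fset I}).

(** Unordered sums, as in the definition of the Eisenstein series: the net of the finite
    partial sums converges. *)
Definition has_sum f (s : C) := forall e : R, 0 < e ->
  exists A, forall B, (A `<=` B)%fset -> cabs (s - \sum_(i <- B) f i) < e.

Definition abs_summable f := exists b : R, forall A,
  \sum_(i <- A) cabs (f i) <= b.

Lemma has_sum_unique f s t : has_sum f s -> has_sum f t -> s = t.
Proof.
move=> hs ht; apply: cabs_inj_eps => e e0.
have e2 : 0 < e / 2 by rewrite divr_gt0.
have [A hA] := hs _ e2; have [B hB] := ht _ e2.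
have h1 := hA _ (fsubsetUl A B); have h2 := hB _ (fsubsetUr A B).
rewrite (_ : s - t = (s - \sum_(i <- (A `|` B)%fset) f i)
   - (t - \sum_(i <- (A `|` B)%fset) f i)); last by ring.
by apply: le_lt_trans (cabs_subD _ _) _; lra.
Qed.

Lemma eq_has_sum f g s : f =1 g -> has_sum f s -> has_sum g s.
Proof.
move=> fg h e /h [A hA]; exists A => B /hA.
by rewrite (eq_bigr g).
Qed.

Lemma has_sumD f g s t :
  has_sum f s -> has_sum g t -> has_sum (fun i => f i + g i) (s + t).
Proof.
move=> hs ht e e0; have e2 : 0 < e / 2 by rewrite divr_gt0.
have [A hA] := hs _ e2; have [B hB] := ht _ e2.
exists (A `|` B)%fset => D; rewrite fsubUset => /andP[/hA h1 /hB h2].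
rewrite big_split /= opprD addrACA.
by apply: le_lt_trans (cabsD _ _) _; lra.
Qed.

Lemma has_sumZ c f s : has_sum f s -> has_sum (fun i => c * f i) (c * s).
Proof.
move=> hs e e0.
have e2 : 0 < e / (cabs c + 1) by rewrite divr_gt0// ltr_wpDl// cabs_ge0.
have [A hA] := hs _ e2; exists A => B /hA h1.
rewrite -mulr_sumr -mulrBr cabsM.
have c0 := cabs_ge0 c.
move: h1; rewrite ltr_pdivlMr; last by lra.
have := cabs_ge0 (s - \sum_(i <- B) f i); nra.
Qed.

Lemma has_sumN f s : has_sum f s -> has_sum (fun i => - f i) (- s).
Proof.
move=> /(has_sumZ (-1)); rewrite mulN1r; apply: eq_has_sum => i.
by rewrite mulN1r.
Qed.

Lemma has_sumB f g s t :
  has_sum f s -> has_sum g t -> has_sum (fun i => f i - g i) (s - t).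
Proof. by move=> hs ht; apply: has_sumD => //; exact: has_sumN. Qed.

Lemma has_sum_fin f A :
  (forall i, i \notin A -> f i = 0) -> has_sum f (\sum_(i <- A) f i).
Proof.
move=> h e e0; exists A => B AB.
rewrite (big_fset_incl _ AB) ?subrr ?cabs0// => i _ /h //.
Qed.

Lemma has_sum0 : has_sum (fun=> 0) 0.
Proof.
have := @has_sum_fin (fun=> 0) fset0 (fun _ _ => erefl).
by rewrite big_seq_fset0.
Qed.

Lemma has_sum1 f i : (forall j, j != i -> f j = 0) -> has_sum f (f i).
Proof.
move=> h; have := @has_sum_fin f [fset i]%fset.
rewrite big_seq_fset1; apply => j; rewrite inE => /h //.
Qed.

Lemma has_sum_big (J : finType) (F : J -> I -> C) (s : J -> C) :
  (forall j, has_sum (F j) (s j)) ->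
  has_sum (fun i => \sum_j F j i) (\sum_j s j).
Proof.
move=> h.
elim: (index_enum J) => [|j l IH].
  by rewrite big_nil; apply: eq_has_sum has_sum0 => i; rewrite big_nil.
rewrite big_cons; apply: eq_has_sum (has_sumD (h j) IH) => i.
by rewrite big_cons.
Qed.

Lemma has_sum_le f s b :
  has_sum f s -> (forall A, \sum_(i <- A) cabs (f i) <= b) -> cabs s <= b.
Proof.
move=> hs hb; apply/ler_addgt0Pr => e /hs [A /(_ A (fsubset_refl _)) h].
have h2 := cabs_sum A xpredT f; have h3 := hb A.
have := cabsD (s - \sum_(i <- A) f i) (\sum_(i <- A) f i).
rewrite subrK; lra.
Qed.

(** The sum is the supremum of the finite partial sums. *)
Lemma ge0_has_sum (g : I -> R) (b : R) : (forall i, 0 <= g i) ->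
  (forall A, \sum_(i <- A) g i <= b) ->
  exists s : R, has_sum (fun i => (g i)%:C%C) s%:C%C.
Proof.
move=> g0 hb; pose E := [set x : R | exists A : {fset I}, x = \sum_(i <- A) g i].
have Es : has_sup E.
  split; first by exists 0; exists fset0; rewrite big_seq_fset0.
  by exists b => _ [A ->].
exists (sup E) => e e0.
have [_ [A ->] hA] := sup_adherent e0 Es.
exists A => B AB.
rewrite -(raddf_sum (real_complex R)) -(rmorphB (real_complex R)) cabsR.
have h1 : \sum_(i <- B) g i <= sup E by apply: sup_upper_bound => //; exists B.
have h2 : \sum_(i <- A) g i <= \sum_(i <- B) g i.
  rewrite [leRHS](big_fsetID _ (mem A)) /=.
  have -> : [fset x | x in B & x \in A]%fset = A.
    apply/fsetP => x; rewrite !inE /= andbC.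
    by case xA: (x \in A) => //=; rewrite (fsubsetP AB).
  by rewrite lerDl sumr_ge0.
rewrite ger0_norm; lra.
Qed.

(** Split into real and imaginary, positive and negative parts. *)
Lemma abs_summable_has_sum f : abs_summable f -> exists s, has_sum f s.
Proof.
case=> b hb.
have H (g : I -> R) : (forall i, 0 <= g i <= cabs (f i)) ->
    exists s : R, has_sum (fun i => (g i)%:C%C) s%:C%C.
  move=> hg; apply: (@ge0_has_sum g b) => [i|A]; first by have /andP[] := hg i.
  by apply: le_trans (hb A); apply: ler_sum => i _; have /andP[] := hg i.
have hR i := Re_le_cabs (f i); have hI i := Im_le_cabs (f i).
have aR (x : R) : - `|x| <= x <= `|x| by rewrite lerNnormlW// ler_norm.
have [|s1 h1] := H (fun i => (`|complex.Re (f i)| + complex.Re (f i)) / 2).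
  by move=> i; have := hR i; have := aR (complex.Re (f i)); lra.
have [|s2 h2] := H (fun i => (`|complex.Re (f i)| - complex.Re (f i)) / 2).
  by move=> i; have := hR i; have := aR (complex.Re (f i)); lra.
have [|s3 h3] := H (fun i => (`|complex.Im (f i)| + complex.Im (f i)) / 2).
  by move=> i; have := hI i; have := aR (complex.Im (f i)); lra.
have [|s4 h4] := H (fun i => (`|complex.Im (f i)| - complex.Im (f i)) / 2).
  by move=> i; have := hI i; have := aR (complex.Im (f i)); lra.
exists ((s1%:C - s2%:C) + 'i * (s3%:C - s4%:C))%C.
apply: eq_has_sum (has_sumD (has_sumB h1 h2) (has_sumZ 'i%C (has_sumB h3 h4))).
move=> i; rewrite -!(rmorphB (real_complex R)) [RHS]complexE.
by congr (_%:C + 'i * _%:C)%C; lra.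
Qed.

Lemma abs_summable_le f g c : abs_summable f ->
  (forall i, cabs (g i) <= c * cabs (f i)) -> abs_summable g.
Proof.
case=> b hb h; exists (`|c| * b) => A.
apply: (le_trans (ler_sum _ (fun i _ => h i))).
rewrite -mulr_sumr; apply: (@le_trans _ _ (`|c| * \sum_(i <- A) cabs (f i))).
  by apply: ler_wpM2r (ler_norm _); apply: sumr_ge0 => i _; exact: cabs_ge0.
exact: ler_wpM2l.
Qed.

Lemma abs_summableD f g :
  abs_summable f -> abs_summable g -> abs_summable (fun i => f i + g i).
Proof.
move=> [b hb] [b' hb']; exists (b + b') => A.
apply: (@le_trans _ _ (\sum_(i <- A) (cabs (f i) + cabs (g i)))).
  by apply: ler_sum => i _; exact: cabsD.
by rewrite big_split lerD.
Qed.

Lemma sum_cabs_sub f A B : (A `<=` B)%fset ->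
  \sum_(i <- A) cabs (f i) <= \sum_(i <- B) cabs (f i).
Proof.
move=> AB; rewrite [leRHS](big_fsetID _ (mem A)) /=.
have -> : [fset x | x in B & x \in A]%fset = A.
  apply/fsetP => x; rewrite !inE /= andbC.
  by case xA: (x \in A) => //=; rewrite (fsubsetP AB).
by rewrite lerDl sumr_ge0// => i _; exact: cabs_ge0.
Qed.

Lemma abs_summable_fin f A :
  (forall i, i \notin A -> f i = 0) -> abs_summable f.
Proof.
move=> h; exists (\sum_(i <- A) cabs (f i)) => B.
rewrite (big_fsetID _ (mem A)) /= [X in _ + X]big1_fset ?addr0; last first.
  by move=> i; rewrite !inE /= => /andP[_ /h -> _]; rewrite cabs0.
by apply: sum_cabs_sub; apply/fsubsetP => x; rewrite !inE => /andP[].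
Qed.

(** Summability is insensitive to finitely many terms. *)
Lemma abs_summable_near f g A : abs_summable f ->
  (forall i, i \notin A -> cabs (g i) <= cabs (f i)) -> abs_summable g.
Proof.
move=> hf h.
have h1 : abs_summable (fun i => if i \in A then 0 else g i).
  apply: (abs_summable_le (c := 1) hf) => i; rewrite mul1r.
  by case: ifPn => [_|/h//]; rewrite cabs0 cabs_ge0.
have h2 : abs_summable (fun i => if i \in A then g i else 0).
  by apply: (@abs_summable_fin _ A) => i /negbTE ->.
have [b hb] := abs_summableD h1 h2; exists b => B.
apply: le_trans (hb B); apply: ler_sum => i _.
by case: ifP; rewrite ?addr0 ?add0r.
Qed.

Lemma has_sum_cvg f s : has_sum f s -> summability.sum (f : I -> C^o) = s.
Proof.
move=> hs; have FF := @totally_filter I; apply: cvg_lim => //.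
apply/cvgrPdist_lt => e e0.
have ei : complex.Im e = 0 by apply: ger0_Im; exact: ltW.
have er : 0 < complex.Re e by move: e0; rewrite ltcE => /andP[].
have [A hA] := hs _ er; exists A => //= B AB.
rewrite /partial_sum -(big_seq_fsetE _ _ xpredT f) normE ltcE /= ei eqxx /=.
exact: hA.
Qed.

End Basic.

Section Fibers.
Variables I J : choiceType.

(** Rearrangements of unordered sums are instances of summation along the fibres of a
    map: projections give Fubini's theorem, bijections reindexing, addition the Cauchy
    product, and multiplication the divisor sums of Lambert series. *)
Lemma has_sum_fiber (f : I -> C) (p : I -> J) (g : J -> C) (s : C) :
  has_sum f s ->
  (forall j, has_sum (fun i => if p i == j then f i else 0) (g j)) ->
  has_sum g s.
Proof.
move=> hs hg e e0; have e2 : 0 < e / 2 by rewrite divr_gt0.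
have [A hA] := hs _ e2; exists [fset p i | i in A]%fset => B pAB.
pose N : R := (#|` B|)%:R + 1.
have N0 : 0 < N by rewrite /N ltr_wpDl.
have e3 : 0 < e / 2 / N by rewrite divr_gt0.
pose D j := xget fset0 [set D : {fset I} | forall E : {fset I}, (D `<=` E)%fset ->
  cabs (g j - \sum_(i <- E) (if p i == j then f i else 0)) < e / 2 / N].
have hD j (E : {fset I}) : (D j `<=` E)%fset ->
    cabs (g j - \sum_(i <- E) (if p i == j then f i else 0)) < e / 2 / N.
  rewrite /D; case: xgetP => [D' _ h|no]; first exact: h.
  by have [D' hD'] := hg j _ e3; have := no D' hD'.
pose U := (A `|` \bigcup_(j <- B) D j)%fset.
have UA : (A `<=` [fset i in U | p i \in B])%fset.
  apply/fsubsetP => i iA; rewrite !inE iA /=.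
  by apply: (fsubsetP pAB); apply: in_imfset.
have UD j : j \in B -> (D j `<=` U)%fset.
  move=> jB; apply: fsubset_trans (fsubsetUr _ _).
  apply/fsubsetP => x xD; apply/bigfcupP; exists j => //; rewrite jB //.
have E : \sum_(i <- [fset i in U | p i \in B]%fset) f i =
    \sum_(j <- B) \sum_(i <- U) (if p i == j then f i else 0).
  rewrite exchange_big /= -big_fset_condE big_mkcond /=; apply: eq_bigr => i _.
  case: ifPn => [pB|pB].
    by rewrite (bigD1_seq (p i)) //= eqxx big1 ?addr0// => j /negbTE; rewrite eq_sym => ->.
  rewrite big1_seq // => j /= jB; case: eqP => // pij.
  by move: pB; rewrite pij jB.
have h1 := hA _ UA; rewrite E in h1.
have h2 : cabs (\sum_(j <- B) (g j - \sum_(i <- U) (if p i == j then f i else 0)))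
    <= e / 2.
  apply: (le_trans (cabs_sum _ _ _)).
  apply: (@le_trans _ _ (\sum_(j <- B) (e / 2 / N))).
    rewrite big_seq [leRHS]big_seq; apply: ler_sum => j jB; apply: ltW; apply: hD.
    exact: UD.
  rewrite big_const_seq count_predT iter_addr_0 -(mulr_natr (e / 2 / N)).
  rewrite mulrAC ler_pdivrMr//; apply: ler_wpM2l; [lra|rewrite /N; lra].
rewrite sumrB in h2.
rewrite (_ : s - _ = s - \sum_(j <- B) \sum_(i <- U) (if p i == j then f i else 0)
   - (\sum_(j <- B) g j - \sum_(j <- B) \sum_(i <- U) (if p i == j then f i else 0)));
  last by ring.
by apply: le_lt_trans (cabs_subD _ _) _; lra.
Qed.

End Fibers.

Section Reindex.
Variables I J : choiceType.

Lemma has_sum_bij (f : I -> C) (h : J -> I) (h' : I -> J) (s : C) :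
  cancel h h' -> cancel h' h -> has_sum f s -> has_sum (fun j => f (h j)) s.
Proof.
move=> hK h'K hs; apply: (has_sum_fiber (p := h') hs) => j.
have := @has_sum1 _ (fun i => if h' i == j then f i else 0) (h j).
rewrite hK eqxx; apply => i ij; case: eqP => // E.
by move: ij; rewrite -E h'K eqxx.
Qed.

Lemma sum_row_fset (S : nmodType) (A : {fset I * J}) (i : I) (F : J -> S) :
  \sum_(x <- A | x.1 == i) F x.2 = \sum_(j <- [fset x.2 | x in A & x.1 == i]%fset) F j.
Proof.
rewrite big_imfset /= ?big_filter//.
by move=> [x y] [x' y'] /andP[_ /eqP/= ->] /andP[_ /eqP/= ->] /= ->.
Qed.

Lemma abs_summable_prod (f : I * J -> C) (b : I -> R) (B : R) :
  (forall i (A : {fset J}), \sum_(j <- A) cabs (f (i, j)) <= b i) ->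
  (forall A : {fset I}, \sum_(i <- A) b i <= B) -> abs_summable f.
Proof.
move=> hb hB; exists B => A.
pose A1 := [fset x.1 | x in A]%fset.
rewrite (partition_big_imfset _ fst) /=; apply: le_trans (hB A1).
apply: ler_sum => i _.
apply: le_trans (hb i [fset x.2 | x in A & x.1 == i]%fset).
rewrite -sum_row_fset; apply: ler_sum => -[x y] /= /eqP ->//.
Qed.

Lemma abs_summableM (f : I -> C) (g : J -> C) :
  abs_summable f -> abs_summable g -> abs_summable (fun x : I * J => f x.1 * g x.2).
Proof.
move=> [b hb] [b' hb'].
apply: (@abs_summable_prod _ (fun i => cabs (f i) * b') (b * b')) => [i A|A] /=.
  under eq_bigr do rewrite cabsM; rewrite -mulr_sumr; apply: ler_wpM2l => //.
  exact: cabs_ge0.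
rewrite -mulr_suml; apply: ler_wpM2r => //.
by have := hb' fset0; rewrite big_seq_fset0.
Qed.

Lemma has_sum_row (f : I * J -> C) (i : I) (s : C) :
  has_sum (fun j => f (i, j)) s ->
  has_sum (fun x => if x.1 == i then f x else 0) s.
Proof.
move=> hs e /hs [A hA]; exists [fset (i, j) | j in A]%fset => B AB.
have := hA [fset x.2 | x in B & x.1 == i]%fset.
rewrite -sum_row_fset big_mkcond /= => h.
rewrite (eq_bigr (fun x => if x.1 == i then f (i, x.2) else 0)).
  apply: h; apply/fsubsetP => j jA; apply/imfsetP; exists (i, j) => //.
  by rewrite !inE /= eqxx andbT (fsubsetP AB)// in_imfset.
by move=> [x y] _ /=; case: eqP => // ->.
Qed.

Lemma has_sum_fubini (f : I * J -> C) (g : I -> C) (s : C) :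
  has_sum f s -> (forall i, has_sum (fun j => f (i, j)) (g i)) -> has_sum g s.
Proof.
move=> hs hg; apply: (has_sum_fiber (p := fst) hs) => i.
exact/has_sum_row/hg.
Qed.

End Reindex.

Lemma has_sum_fubini2 (I J : choiceType) (f : I * J -> C) (g : J -> C) (s : C) :
  has_sum f s -> (forall j, has_sum (fun i => f (i, j)) (g j)) -> has_sum g s.
Proof.
move=> hs hg.
pose sw I J := fun x : I * J => (x.2, x.1).
have := @has_sum_bij _ _ f (sw J I) (sw I J) s.
move=> /(_ _ _ hs) hs'; apply: (has_sum_fubini (hs' _ _)) => //.
- by case.
- by case.
Qed.

Lemma has_sum_mul (I J : choiceType) (f : I -> C) (g : J -> C) (s t : C) :
  abs_summable f -> abs_summable g -> has_sum f s -> has_sum g t ->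
  has_sum (fun x : I * J => f x.1 * g x.2) (s * t).
Proof.
move=> fs gs hs ht.
have [u hu] := abs_summable_has_sum (abs_summableM fs gs).
suff -> : s * t = u by [].
apply: (@has_sum_unique _ (fun i => f i * t)).
  by rewrite mulrC; apply: eq_has_sum (has_sumZ t hs) => i; rewrite mulrC.
by apply: (has_sum_fubini hu) => i /=; exact: has_sumZ.
Qed.

(** ** Sequences *)

Lemma in_fset_iota n i : i \in [fset i | i in iota 0 n]%fset = (i < n)%N.
Proof. by rewrite in_fset; exact: mem_iota. Qed.

Lemma sum_fset_iota (S : nmodType) n (F : nat -> S) :
  \sum_(i <- [fset i | i in iota 0 n]%fset) F i = \sum_(i < n) F i.
Proof.
rewrite big_imfset //= -(big_mkord xpredT F) /index_iota subn0.
by rewrite (undup_id (iota_uniq 0 n)).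
Qed.

(** A finite set of indices is contained in an initial segment. *)
Lemma has_sum_series (f : nat -> C) s : has_sum f s ->
  series (f : nat -> C^o) @ \oo --> (s : C^o).
Proof.
move=> hs; apply/cvgrPdist_lt => e e0.
have ei : complex.Im e = 0 by apply: ger0_Im; exact: ltW.
have er : 0 < complex.Re e by move: e0; rewrite ltcE => /andP[].
have [A hA] := hs _ er.
pose N := (\max_(i <- A) i).+1.
exists N => // n /= Nn.
rewrite /series /= normE ltcE /= ei eqxx /=.
rewrite big_mkord -(sum_fset_iota n f).
apply: hA; apply/fsubsetP => i iA; rewrite in_fset_iota.
apply: leq_trans Nn; rewrite /N ltnS.
by rewrite (leq_bigmax_seq (F := id)).
Qed.

Lemma abs_summable_nat (f : nat -> C) (b : R) :
  (forall n, \sum_(i < n) cabs (f i) <= b) -> abs_summable f.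
Proof.
move=> h; exists b => A.
pose N := (\max_(i <- A) i).+1.
apply: le_trans (h N).
rewrite -(sum_fset_iota N (fun i => cabs (f i))).
apply: sum_cabs_sub; apply/fsubsetP => i iA; rewrite in_fset_iota.
by rewrite /N ltnS (leq_bigmax_seq (F := id)).
Qed.

Lemma abs_summable_geom (B x : R) (f : nat -> C) : 0 <= x < 1 ->
  (forall n, cabs (f n) <= B * x ^+ n) -> abs_summable f.
Proof.
move=> /andP[x0 x1] h.
have B0 : 0 <= B by have := h 0%N; rewrite expr0 mulr1; apply: le_trans; exact: cabs_ge0.
apply: (@abs_summable_nat _ (B / (1 - x))) => n.
apply: (le_trans (ler_sum _ (fun (i : 'I_n) _ => h i))).
rewrite -mulr_sumr; apply: ler_wpM2l => //.
have : (1 - x) * \sum_(i < n) x ^+ i = 1 - x ^+ n.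
  by rewrite -opprB mulNr -subrX1 opprB.
have : 0 <= x ^+ n by rewrite exprn_ge0.
rewrite -div1r ler_pdivlMr; last by lra.
lra.
Qed.

Definition conv (f g : nat -> C) (n : nat) : C := \sum_(i < n.+1) f i * g (n - i)%N.

(** The products f_i g_j are grouped by i + j. *)
Lemma has_sum_conv (f g : nat -> C) (s t x : C) :
  abs_summable (fun n => f n * x ^+ n) -> abs_summable (fun n => g n * x ^+ n) ->
  has_sum (fun n => f n * x ^+ n) s -> has_sum (fun n => g n * x ^+ n) t ->
  has_sum (fun n => conv f g n * x ^+ n) (s * t).
Proof.
move=> fs gs hs ht.
apply: (has_sum_fiber (p := fun ij : nat * nat => (ij.1 + ij.2)%N)
  (has_sum_mul fs gs hs ht)) => n /=.
pose A := [fset (nat_of_ord i, (n - i)%N) | i in 'I_n.+1]%fset.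
have := @has_sum_fin _ (fun ij : nat * nat => if (ij.1 + ij.2 == n)%N
  then f ij.1 * x ^+ ij.1 * (g ij.2 * x ^+ ij.2) else 0) A.
rewrite big_imfset /=; last by move=> i j _ _ [/val_inj].
rewrite (_ : \big[_/_]_(i <- _) _ = conv f g n * x ^+ n).
  apply; case=> i j /= ijA; case: eqP => // ijn; case/negP: ijA.
  have ilt : (i < n.+1)%N by lia.
  apply/imfsetP; exists (Ordinal ilt) => //=; congr (_, _); lia.
rewrite /conv mulr_suml big_enum; apply: eq_bigr => i _.
have il : (i <= n)%N by rewrite -ltnS ltn_ord.
have -> : x ^+ n = x ^+ i * x ^+ (n - i) by rewrite -exprD subnKC.
by rewrite subnKC// eqxx; ring.
Qed.

End UnorderedSum.

(** * Formal power series and the change of variable z = exp w - 1 *)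

Section FormalPowerSeries.
Variable K : fieldType.

Definition fps : Type := nat -> K.

HB.instance Definition _ := gen_eqMixin fps.
HB.instance Definition _ := gen_choiceMixin fps.

Definition fps_add (f g : fps) : fps := fun n => f n + g n.
Definition fps_opp (f : fps) : fps := fun n => - f n.
Definition fps_zero : fps := fun=> 0.
Definition fps_mul (f g : fps) : fps := fun n => \sum_(i < n.+1) f i * g (n - i)%N.
Definition fps_one : fps := fun n => (n == 0%N)%:R.

Lemma fps_addA : associative fps_add.
Proof. by move=> f g h; apply/funext => n; rewrite /fps_add addrA. Qed.

Lemma fps_addC : commutative fps_add.
Proof. by move=> f g; apply/funext => n; rewrite /fps_add addrC. Qed.

Lemma fps_add0 : left_id fps_zero fps_add.
Proof. by move=> f; apply/funext => n; rewrite /fps_add add0r. Qed.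

Lemma fps_addN : left_inverse fps_zero fps_opp fps_add.
Proof. by move=> f; apply/funext => n; rewrite /fps_add addNr. Qed.

HB.instance Definition _ :=
  GRing.isZmodule.Build fps fps_addA fps_addC fps_add0 fps_addN.

(** The ring laws of formal power series are checked on truncations, where they are those
    of polynomials. *)
Definition trunc N (f : fps) : {poly K} := \poly_(i < N) f i.

Lemma fps_mul_trunc f g n N : (n < N)%N ->
  fps_mul f g n = (trunc N f * trunc N g)`_n.
Proof.
move=> nN; rewrite coefM; apply: eq_bigr => i _.
have iN : (i <= n)%N by rewrite -ltnS.
by rewrite !coef_poly !ifT//; lia.
Qed.

Lemma fps_mulC : commutative fps_mul.
Proof.
by move=> f g; apply/funext => n; rewrite !(@fps_mul_trunc _ _ n n.+1)// mulrC.
Qed.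

Lemma fps_mulA : associative fps_mul.
Proof.
move=> f g h; apply/funext => n.
have E f1 f2 i : (i <= n)%N -> fps_mul f1 f2 i = (trunc n.+1 f1 * trunc n.+1 f2)`_i.
  by move=> il; apply: fps_mul_trunc.
transitivity ((trunc n.+1 f * (trunc n.+1 g * trunc n.+1 h))`_n).
  rewrite coefM; apply: eq_bigr => i _; rewrite E ?leq_subr//.
  by rewrite coef_poly ltn_ord.
rewrite mulrA coefM; apply: eq_bigr => i _; rewrite E; last by rewrite -ltnS.
by rewrite coef_poly ifT//; lia.
Qed.

Lemma fps_mul1 : left_id fps_one fps_mul.
Proof.
move=> f; apply/funext => n; rewrite /fps_mul big_ord_recl big1 /=.
  by rewrite /fps_one mul1r addr0 subn0.
by move=> i _; rewrite /fps_one mul0r.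
Qed.

Lemma fps_mulDl : left_distributive fps_mul fps_add.
Proof.
move=> f g h; apply/funext => n; rewrite /fps_mul /fps_add -big_split.
by apply: eq_bigr => i _; rewrite mulrDl.
Qed.

Lemma fps_one_neq0 : fps_one != 0 :> fps.
Proof.
apply/eqP => /(congr1 (fun f : fps => f 0%N)); apply/eqP; exact: oner_neq0.
Qed.

HB.instance Definition _ := GRing.Zmodule_isComNzRing.Build fps
  fps_mulA fps_mulC fps_mul1 fps_mulDl fps_one_neq0.

Lemma fpsD (f g : fps) n : (f + g) n = f n + g n. Proof. by []. Qed.

Lemma fpsN (f : fps) n : (- f) n = - f n. Proof. by []. Qed.

Lemma fps0 n : (0 : fps) n = 0. Proof. by []. Qed.

Lemma fps1 n : (1 : fps) n = (n == 0%N)%:R. Proof. by []. Qed.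

Lemma fpsM (f g : fps) n : (f * g) n = \sum_(i < n.+1) f i * g (n - i)%N.
Proof. by []. Qed.

Lemma fpsM0 (f g : fps) : (f * g) 0%N = f 0%N * g 0%N.
Proof. by rewrite fpsM big_ord_recl big_ord0 addr0. Qed.

Lemma fps_sum I (s : seq I) (p : pred I) (F : I -> fps) n :
  (\sum_(i <- s | p i) F i) n = \sum_(i <- s | p i) F i n.
Proof. by elim/big_rec2: _ => // i x y _ <-. Qed.

Definition fpsC (c : K) : fps := fun n => c *+ (n == 0%N).
Definition fpsX : fps := fun n => (n == 1%N)%:R.

Lemma fpsCM c f n : (fpsC c * f) n = c * f n.
Proof.
rewrite fpsM big_ord_recl big1 /= ?addr0 ?subn0 // => i _.
by rewrite /fpsC /= mulr0n mul0r.
Qed.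

Lemma fpsXM f n : (fpsX * f) n.+1 = f n.
Proof.
rewrite fpsM 2!big_ord_recl big1 /= => [|i _]; last by rewrite /fpsX /= mul0r.
by rewrite /fpsX /= mul0r add0r mul1r addr0 subSS subn0.
Qed.

Lemma fpsXM0 f : (fpsX * f) 0%N = 0.
Proof. by rewrite fpsM0 /fpsX mul0r. Qed.

(** The Euler derivation w d/dw. *)
Definition theta (f : fps) : fps := fun n => n%:R * f n.

Lemma thetaM f g : theta (f * g) = theta f * g + f * theta g.
Proof.
apply/funext => n; rewrite fpsD !fpsM /theta fpsM mulr_sumr -big_split.
apply: eq_bigr => i _ /=; have il : (i <= n)%N by rewrite -ltnS.
by rewrite -{1}(subnKC il) natrD; ring.
Qed.

Lemma theta1 : theta 1 = 0.
Proof.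
by apply/funext => -[|n]; rewrite /theta fps1 fps0 ?mul0r// mulr0.
Qed.

Lemma thetaX_exp f n : theta (f ^+ n.+1) = n.+1%:R * f ^+ n * theta f.
Proof.
elim: n => [|n IH]; first by rewrite expr1 expr0; ring.
by rewrite exprS thetaM IH -(natr1 n.+1) exprS; ring.
Qed.

(** A series with constant term 1 is regular, so that it can be cancelled. *)
Lemma fps_lreg (f g : fps) : f 0%N = 1 -> f * g = 0 -> g = 0.
Proof.
move=> f0 fg; apply/funext => n; elim/ltn_ind: n => n IH.
have := congr1 (fun h : fps => h n) fg; rewrite fpsM big_ord_recl f0 mul1r subn0.
rewrite big1 ?addr0// => i _ /=; rewrite IH ?fps0 ?mulr0//.
have := ltn_ord i; rewrite /bump /=; lia.
Qed.

Lemma fps_cancel (f g h : fps) : f 0%N = 1 -> f * g = f * h -> g = h.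
Proof.
move=> f0 fgh; apply/eqP; rewrite -subr_eq0; apply/eqP; apply: (fps_lreg f0).
by rewrite mulrBr fgh subrr.
Qed.

Definition eq_upto N (f g : fps) := forall n, (n <= N)%N -> f n = g n.

Lemma eq_uptoM N f g f' g' :
  eq_upto N f f' -> eq_upto N g g' -> eq_upto N (f * g) (f' * g').
Proof.
move=> ff gg n nN; rewrite !fpsM; apply: eq_bigr => i _.
by rewrite ff ?gg//; have := ltn_ord i; lia.
Qed.

Lemma eq_upto_exp N f f' i : eq_upto N f f' -> eq_upto N (f ^+ i) (f' ^+ i).
Proof.
move=> ff; elim: i => [|i IH]; first by rewrite !expr0 => n.
by rewrite !exprS; apply: eq_uptoM.
Qed.

Lemma fps_exp_lt (f : fps) i n : f 0%N = 0 -> (n < i)%N -> (f ^+ i) n = 0.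
Proof.
move=> f0; elim: i n => // i IH n ni; rewrite exprS fpsM big1// => j _.
case: j => -[|j] /= jn; first by rewrite f0 mul0r.
by rewrite IH ?mulr0//; lia.
Qed.

Definition fps_of_poly (p : {poly K}) : fps := fun n => p`_n.

Lemma fps_of_polyM p q : fps_of_poly (p * q) = fps_of_poly p * fps_of_poly q.
Proof. by apply/funext => n; rewrite /fps_of_poly coefM. Qed.

Lemma fps_of_polyX p i : fps_of_poly (p ^+ i) = fps_of_poly p ^+ i.
Proof.
elim: i => [|i IH]; last by rewrite !exprS fps_of_polyM IH.
by rewrite !expr0; apply/funext => n; rewrite /fps_of_poly coef1 fps1.
Qed.

End FormalPowerSeries.

Section ExponentialSeries.
Variable R : realType.
Local Notation C := R[i].
Local Notation fps := (fps C).

(** [fexp x] is exp (x w), [fE] is (exp w - 1) / w, and [fEpow s] is its power with an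
    integer exponent, by the binomial series in [fE - 1]; the terms beyond the n-th do not
    contribute to the n-th coefficient, as [fE - 1] has no constant term. *)
Definition fexp (x : C) : fps := fun n => x ^+ n / (n`!)%:R.
Definition fE : fps := fun n => ((n.+1)`!)%:R^-1.
Definition fEpow (s : int) : fps := fun n =>
  (\sum_(i < n.+1) fpsC (binz R s i) * (fE - 1) ^+ i) n.

Lemma fact_neq0 n : (n`!%:R : C) != 0.
Proof. by rewrite pnatr_eq0 -lt0n fact_gt0. Qed.

Lemma fE0 : fE 0%N = 1.
Proof. by rewrite /fE invr1. Qed.

Lemma fexp0 x : fexp x 0%N = 1.
Proof. by rewrite /fexp expr0 fact0 divr1. Qed.

Lemma fE1_0 : (fE - 1) 0%N = 0.
Proof. by rewrite fpsD fpsN fE0 fps1 subrr. Qed.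

Lemma fexpD x y : fexp (x + y) = fexp x * fexp y.
Proof.
apply/funext => n; rewrite fpsM /fexp addrC exprDn mulr_suml.
apply: eq_bigr => i _; have il : (i <= n)%N by rewrite -ltnS.
have := bin_fact il => /(congr1 (fun k => k%:R : C)); rewrite !natrM => h.
have := fact_neq0 n; rewrite -mulr_natr -h !mulf_eq0 !negb_or.
by move=> /and3P[_ h2 /andP[h3 h4]]; field; rewrite h2 h3 h4.
Qed.

Lemma fexp_shift : fpsX C * fE = fexp 1 - 1.
Proof.
apply/funext => -[|n]; rewrite fpsD fpsN fps1 /=.
  by rewrite fpsXM0 fexp0 subrr.
by rewrite fpsXM subr0 /fexp expr1n div1r.
Qed.

Lemma theta_fexp x : theta (fexp x) = fpsC x * (fpsX C * fexp x).
Proof.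
apply/funext => -[|n]; rewrite fpsCM /theta; first by rewrite fpsXM0 mul0r mulr0.
rewrite fpsXM /fexp factS natrM exprS.
have := fact_neq0 n.+1; rewrite factS natrM mulf_eq0 negb_or -natr1 => /andP[h1 h2].
by field; rewrite h1 h2.
Qed.

Lemma theta_fE : theta fE = fexp 1 - fE.
Proof.
apply/funext => n; rewrite fpsD fpsN /theta /fE /fexp expr1n.
have := fact_neq0 n.+1; rewrite factS natrM mulf_eq0 negb_or -natr1 => /andP[h1 h2].
by field; rewrite h1 h2.
Qed.

Lemma binz0r s : binz R s 0 = 1.
Proof. by rewrite /binz big_ord0 fact0 divr1. Qed.

Lemma binz0l i : binz R 0 i.+1 = 0.
Proof. by rewrite /binz big_ord_recl subrr !mul0r. Qed.

Lemma binz_pascal s i : binz R (s + 1) i.+1 = binz R s i.+1 + binz R s i.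
Proof.
rewrite /binz big_ord_recl big_ord_recr /=.
rewrite (eq_bigr (fun j : 'I_i => (s - j%:Z)%:~R)) => [|j _]; last first.
  by congr (_%:~R); rewrite /bump /=; lia.
have := fact_neq0 i.+1; rewrite factS natrM mulf_eq0 negb_or => /andP[h1 h2].
rewrite !(rmorphB, rmorphD) /= -!natr1.
move: h1; rewrite -natr1 => h1.
by field; rewrite h1 h2.
Qed.

Lemma fEpow_upto N s :
  eq_upto N (fEpow s) (\sum_(i < N.+1) fpsC (binz R s i) * (fE - 1) ^+ i).
Proof.
move=> n nN; rewrite /fEpow !fps_sum.
rewrite -!(big_mkord xpredT (fun i => (fpsC (binz R s i) * (fE - 1) ^+ i) n)).
rewrite [RHS](big_cat_nat _ (n := n.+1)) //= -[LHS]addr0; congr (_ + _).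
rewrite big_nat_cond big1//.
by move=> i /andP[/andP[ni _] _]; rewrite fpsCM fps_exp_lt ?mulr0// fE1_0.
Qed.

Lemma fEpow0 : fEpow 0 = 1.
Proof.
apply/funext => n; rewrite /fEpow big_ord_recl big1 ?addr0 => [|i _].
  by rewrite fpsCM binz0r mul1r expr0.
by apply/funext => m; rewrite fpsCM binz0l mul0r.
Qed.

Lemma fEpow_at0 s : fEpow s 0%N = 1.
Proof. by rewrite /fEpow big_ord_recl big_ord0 addr0 fpsCM binz0r mul1r expr0. Qed.

(** Pascal's rule for the binomial coefficients. *)
Lemma fEpowS s : fEpow s * fE = fEpow (s + 1).
Proof.
have -> : fE = 1 + (fE - 1) by ring.
rewrite mulrDr mulr1; apply/funext => n; rewrite fpsD.
rewrite (eq_uptoM (fEpow_upto (N := n) s) (fun _ _ => erefl) (leqnn n)).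
rewrite mulr_suml fps_sum /fEpow !fps_sum [X in X + _ = _]big_ord_recl [RHS]big_ord_recl.
rewrite -addrA; congr (_ + _); first by rewrite !binz0r.
under [RHS]eq_bigr => i _ do rewrite fpsCM binz_pascal mulrDl -!fpsCM.
rewrite big_split; congr (_ + _).
rewrite big_ord_recr /=.
rewrite -mulrA -exprSr fpsCM fps_exp_lt ?fE1_0// mulr0 addr0.
by apply: eq_bigr => i _; rewrite -mulrA -exprSr.
Qed.

Lemma fEpow_expE n : fEpow (- n%:Z) * fE ^+ n = 1.
Proof.
elim: n => [|n IH]; first by rewrite oppr0 fEpow0 mul1r expr0.
by rewrite exprS mulrA fEpowS (_ : - n.+1%:Z + 1 = - n%:Z) //; lia.
Qed.

Lemma fE_exp0 n : (fE ^+ n) 0%N = 1.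
Proof. by elim: n => [|n IH]; rewrite ?expr0 ?fps1// exprS fpsM0 IH fE0 mulr1. Qed.

Lemma fEpowD s n : fEpow s * fEpow (- n%:Z) = fEpow (s - n%:Z).
Proof.
elim: n s => [|n IH] s; first by rewrite oppr0 fEpow0 subr0 mulr1.
apply: (fps_cancel fE0).
transitivity (fEpow s * (fEpow (- n.+1%:Z) * fE)); first by ring.
rewrite fEpowS [in RHS]mulrC fEpowS.
by rewrite (_ : - n.+1%:Z + 1 = - n%:Z) ?IH; [congr fEpow|]; lia.
Qed.

(** Differentiating [fEpow (- n) * fE ^+ n = 1]. *)
Lemma theta_fEpow n :
  theta (fEpow (- n%:Z)) = - n%:R * fEpow (- n.+1%:Z) * (fexp 1 - fE).
Proof.
apply: (fps_cancel (fE_exp0 n)); rewrite [LHS]mulrC.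
have := congr1 (@theta _) (fEpow_expE n); rewrite thetaM theta1.
move/eqP; rewrite addr_eq0 => /eqP ->.
case: n => [|n]; first by rewrite expr0 theta1 ; ring.
rewrite thetaX_exp theta_fE.
have -> : fE ^+ n.+1 * (- n.+1%:R * fEpow (- n.+2%:Z) * (fexp 1 - fE)) =
  - (fEpow (- n.+2%:Z) * fE * (n.+1%:R * fE ^+ n * (fexp 1 - fE))).
  by rewrite exprS; ring.
by rewrite fEpowS (_ : - n.+2%:Z + 1 = - n.+1%:Z) //; lia.
Qed.

(** Binomial coefficients with a complex argument, for the recursion of [residue_exp]. *)
Definition fbin (x : C) i := (\prod_(j < i) (x - j%:R)) / (i`!)%:R.

Lemma binz_fbin s i : binz R s i = fbin s%:~R i.
Proof.
rewrite /binz /fbin; congr (_ / _); apply: eq_bigr => j _.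
by rewrite rmorphB.
Qed.

Lemma fbinS x i : fbin x i.+1 * i.+1%:R = x * fbin (x - 1) i.
Proof.
rewrite /fbin big_ord_recl /= subr0.
rewrite (eq_bigr (fun j : 'I_i => x - 1 - j%:R)) => [|j _]; last first.
  by rewrite /bump /= natrD; ring.
have := fact_neq0 i.+1; rewrite factS natrM mulf_eq0 negb_or => /andP[h1 h2].
by field; rewrite nat1r h1 h2.
Qed.

(** The residue of exp ((x + 1) w) / (exp w - 1) ^ (i + 1) dw is that of
    (1 + z) ^ x / z ^ (i + 1) dz.  The recursion in [i] comes from the vanishing of
    the residue of the derivative of exp (x w) / (exp w - 1) ^ i. *)
Lemma residue_exp x i : (fEpow (- i.+1%:Z) * fexp (x + 1)) i = fbin x i.
Proof.
elim: i x => [|i IH] x; first by rewrite fpsM0 fEpow_at0 fexp0 /fbin big_ord0 fact0 divr1 mulr1.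
have i0 : (i.+1%:R : C) != 0 by rewrite pnatr_eq0.
apply: (mulIf i0); rewrite fbinS -IH subrK [LHS]mulrC.
have H : theta (fEpow (- i.+1%:Z) * fexp x) = i.+1%:R * (fEpow (- i.+1%:Z) * fexp x)
    - i.+1%:R * (fEpow (- i.+2%:Z) * fexp (x + 1))
    + fpsC x * (fpsX C * (fEpow (- i.+1%:Z) * fexp x)).
  rewrite thetaM theta_fEpow theta_fexp fexpD.
  have -> : fEpow (- i.+1%:Z) = fEpow (- i.+2%:Z) * fE.
    by rewrite fEpowS; congr fEpow; lia.
  ring.
have := congr1 (fun f : fps => f i.+1) H; rewrite !fpsD fpsN fpsCM fpsXM /theta.
have N n f m : (n%:R * f : fps) m = n%:R * f m.
  by rewrite !mulr_natl; elim: n => // n; rewrite !mulrS => <-.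
rewrite !N => h; apply/eqP; rewrite -subr_eq0 -oppr_eq0; apply/eqP.
transitivity (i.+1%:R * (fEpow (- i.+1%:Z) * fexp x) i.+1
  - i.+1%:R * (fEpow (- i.+1%:Z) * fexp x) i.+1 : C); last by rewrite subrr.
by rewrite {1}h; ring.
Qed.

(** The polynomials in the definition of [exp_coef] are truncations of the series above. *)
Lemma exp_coefE s k j : exp_coef R s k j = (fEpow s * fexp k%:R) j.
Proof.
rewrite /exp_coef.
set u := \poly_(i < j.+1) _ - 1; set e := \poly_(i < j.+1) _.
have ue : eq_upto j (fE - 1) (fps_of_poly u).
  move=> n nj; rewrite /fps_of_poly coefB coef_poly ltnS nj coef1 fpsD fpsN fps1.
  by [].
have ee : eq_upto j (fexp k%:R) (fps_of_poly e).
  by move=> n nj; rewrite /fps_of_poly coef_poly ltnS nj.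
have su : eq_upto j (fEpow s) (fps_of_poly (\sum_(i < j.+1) binz R s i *: u ^+ i)).
  move=> n nj; rewrite (fEpow_upto s nj) fps_sum /fps_of_poly coef_sum.
  apply: eq_bigr => i _; rewrite fpsCM coefZ; congr (_ * _).
  by rewrite (eq_upto_exp i ue nj) -fps_of_polyX.
by rewrite (eq_uptoM su ee (leqnn j)) -fps_of_polyM.
Qed.

Lemma exp_coef0 s k : exp_coef R s k 0 = 1.
Proof. by rewrite exp_coefE fpsM0 fEpow_at0 fexp0 mulr1. Qed.

(** exp w * (w / (exp w - 1)) ^ (e + 1): for [e = 0] these are the Bernoulli
    numbers divided by factorials, for [e = 1] the expansion of
    w ^ 2 exp w / (exp w - 1) ^ 2. *)
Definition bern (e : nat) : fps := fEpow (- e.+1%:Z) * fexp 1.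

(** The coefficients of (1 + z)^(m + k - 1), with z = exp w - 1, are residues in w; expanding
    exp (m w) separates the dependence on m. *)
Lemma binz_exp_coef (m : int) (k i : nat) :
  binz R (m + k%:Z - 1) i =
  \sum_(s < i.+1) m%:~R ^+ s / (s`!)%:R * exp_coef R (- i.+1%:Z) k (i - s).
Proof.
rewrite binz_fbin -residue_exp.
under [RHS]eq_bigr => s _ do rewrite exp_coefE.
rewrite -(fpsM (fexp m%:~R)) mulrCA -fexpD; congr ((_ * fexp _) _).
by rewrite !(rmorphB, rmorphD) /= ; ring.
Qed.

(** The same residues, with the factor exp w (w / (exp w - 1))^(e + 1) split off. *)
Lemma binz_bern (e k i : nat) :
  binz R k i = \sum_(s < i.+1) bern e s * exp_coef R (e%:Z - i%:Z) k (i - s).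
Proof.
rewrite binz_fbin -residue_exp.
under [RHS]eq_bigr => s _ do rewrite exp_coefE.
rewrite -(fpsM (bern e)) /bern.
have -> : fEpow (- e.+1%:Z) * fexp 1 * (fEpow (e%:Z - i%:Z) * fexp k%:R) =
  (fEpow (e%:Z - i%:Z) * fEpow (- e.+1%:Z)) * (fexp k%:R * fexp 1) by ring.
by rewrite fEpowD -fexpD; congr ((fEpow _ * _) _); lia.
Qed.

Lemma bern_at0 e : bern e 0%N = 1.
Proof. by rewrite /bern fpsM0 fEpow_at0 fexp0 mulr1. Qed.

Lemma bern1E2 : bern 1 * fE ^+ 2 = fexp 1.
Proof. by rewrite /bern mulrAC fEpow_expE mul1r. Qed.

(** exp w / (exp w - 1) ^ 2 is minus the derivative of exp w / (exp w - 1). *)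
Lemma bern1_bern0 n : bern 1 n = (1 - n%:R) * bern 0 n.
Proof.
have bE : bern 0 * fE = fexp 1.
  by rewrite /bern mulrAC -[fE in LHS]expr1 fEpow_expE mul1r.
suff -> : bern 1 = bern 0 - theta (bern 0) by rewrite fpsD fpsN /theta; ring.
apply: (fps_cancel (fE_exp0 2)); rewrite mulrC bern1E2.
have H : theta (bern 0) * fE = fpsX C * fexp 1 - bern 0 * (fexp 1 - fE).
  have := congr1 (@theta _) bE; rewrite thetaM theta_fE theta_fexp.
  have -> : fpsC (1 : C) = 1 by apply/funext => -[|m].
  by rewrite mul1r => <-; ring.
have -> : fE ^+ 2 * (bern 0 - theta (bern 0)) =
   (bern 0 * fE - theta (bern 0) * fE) * fE by rewrite expr2; ring.
rewrite H bE mulrBr bE.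
have -> : (fexp 1 - (fpsX C * fexp 1 - (bern 0 * fexp 1 - fexp 1))) * fE =
   (bern 0 * fE - fpsX C * fE) * fexp 1 by ring.
by rewrite bE fexp_shift; ring.
Qed.

End ExponentialSeries.

(** * The complex exponential *)

Section MoreSums.
Variable R : realType.
Local Notation C := R[i].

Lemma has_sum_reindex (I J : choiceType) (f : I -> C) (h : J -> I) (h' : I -> J) s :
  cancel h h' -> (forall i, f i != 0 -> h (h' i) = i) ->
  has_sum f s -> has_sum (fun j => f (h j)) s.
Proof.
move=> hK h'K hs; apply: (has_sum_fiber (p := h') hs) => j.
have := @has_sum1 _ _ (fun i => if h' i == j then f i else 0) (h j).
rewrite hK eqxx; apply => i ij; case: eqP => // E.
by apply/eqP/negPn/negP => /h'K; rewrite E => hi; rewrite hi eqxx in ij.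
Qed.

Lemma has_sum_shift (f : nat -> C) k s : has_sum f s ->
  has_sum (fun n => f (n + k)%N) (s - \sum_(i < k) f i).
Proof.
move=> hs; pose A := [fset i | i in iota 0 k]%fset.
have hA := @has_sum_fin R _ (fun i => if (i < k)%N then f i else 0) A.
have := has_sumB hs (hA _); rewrite sum_fset_iota.
under eq_bigr => i _ do rewrite ltn_ord.
move=> H; have {}H := H _.
have := has_sum_reindex (h := fun n => (n + k)%N) (h' := fun n => (n - k)%N) _ _ (H _).
move=> /= K; apply: eq_has_sum (K _ _ _) => [n|n|n|i].
- by rewrite ltnNge leq_addl subr0.
- by rewrite addnK.
- by case: ltnP => h; [rewrite subrr eqxx|rewrite subnK].
- by rewrite in_fset_iota => /negbTE ->.
Qed.

Lemma real_series_has_sum (g : nat -> R) (s : R) :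
  abs_summable (fun n => (g n)%:C%C) -> series g @ \oo --> s ->
  has_sum (fun n => (g n)%:C%C) s%:C%C.
Proof.
move=> /abs_summable_has_sum [t ht] gs.
suff -> : s%:C%C = t by [].
have [ts ti] : complex.Re t = s /\ complex.Im t = 0.
  have H e : 0 < e -> exists N, forall n, (N <= n)%N ->
      cabs (t - (series g n)%:C%C) < e.
    move=> /ht [A hA]; exists (\max_(i <- A) i).+1 => n nA.
    have -> : (series g n)%:C%C = \sum_(k <- [fset i | i in iota 0 n]%fset) (g k)%:C%C.
      rewrite sum_fset_iota /series /= big_mkord.
      by rewrite (raddf_sum (real_complex R)).
    apply: hA; apply/fsubsetP => i iA; rewrite in_fset_iota.
    by apply: leq_trans nA; rewrite ltnS (leq_bigmax_seq (F := id)).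
  split.
    apply: (cvg_unique _ _ gs) => //.
    apply/cvgrPdist_lt => e /H [N hN]; exists N => // n /= /hN.
    apply: le_lt_trans; apply: le_trans (Re_le_cabs _).
    by case: (t) => a b /=.
  apply/eqP/negPn/negP => /eqP h.
  have /H [N /(_ N (leqnn N))] : 0 < `|complex.Im t| by rewrite normr_gt0; apply/eqP.
  rewrite ltNge; apply/negP/negPn; apply: le_trans (Im_le_cabs _).
  by case: (t) => a b /=; rewrite subr0.
by rewrite [t]complexE ts ti mulr0 addr0.
Qed.

End MoreSums.

Section ComplexExp.
Variable R : realType.
Local Notation C := R[i].
Local Notation cexp := (@cexp R).

Lemma cexpD z w : cexp (z + w) = cexp z * cexp w.
Proof.
case: z w => [a b] [c d]; rewrite /cexp /= expRD cosD sinD.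
by congr Complex; ring.
Qed.

Lemma cexp0 : cexp 0 = 1.
Proof. by rewrite /cexp /= expR0 cos0 sin0 mul1r mulr0. Qed.

Lemma cexpNM z : cexp (- z) * cexp z = 1.
Proof. by rewrite -cexpD addNr cexp0. Qed.

Lemma cexp_neq0 z : cexp z != 0.
Proof.
by apply/eqP => h; have := cexpNM z; rewrite h mulr0 => /esym/eqP; rewrite oner_eq0.
Qed.

Lemma cexpN z : cexp (- z) = (cexp z)^-1.
Proof. by apply: (mulIf (cexp_neq0 z)); rewrite cexpNM mulVf ?cexp_neq0. Qed.

Lemma cexp_natM n z : cexp (n%:R * z) = cexp z ^+ n.
Proof.
elim: n => [|n IH]; first by rewrite mul0r cexp0 expr0.
by rewrite -natr1 mulrDl mul1r cexpD IH exprSr.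
Qed.

Lemma cabs_cexp z : cabs (cexp z) = expR (complex.Re z).
Proof.
case: z => a b; rewrite /cabs /cexp /=.
by rewrite !exprMn -mulrDr cos2Dsin2 mulr1 sqrtr_sqr ger0_norm// expR_ge0.
Qed.

Lemma cexp_2pii : cexp (two_pi_i R) = 1.
Proof.
rewrite /cexp /two_pi_i /= expR0 !mul1r mulrC.
by rewrite (_ : pi * 2 = pi *+ 2) ?cos2pi ?sin2pi // mulr_natr.
Qed.

Lemma two_pi_i_neq0 : two_pi_i R != 0.
Proof.
by rewrite /two_pi_i eq_complex /= negb_and mulf_neq0 ?orbT//= gt_eqF ?pi_gt0.
Qed.

Lemma cabs_2pii : cabs (two_pi_i R) = 2 * pi.
Proof.
rewrite /two_pi_i /cabs /= expr0n /= add0r sqrtr_sqr ger0_norm//.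
by rewrite mulr_ge0// pi_ge0.
Qed.

Lemma exp_coeff_partial (x : R) n : 0 <= x ->
  \sum_(i < n) x ^+ i / (i`!)%:R <= expR x.
Proof.
move=> x0; rewrite -(big_mkord xpredT (fun i => x ^+ i / (i`!)%:R)).
apply: (@nondecreasing_cvgn_le R (series (exp_coeff x))).
  by apply/nondecreasing_series => m _ _; exact: exp_coeff_ge0.
exact: is_cvg_series_exp_coeff.
Qed.

Lemma cabs_expterm (z : C) n : cabs (z ^+ n / (n`!)%:R) = cabs z ^+ n / (n`!)%:R.
Proof. by rewrite cabsM cabsV cabsX cabs_nat. Qed.

Lemma expterm_summable (z : C) : abs_summable (fun n => z ^+ n / (n`!)%:R).
Proof.
apply: (@abs_summable_nat _ _ (expR (cabs z))) => n.
under eq_bigr do rewrite cabs_expterm; apply: exp_coeff_partial; exact: cabs_ge0.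
Qed.

Lemma cexp_has_sum (z : C) : has_sum (fun n => z ^+ n / (n`!)%:R) (cexp z).
Proof.
case: z => x y.
have hx : has_sum (fun n => x%:C%C ^+ n / (n`!)%:R) (expR x)%:C%C.
  have E n : (exp_coeff x n)%:C%C = x%:C%C ^+ n / (n`!)%:R :> C.
    by rewrite /exp_coeff /= natC !(rmorphM (real_complex R)) fmorphV rmorphXn.
  apply: (eq_has_sum E); apply: real_series_has_sum.
    apply: (abs_summable_le (c := 1) (expterm_summable x%:C%C)) => n.
    by rewrite E mul1r.
  exact: is_cvg_series_exp_coeff.
have hy : has_sum (fun n => ('i * y%:C)%C ^+ n / (n`!)%:R) ((cos y)%:C%C + 'i%C * (sin y)%:C%C).
  have cosC n : cos_coeff y n = (if odd n then 0 else (-1) ^+ n./2) * (y ^+ n / (n`!)%:R).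
    by rewrite /cos_coeff /= -!mulrA; case: (odd n); rewrite ?mul0r ?mul1r.
  have sinC n : sin_coeff y n = (if odd n then (-1) ^+ n./2 else 0) * (y ^+ n / (n`!)%:R).
    rewrite /sin_coeff /= -!mulrA; case: ifPn => no; rewrite ?mul0r ?mul1r//.
    by rewrite -[n in n.-1](odd_double_half n) no /= doubleK.
  have E n : (cos_coeff y n)%:C%C + 'i%C * (sin_coeff y n)%:C%C = ('i * y%:C)%C ^+ n / (n`!)%:R :> C.
    have -> : ('i * y%:C)%C ^+ n / (n`!)%:R = 'i%C ^+ n * (y ^+ n / (n`!)%:R)%:C%C :> C.
      by rewrite exprMn natC (rmorphM (real_complex R)) fmorphV rmorphXn mulrA.
    have I2 m : ('i%C : C) ^+ m.*2 = ((-1) ^+ m)%:C%C.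
      by rewrite -mul2n exprM sqr_i rmorphXn rmorphN1.
    rewrite cosC sinC -[in 'i%C ^+ n](odd_double_half n) exprD I2.
    case: (odd n) => /=; rewrite ?expr1 ?expr0 ?mul1r ?mul0r !(rmorph0, add0r, addr0, mulr0)//.
      by rewrite -mulrA -(rmorphM (real_complex R)).
    by rewrite -(rmorphM (real_complex R)).
  have B (b : bool) m n : cabs (((if b then 0 else (-1) ^+ m) * (y ^+ n / (n`!)%:R))%:C%C : C) <=
     1 * cabs (y%:C%C ^+ n / (n`!)%:R).
    rewrite mul1r cabs_expterm !cabsR normrM; case: b; first by rewrite normr0 mul0r divr_ge0.
    by rewrite normrX normrN1 expr1n mul1r normrM normrX normfV normr_nat.
  apply: (eq_has_sum E); apply: has_sumD.
    apply: real_series_has_sum; last by rewrite cos.unlock; exact: is_cvg_series_cos_coeff.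
    by apply: (abs_summable_le (c := 1) (expterm_summable y%:C%C)) => n; rewrite cosC.
  apply: has_sumZ; apply: real_series_has_sum; last by rewrite sin.unlock; exact: is_cvg_series_sin_coeff.
  apply: (abs_summable_le (c := 1) (expterm_summable y%:C%C)) => n; rewrite sinC -if_neg.
  exact: B.
have H1 (f : nat -> C) t : has_sum f t -> has_sum (fun n => f n * 1 ^+ n) t.
  by apply: eq_has_sum => n; rewrite expr1n mulr1.
have A1 (f : nat -> C) : abs_summable f -> abs_summable (fun n => f n * 1 ^+ n).
  by move=> h; apply: (abs_summable_le (c := 1) h) => n; rewrite expr1n mulr1 mul1r.
have := has_sum_conv (A1 _ (expterm_summable _)) (A1 _ (expterm_summable _)) (H1 _ _ hx) (H1 _ _ hy).
have -> : (expR x)%:C%C * ((cos y)%:C%C + 'i%C * (sin y)%:C%C) = cexp (x +i* y)%C.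
  by rewrite /cexp /=; simpc; rewrite //= ; congr Complex; ring.
apply: eq_has_sum => n; rewrite expr1n mulr1.
rewrite [(x +i* y)%C]complexE /=.
exact: esym (congr1 (fun f : fps C => f n) (fexpD x%:C%C ('i * y%:C)%C)).
Qed.

(** The remainder of the exponential series is divided by z^k termwise. *)
Lemma cexp_taylor k (z : C) : exists2 a : C, cabs a <= expR (cabs z) &
  cexp z = \sum_(i < k) z ^+ i / (i`!)%:R + z ^+ k * a.
Proof.
have := has_sum_shift k (cexp_has_sum z).
have hb n : cabs (z ^+ n / ((n + k)`!)%:R) <= 1 * cabs (z ^+ n / (n`!)%:R).
  rewrite mul1r !cabsM; apply: ler_wpM2l; first exact: cabs_ge0.
  rewrite !cabsV !cabs_nat lef_pV2 ?posrE ?ltr0n ?fact_gt0// ler_nat.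
  by rewrite leq_fact// leq_addr.
have [a ha] := abs_summable_has_sum (abs_summable_le (expterm_summable z) hb).
move=> hk; exists a.
  apply: (has_sum_le ha) => A.
  apply: (le_trans (ler_sum _ (fun i _ => hb i))).
  have [b hbb] := expterm_summable z.
  pose N := (\max_(i <- A) i).+1.
  under eq_bigr do rewrite mul1r.
  apply: (@le_trans _ _ (\sum_(i <- [fset i | i in iota 0 N]%fset) cabs (z ^+ i / (i`!)%:R))).
    apply: sum_cabs_sub; apply/fsubsetP => i iA; rewrite in_fset_iota.
    by rewrite /N ltnS (leq_bigmax_seq (F := id)).
  rewrite sum_fset_iota; under eq_bigr do rewrite cabs_expterm.
  by apply: exp_coeff_partial; exact: cabs_ge0.
have := has_sumZ (z ^+ k) ha.
move=> /(eq_has_sum (g := fun n => z ^+ (n + k) / ((n + k)`!)%:R)) ha'.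
have <- := has_sum_unique hk (ha' _); first by ring.
by move=> n; rewrite exprD; ring.
Qed.

End ComplexExp.

Arguments cexp {R} z : simpl never.

(** ** Sequences of subexponential growth *)

Section Growth.
Variable R : realType.
Local Notation C := R[i].

(** The coefficients of the power series that converge in the unit disc. *)
Definition subexp (f : nat -> C) := forall x : R, 0 < x < 1 ->
  exists b : R, forall n, cabs (f n) * x ^+ n <= b.

Lemma subexp_ge0 f x : subexp f -> 0 < x < 1 ->
  exists2 b : R, 0 <= b & forall n, cabs (f n) * x ^+ n <= b.
Proof.
move=> h /h [b hb]; exists b => //.
by have := hb 0%N; rewrite expr0 mulr1; apply: le_trans; exact: cabs_ge0.
Qed.

Lemma pow_divK (x y : R) n : y != 0 -> y ^+ n * (x / y) ^+ n = x ^+ n.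
Proof. by move=> y0; rewrite -exprMn mulrC divfK. Qed.

Lemma subexp_summable f q : subexp f -> cabs q < 1 ->
  abs_summable (fun n => f n * q ^+ n).
Proof.
move=> hf q1; pose x : R := (1 + cabs q) / 2.
have q0 := cabs_ge0 q.
have x01 : 0 < x < 1 by rewrite /x; lra.
have [b b0 hb] := subexp_ge0 hf x01; have /andP[x0 x1] := x01.
apply: (@abs_summable_geom _ b (cabs q / x)).
  by rewrite divr_ge0 ?(ltW x0)//= ltr_pdivrMr// mul1r /x; lra.
move=> n; rewrite cabsM cabsX.
have -> : cabs (f n) * cabs q ^+ n = (cabs (f n) * x ^+ n) * (cabs q / x) ^+ n.
  by rewrite -mulrA pow_divK// gt_eqF.
by apply: ler_wpM2r; rewrite // exprn_ge0// divr_ge0// ltW.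
Qed.

Lemma subexpD f g : subexp f -> subexp g -> subexp (fun n => f n + g n).
Proof.
move=> hf hg x x01; have [b hb] := hf x x01; have [b' hb'] := hg x x01.
exists (b + b') => n; apply: le_trans (lerD (hb n) (hb' n)).
rewrite -mulrDl; apply: ler_wpM2r; last exact: cabsD.
by apply: exprn_ge0; case/andP: x01 => /ltW.
Qed.

Lemma subexpZ c f : subexp f -> subexp (fun n => c * f n).
Proof.
move=> hf x x01; have [b hb] := hf x x01.
exists (cabs c * b) => n; rewrite cabsM -mulrA; apply: ler_wpM2l => //.
exact: cabs_ge0.
Qed.

Lemma subexp0 : subexp (fun=> 0).
Proof. by move=> x _; exists 0 => n; rewrite cabs0 mul0r. Qed.

Lemma subexp_sum (I : Type) (s : seq I) (F : I -> nat -> C) :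
  (forall i, subexp (F i)) -> subexp (fun n => \sum_(i <- s) F i n).
Proof.
move=> h; elim: s => [|i s IH] x x01.
  by exists 0 => n; rewrite big_nil cabs0 mul0r.
have [b hb] := subexpD (h i) IH x01; exists b => n; rewrite big_cons; exact: hb.
Qed.

Lemma subexp_delta c : subexp (fun n => c *+ (n == 0%N)).
Proof.
move=> x _; exists (cabs c) => -[|n]; first by rewrite expr0 mulr1 lexx.
by rewrite mulr0n cabs0 mul0r cabs_ge0.
Qed.

(** Bernoulli's inequality, in the form that makes [n x ^ n] bounded. *)
Lemma nat_geom_bound (t : R) n : 0 < t < 1 -> n%:R * t ^+ n <= (1 - t)^-1.
Proof.
move=> /andP[t0 t1].
have h : n%:R * (1 - t) * t ^+ n <= 1 - t ^+ n.
  elim: n => [|n IH]; first by rewrite !mul0r expr0 subrr.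
  rewrite -natr1 exprS; have := exprn_ge0 n (ltW t0).
  have a1 : t ^+ n <= 1 by rewrite exprn_ile1 ?ltW.
  set a := t ^+ n in IH a1 *; have := ler0n R n; set m : R := n%:R in IH * => m0 a0.
  have : 0 <= (1 - t) * (1 - t * a).
    have : t * a <= 1 by apply: mulr_ile1; rewrite ?(ltW t0) ?(ltW t1).
    by move=> ?; rewrite mulr_ge0 ?subr_ge0 ?(ltW t1).
  have := ler_wpM2l (ltW t0) IH; lra.
rewrite -div1r ler_pdivlMr; last by lra.
have := exprn_ge0 n (ltW t0); lra.
Qed.

Lemma subexpMn f : subexp f -> subexp (fun n => n%:R * f n).
Proof.
move=> hf x x01; pose y : R := (1 + x) / 2.
have y01 : 0 < y < 1 by rewrite /y; lra.
have [b b0 hb] := subexp_ge0 hf y01.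
have /andP[x0 x1] := x01; have /andP[y0 y1] := y01.
have t01 : 0 < x / y < 1.
  by rewrite divr_gt0//= ltr_pdivrMr// mul1r /y; lra.
exists (b * (1 - x / y)^-1) => n; rewrite cabsM cabs_nat.
have -> : n%:R * cabs (f n) * x ^+ n = (cabs (f n) * y ^+ n) * (n%:R * (x / y) ^+ n).
  by rewrite [in RHS]mulrACA pow_divK ?gt_eqF// (mulrC (cabs _)).
apply: ler_pM => //; last exact: nat_geom_bound.
- by rewrite mulr_ge0 ?cabs_ge0 ?exprn_ge0 ?ltW.
- by rewrite mulr_ge0 ?exprn_ge0// divr_ge0 ?ltW.
Qed.

Lemma subexp1 : subexp (fun=> 1).
Proof.
move=> x /andP[x0 x1]; exists 1 => n; rewrite cabs1 mul1r.
by rewrite exprn_ile1 ?ltW.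
Qed.

Lemma subexp_pow k : subexp (fun n => n%:R ^+ k).
Proof.
elim: k => [|k IH]; first by under eq_fun do rewrite expr0; exact: subexp1.
by under eq_fun do rewrite exprS; exact: subexpMn.
Qed.

Lemma subexp_le f (g : nat -> C) : subexp f -> (forall n, cabs (g n) <= cabs (f n)) ->
  subexp g.
Proof.
move=> hf h x x01; have [b hb] := hf x x01; exists b => n.
apply: le_trans (hb n); apply: ler_wpM2r => //.
by apply: exprn_ge0; case/andP: x01 => /ltW.
Qed.

Lemma subexp_conv f g : subexp f -> subexp g -> subexp (conv f g).
Proof.
move=> hf hg x x01; pose y : R := (1 + x) / 2.
have y01 : 0 < y < 1 by rewrite /y; lra.
have [b b0 hb] := subexp_ge0 hf y01; have [b' b0' hb'] := subexp_ge0 hg y01.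
have /andP[x0 x1] := x01; have /andP[y0 y1] := y01.
have t01 : 0 < x / y < 1.
  by rewrite divr_gt0//= ltr_pdivrMr// mul1r /y; lra.
exists (b * b' * ((1 - x / y)^-1 + 1)) => n.
apply: (@le_trans _ _ (\sum_(i < n.+1) b * b' * (x / y) ^+ n)).
  rewrite /conv; apply: (@le_trans _ _ ((\sum_(i < n.+1) cabs (f i * g (n - i)%N)) * x ^+ n)).
    by apply: ler_wpM2r; [exact/exprn_ge0/ltW|exact: cabs_sum].
  rewrite mulr_suml; apply: ler_sum => i _; rewrite cabsM.
  have il : (i <= n)%N by rewrite -ltnS.
  have -> : x ^+ n = y ^+ i * y ^+ (n - i) * (x / y) ^+ n.
    by rewrite -exprD subnKC// pow_divK// gt_eqF.
  rewrite !mulrA; apply: ler_wpM2r; first by rewrite exprn_ge0// divr_ge0 ?ltW.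
  rewrite (_ : _ * y ^+ (n - i) = (cabs (f i) * y ^+ i) * (cabs (g (n - i)%N) * y ^+ (n - i))); last by ring.
  by apply: ler_pM => //; rewrite mulr_ge0 ?cabs_ge0 ?exprn_ge0 ?ltW.
rewrite sumr_const card_ord -mulr_natr -mulrA; apply: ler_wpM2l; first exact: mulr_ge0.
have := nat_geom_bound n t01; rewrite -natr1 mulrDr mulr1 mulrC => h.
apply: lerD => //; by case/andP: t01 => h1 h2; rewrite exprn_ile1 ?ltW.
Qed.

Lemma common_bound (I : finType) (f : I -> nat -> C) (x : R) : 0 < x < 1 ->
  (forall i, subexp (f i)) -> exists2 b : R, 0 <= b & forall i n, cabs (f i n) * x ^+ n <= b.
Proof.
move=> x01 hf; have /choice [b hb] i : exists b : R, 0 <= b /\ forall n, cabs (f i n) * x ^+ n <= b.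
  by have [b b0 h] := subexp_ge0 (hf i) x01; exists b.
exists (\sum_i b i); first by apply: sumr_ge0 => i _; case: (hb i).
move=> i n; apply: le_trans (_ : b i <= _); first by case: (hb i) => _; exact.
by rewrite (bigD1 i)//= lerDl; apply: sumr_ge0 => j _; case: (hb j).
Qed.

Lemma geom_tail_le (w : R) n : 0 <= w -> w < 1 ->
  \sum_(m < n) w ^+ (n - m) <= (1 - w)^-1.
Proof.
move=> w0 w1; rewrite -[leRHS]mul1r ler_pdivlMr; last by lra.
rewrite (reindex_inj rev_ord_inj) /=.
have h := subrX1 w n; have : \sum_(i < n) w ^+ (n - (n - i.+1)) * (1 - w) = w * (1 - w ^+ n).
  rewrite -mulr_suml.
  under eq_bigr => i _ do rewrite subKn// exprS.
  by rewrite -mulr_sumr -mulrA; congr (_ * _); rewrite mulrC -opprB mulNr -h opprB.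
rewrite mulr_suml => ->.
have : 0 <= w ^+ n by exact: exprn_ge0.
nra.
Qed.

(** The equations are those of the coefficients of a solution of q X' = H X + y.  Choose
    x < z < 1 and bound the n-th coefficients of H and y by a multiple of z^(-n).  With
    t_n = x^n times the n-th coefficients of X and w = x / z, the equations give
    n t_n <= B sum_(m <= n) w^(n - m) t_m + B, and the geometric series in w is bounded: for
    n large compared with B, the maximum of the earlier t_m bounds t_n as well. *)
Lemma subexp_system (I : finType) (X y : I -> nat -> C) (H : I -> I -> nat -> C) :
  (forall i i', subexp (H i i')) -> (forall i, subexp (y i)) ->
  (forall i n, n%:R * X i n = \sum_i' conv (H i i') (X i') n + y i n) ->
  forall i, subexp (X i).
Proof.
move=> hH hy hX.
suff key x : 0 < x < 1 -> exists b : R, forall n, (\sum_i cabs (X i n)) * x ^+ n <= b.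
  move=> i x x01; have [b hb] := key x x01; exists b => n; apply: le_trans (hb n).
  apply: ler_wpM2r; first by apply: exprn_ge0; case/andP: x01 => /ltW.
  by rewrite (bigD1 i)//= lerDl; apply: sumr_ge0 => j _; exact: cabs_ge0.
move=> x01; (* Any z strictly between x and 1 would do. *)
pose z : R := (1 + x) / 2.
have z01 : 0 < z < 1 by rewrite /z; lra.
have xz : x < z by rewrite /z; lra.
clearbody z.
have /andP[x0 x1] := x01; have /andP[z0 z1] := z01.
have [b b0 hb] := common_bound z01 (fun ii : I * I => hH ii.1 ii.2).
have [b' b0' hb'] := common_bound z01 hy.
pose w := x / z.
have w0 : 0 <= w by rewrite divr_ge0 ?ltW.
have w1 : w < 1 by rewrite ltr_pdivrMr// mul1r.
pose t n := (\sum_i cabs (X i n)) * x ^+ n.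
have t0 n : 0 <= t n.
  by apply: mulr_ge0; [apply: sumr_ge0 => i _; exact: cabs_ge0|exact: exprn_ge0 (ltW x0)].
pose B := (b + b') * #|I|%:R.
have B0 : 0 <= B by rewrite mulr_ge0 ?addr_ge0.
have rec n : n%:R * t n <= B * \sum_(m < n.+1) w ^+ (n - m) * t m + B.
  have -> : n%:R * t n = \sum_i cabs (n%:R * X i n) * x ^+ n.
    rewrite /t mulrA mulr_sumr mulr_suml; apply: eq_bigr => i _.
    by rewrite cabsM cabs_nat.
  apply: (@le_trans _ _ (\sum_(i : I) (b * \sum_(m < n.+1) w ^+ (n - m) * t m + b'))).
    apply: ler_sum => i _; rewrite hX.
    have h1 : cabs (y i n) * x ^+ n <= b'.
      apply: le_trans (hb' i n); apply: ler_wpM2l (cabs_ge0 _) _ _ _.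
      by apply: lerXn2r; rewrite ?nnegrE ltW.
    have h2 : cabs (\sum_i' conv (H i i') (X i') n) * x ^+ n <=
        b * \sum_(m < n.+1) w ^+ (n - m) * t m.
      rewrite mulr_sumr.
      apply: (@le_trans _ _ (\sum_i' \sum_(m < n.+1)
         b * (w ^+ (n - m) * (cabs (X i' m) * x ^+ m)))); last first.
        rewrite exchange_big /=; apply: ler_sum => m _.
        by rewrite -!mulr_sumr /t mulr_suml.
      apply: (@le_trans _ _ ((\sum_i' cabs (conv (H i i') (X i') n)) * x ^+ n)).
        by apply: ler_wpM2r (cabs_sum _ _ _); apply: exprn_ge0 (ltW x0).
      rewrite mulr_suml; apply: ler_sum => i' _.
      apply: (@le_trans _ _ (\sum_(m < n.+1)
         cabs (H i i' (n - m)%N * X i' m) * x ^+ n)).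
        rewrite -mulr_suml; apply: ler_wpM2r; first exact: exprn_ge0 (ltW x0).
        apply: le_trans (cabs_sum _ _ _).
        rewrite (_ : conv _ _ n = \sum_(m < n.+1) H i i' (n - m)%N * X i' m) //.
        rewrite /conv (reindex_inj rev_ord_inj) /=; apply: eq_bigr => m _.
        by rewrite subSS subKn// -ltnS.
      apply: ler_sum => m _; have mn : (m <= n)%N by rewrite -ltnS.
      rewrite cabsM (_ : x ^+ n = x ^+ (n - m) * x ^+ m); last by rewrite -exprD subnK.
      have -> : cabs (H i i' (n - m)%N) * cabs (X i' m) * (x ^+ (n - m) * x ^+ m) =
         (cabs (H i i' (n - m)%N) * z ^+ (n - m)) * (w ^+ (n - m) * (cabs (X i' m) * x ^+ m)).
        move: (n - m)%N => p; rewrite /w expr_div_n.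
        have zp := lt0r_neq0 (exprn_gt0 p z0).
        move: (cabs _) (cabs _) (x ^+ p) (x ^+ m) (z ^+ p) zp => c1 c2 c3 c4 c5 h; by field.
      apply: ler_wpM2r (hb (i, i') _).
      have xm : 0 <= x ^+ m by apply: exprn_ge0; exact: ltW.
      by rewrite mulr_ge0 ?exprn_ge0// mulr_ge0 ?cabs_ge0.
    apply: le_trans (lerD h2 h1); rewrite -mulrDl; apply: ler_wpM2r (cabsD _ _).
    exact: exprn_ge0 (ltW x0).
  rewrite sumr_const -mulr_natl.
  set S := \sum_(m < n.+1) _.
  have S0 : 0 <= S by apply: sumr_ge0 => m _; rewrite mulr_ge0 ?exprn_ge0.
  have c0 : 0 <= #|I|%:R :> R by [].
  have m1 := mulr_ge0 c0 b0; have m2 := mulr_ge0 (mulr_ge0 c0 b0') S0.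
  by rewrite /B; move: m1 m2; set cI : R := #|I|%:R; lra.
(* For n > D, the bound c of the earlier terms propagates to t n. *)
pose D := B + B * (1 - w)^-1 + B.
pose N0 := Num.bound D.
pose c := 1 + \sum_(m < N0) t m.
exists c => n; rewrite -/(t n); elim/ltn_ind: n => n IH.
have c1 : 1 <= c by rewrite lerDl; apply: sumr_ge0.
case: (ltnP n N0) => nN.
  rewrite /c (bigD1 (Ordinal nN))//= addrCA lerDl addr_ge0//; apply: sumr_ge0 => //.
have Dn : D < n%:R.
  apply: lt_le_trans (_ : N0%:R <= _); last by rewrite ler_nat.
  apply: archi_boundP; rewrite /D !addr_ge0// mulr_ge0// invr_ge0; lra.
have hr := rec n.
have hs : \sum_(m < n.+1) w ^+ (n - m) * t m <= t n + c * (1 - w)^-1.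
  rewrite big_ord_recr /= subnn expr0 mul1r addrC lerD2l.
  apply: (@le_trans _ _ (\sum_(m < n) c * w ^+ (n - m))).
    apply: ler_sum => m _; rewrite mulrC; apply: ler_wpM2r; first exact: exprn_ge0.
    exact: IH.
  rewrite -mulr_sumr; apply: ler_wpM2l; first lra.
  exact: geom_tail_le.
have B1 : B * (1 - w)^-1 * c <= B * (1 - w)^-1 * c by [].
have q0 : 0 <= (1 - w)^-1 by rewrite invr_ge0; lra.
have BD : B * \sum_(m < n.+1) w ^+ (n - m) * t m <= B * (t n + c * (1 - w)^-1).
  exact: ler_wpM2l.
have h1 : n%:R * t n <= B * t n + (B * (1 - w)^-1 + B) * c.
  apply: le_trans hr _; rewrite [X in _ <= X](_ : _ =
    B * (t n + c * (1 - w)^-1) + B * c); last by ring.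
  by apply: lerD => //; rewrite -[X in X <= _]mulr1; exact: ler_wpM2l.
rewrite leNgt; apply/negP => ct.
have q1 : 0 < n%:R - B.
  by move: Dn; rewrite /D; have := mulr_ge0 B0 q0; lra.
have q2 : B * (1 - w)^-1 + B < n%:R - B by move: Dn; rewrite /D; lra.
have h2 : (n%:R - B) * t n <= (B * (1 - w)^-1 + B) * c by rewrite mulrBl; lra.
have h3 : (n%:R - B) * c < (n%:R - B) * t n by rewrite ltr_pM2l.
have h4 : (B * (1 - w)^-1 + B) * c < (n%:R - B) * c by rewrite ltr_pM2r//; lra.
lra.
Qed.

End Growth.

(** * The partial fraction expansion of the inverse square of the sine *)

Section PartialFractions.
Variable R : realType.
Local Notation C := R[i].
Local Notation cexp := (@cexp R).
Local Notation u := (two_pi_i R).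

Lemma has_sum_sum (I : choiceType) (f : I -> C) : abs_summable f ->
  has_sum f (summability.sum (f : I -> C^o)).
Proof. by move=> /abs_summable_has_sum [s hs]; rewrite (has_sum_cvg hs). Qed.

Lemma abs_summable_int (f : int -> C) :
  abs_summable (fun n => f (Posz n)) -> abs_summable (fun n => f (Negz n)) ->
  abs_summable f.
Proof.
move=> [b hb] [b' hb']; exists (b + b') => A.
pose P := [fset n | n in [seq `|z|%N | z <- A]]%fset.
pose N := [fset n | n in [seq (`|z|.-1)%N | z <- A]]%fset.
apply: le_trans (lerD (hb P) (hb' N)).
pose A1 := [fset Posz n | n in P]%fset; pose A2 := [fset Negz n | n in N]%fset.
have -> : \sum_(n <- P) cabs (f (Posz n)) = \sum_(z <- A1) cabs (f z).
  by rewrite [RHS]big_imfset //= => x y _ _ [].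
have -> : \sum_(n <- N) cabs (f (Negz n)) = \sum_(z <- A2) cabs (f z).
  by rewrite [RHS]big_imfset //= => x y _ _ [].
rewrite (big_fsetID _ (fun z : int => 0 <= z)); apply: lerD.
  apply: sum_cabs_sub; apply/fsubsetP => -[n|n]; rewrite !inE => /andP[zA]// _.
  by apply/imfsetP; exists n => //=; rewrite in_fset; apply/mapP; exists (Posz n).
apply: sum_cabs_sub; apply/fsubsetP => -[n|n]; rewrite !inE => /andP[zA]// _.
by apply/imfsetP; exists n => //=; rewrite in_fset; apply/mapP; exists (Negz n).
Qed.

Lemma inv2_nat_summable : abs_summable (fun n : nat => (n.+1%:R : C) ^- 2).
Proof.
apply: (@abs_summable_nat _ _ 2) => n.
suff : \sum_(i < n) cabs ((i.+1%:R : C) ^- 2) <= 2 - n%:R^-1.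
  by move=> /le_trans; apply; rewrite lerBlDr lerDl invr_ge0.
elim: n => [|n IH]; first by rewrite big_ord0 invr0 subr0.
rewrite big_ord_recr /= cabsV cabsX cabs_nat.
case: n IH => [|n] IH; first by rewrite big_ord0 add0r invr1 expr1n invr1; lra.
apply: le_trans (lerD IH (lexx _)) _.
set x : R := n.+1%:R; have -> : n.+2%:R = x + 1 :> R by rewrite -natr1.
have x0 : 0 < x by rewrite ltr0n.
rewrite -addrA lerD2l -subr_ge0.
have -> : - (x + 1)^-1 - (- x^-1 + (x + 1) ^- 2) = x^-1 * (x + 1) ^- 2.
  by field; rewrite !gt_eqF// addr_gt0.
by rewrite mulr_ge0 ?invr_ge0 ?exprn_ge0// ?addr_ge0 // ltW.
Qed.

Lemma inv2_int_summable : abs_summable (fun n : int => (n%:~R : C) ^- 2).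
Proof.
apply: abs_summable_int.
  apply: (abs_summable_near (A := [fset 0%N]%fset) (f := fun n => n%:R ^- 2 : C)) => //.
  have [b hb] := inv2_nat_summable; apply: (@abs_summable_nat _ _ b) => -[|n].
    by rewrite big_ord0; have := hb fset0; rewrite big_seq_fset0.
  rewrite big_ord_recl.
  have -> : cabs (((ord0 : 'I_n.+1) : nat)%:R ^- 2 : C) = 0.
    by rewrite expr0n invr0 cabs0.
  rewrite add0r.
  by rewrite -(sum_fset_iota n (fun i => cabs (i.+1%:R ^- 2 : C))); apply: hb.
apply: (abs_summable_le (c := 1) inv2_nat_summable) => n.
by rewrite NegzE rmorphN mul1r sqrrN.
Qed.

Lemma cabs_int (n : int) : cabs (n%:~R : C) = `|n%:~R|.
Proof. by rewrite intC cabsR. Qed.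

Lemma inv2_shift_summable (z : C) : abs_summable (fun n : int => (z + n%:~R) ^- 2).
Proof.
have h4 := abs_summable_le (c := cabs 4) inv2_int_summable
  (g := fun n => 4 * n%:~R ^- 2).
have [N hN] : exists N : nat, 2 * cabs z < N%:R.
  exists (Num.bound (2 * cabs z)); apply: archi_boundP.
  by rewrite mulr_ge0// cabs_ge0.
pose A := ([fset Posz i | i in iota 0 N.+1] `|` [fset Negz i | i in iota 0 N.+1])%fset.
apply: (abs_summable_near (A := A) (h4 _)) => [n|n nA]; first by rewrite cabsM.
have nN : N%:R <= cabs (n%:~R : C).
  rewrite cabs_int; case: n nA => n; rewrite !inE negb_or => /andP[h1 h2].
    rewrite ger0_norm// ler_nat leqNgt; apply: contra h1 => h1.
    apply/imfsetP; exists n => //=.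
    by rewrite -[_ :: _]/(iota 0 N.+1) mem_iota /= add0n ltnS (ltnW h1).
  rewrite NegzE rmorphN normrN ger0_norm// ler_nat leqNgt; apply: contra h2 => h2.
  by apply/imfsetP; exists n => //=; rewrite -[_ :: _]/(iota 0 N.+1) mem_iota /= add0n ltnS ltnW// ltnW.
have zn : cabs (n%:~R : C) / 2 <= cabs (z + n%:~R).
  have := cabs_ge_sub (n%:~R : C) z; rewrite (addrC z); lra.
have n0 : 0 < cabs (n%:~R : C) by have := cabs_ge0 z; lra.
rewrite cabsM !cabsV !cabsX cabs_nat.
rewrite -[4%:R]invrK -invfM lef_pV2 ?posrE ?exprn_gt0//.
- have -> : 4^-1 * cabs (n%:~R : C) ^+ 2 = (cabs (n%:~R : C) / 2) ^+ 2 by field.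
  by rewrite lerXn2r ?nnegrE// ?cabs_ge0// divr_ge0// ltW.
- by apply: lt_le_trans zn; rewrite divr_gt0.
- by rewrite mulr_gt0 ?exprn_gt0.
Qed.

(** As the inverse of 0 is 0, an integer n with z + n = 0 contributes 0. *)
Definition Esum (z : C) : C :=
  summability.sum (fun n : int => (z + n%:~R) ^- 2 : C^o).

Lemma Esum_has_sum z : has_sum (fun n : int => (z + n%:~R) ^- 2) (Esum z).
Proof. exact/has_sum_sum/inv2_shift_summable. Qed.

Lemma EsumDint z (m : int) : Esum (z + m%:~R) = Esum z.
Proof.
apply: has_sum_unique (Esum_has_sum _) _.
have := has_sum_bij (h := fun n : int => m + n) (h' := fun n => n - m) _ _ (Esum_has_sum z).
move=> /(_ (fun n => _) (fun n => _)) /= H.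
apply: eq_has_sum (H _ _) => [n|n|n].
- by rewrite rmorphD addrA.
- by rewrite addrC addKr.
- by rewrite addrC subrK.
Qed.

(** Split the sum over the integers according to parity. *)
Lemma Esum_duplication z : Esum (z / 2) + Esum ((z + 1) / 2) = 4 * Esum z.
Proof.
pose h (x : bool * int) : int := 2 * x.2 + (x.1 : nat)%:Z.
pose h' (m : int) : bool * int := ((m %% 2)%Z == 1, (m %/ 2)%Z).
have hK : cancel h h'.
  case=> b n; rewrite /h /h' /=; congr (_, _); case: b; lia.
have h'K : cancel h' h.
  move=> m; rewrite /h /h' /=; case: eqP; lia.
have := has_sumZ 4 (has_sum_bij hK h'K (Esum_has_sum z)).
pose g (b : bool) := Esum ((z + (b : nat)%:R) / 2).
move=> /has_sum_fubini => /(_ g) H.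
have {}H : has_sum g (4 * Esum z).
  apply: H => b; apply: eq_has_sum (Esum_has_sum _) => n /=.
  rewrite /h /= rmorphD rmorphM /=.
  have -> : (z + (b : nat)%:R) / 2 + n%:~R = (z + (2%:~R * n%:~R + (b : nat)%:~R)) / 2.
    by rewrite -!pmulrn; field.
  by rewrite expr_div_n invf_div -exprVn; ring.
rewrite -(has_sum_unique (has_sum_fin (f := g) (A := [fset false; true]%fset) _) H).
  rewrite big_fsetU1 ?inE//= big_seq_fset1 /g /=.
  by rewrite addr0.
by case; rewrite !inE.
Qed.

(** u ^ 2 exp w / (exp w - 1) ^ 2 with w = u z, u = 2 pi i; it is
    (pi / sin (pi z)) ^ 2. *)
Definition Dfun (z : C) : C := u ^+ 2 * cexp (u * z) / (cexp (u * z) - 1) ^+ 2.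

Lemma cexp_int (m : int) : cexp (u * m%:~R) = 1.
Proof.
have N n : cexp (u * n%:R) = 1 by rewrite mulrC cexp_natM cexp_2pii expr1n.
case: m => n; first exact: N.
by rewrite NegzE rmorphN mulrN cexpN N invr1.
Qed.

Lemma DfunDint z (m : int) : Dfun (z + m%:~R) = Dfun z.
Proof. by rewrite /Dfun mulrDr cexpD cexp_int mulr1. Qed.

Lemma cexp_half : cexp (u / 2) = -1.
Proof.
have h : cexp (u / 2) ^+ 2 = 1.
  by rewrite -cexp_natM mulrC divfK ?cexp_2pii// pnatr_eq0.
have : cexp (u / 2) != 1.
  rewrite /cexp /two_pi_i.
  have -> : ((0 +i* (2 * pi))%C / 2 : C) = (0 +i* pi)%C.
    have -> : (0 +i* (2 * pi))%C = (0 +i* pi)%C * 2 :> C.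
      by rewrite mulr_natr mulr2n; simpc; congr Complex; ring.
    by rewrite mulfK// pnatr_eq0.
  rewrite /= expR0 cospi sinpi eq_complex /= mul1r; apply/negP => /andP[/eqP]; lra.
move: h => /eqP; rewrite -subr_eq0 subr_sqr_1 mulf_eq0 subr_eq0 => /orP[->//|].
by rewrite addr_eq0 => /eqP.
Qed.

(** With e = exp (u z / 2), the two terms are the values at e and - e of e / (e - 1)^2. *)
Lemma Dfun_duplication z : cexp (u * z) != 1 ->
  Dfun (z / 2) + Dfun ((z + 1) / 2) = 4 * Dfun z.
Proof.
rewrite /Dfun; set e := cexp (u * (z / 2)).
have -> : cexp (u * ((z + 1) / 2)) = - e.
  have -> : u * ((z + 1) / 2) = u * (z / 2) + u / 2 by ring.
  by rewrite cexpD cexp_half mulrN1.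
have -> : cexp (u * z) = e ^+ 2.
  by rewrite -cexp_natM; congr cexp; field.
rewrite -subr_eq0.
rewrite subr_sqr_1 mulf_eq0 negb_or => /andP[h1 h2].
have h3 : - e - 1 != 0 by rewrite -opprD oppr_eq0.
have h4 : e ^+ 2 - 1 != 0 by rewrite subr_sqr_1 mulf_neq0.
by field; rewrite ?h1 ?h2 ?h3.
Qed.

Lemma expR_quarter : expR (1 / 4) <= 2 :> R.
Proof.
have := expR_ge1Dx (- (1 / 4) : R); rewrite expRN => h.
have := expR_gt0 (1 / 4 : R) => p.
have : 3 / 4 * expR (1 / 4) <= (1 : R) 
  by have := ler_wpM2r (ltW p) h; rewrite mulVf ?gt_eqF//; lra.
lra.
Qed.

Lemma pi_lt4 : pi < 4 :> R.
Proof. have := pihalf_lt2 R; lra. Qed.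

(** With w = u z, write exp w = 1 + w + w^2 a and a = 1/2 + w b; then the difference is
    u^2 (a - a^2 - 2 b) / (1 + w a)^2, with |a|, |b| <= 2 and |w a| <= 1/2.  The three factors
    of the bound are those of |u|^2, of the numerator and of the denominator. *)
Lemma Dfun_near0 (z : C) : z != 0 -> cabs z <= 1 / 32 ->
  cabs (Dfun z - z ^- 2) <= 64 * 10 * 4.
Proof.
move=> z0 zs; pose w := u * z.
have w0 : w != 0 by rewrite mulf_neq0// two_pi_i_neq0.
have ws : cabs w <= 1 / 4.
  by rewrite cabsM cabs_2pii; have := pi_lt4; have := pi_gt0 R; have := cabs_ge0 z; nra.
have ew : expR (cabs w) <= 2 by apply: le_trans expR_quarter; rewrite ler_expR.
have [a ha Ea] := cexp_taylor 2 w; have [b hb Eb] := cexp_taylor 3 w.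
have {}ha := le_trans ha ew; have {}hb := le_trans hb ew.
move: Ea Eb; rewrite !big_ord_recr !big_ord0 /= !expr0 !fact0 !expr1 add0r divr1 => Ea Eb.
have Eab : a = 1 / 2 + w * b.
  have w2 : w ^+ 2 != 0 by rewrite expf_neq0.
  apply: (mulfI w2); move: Eb; rewrite Ea => /eqP; rewrite -!addrA.
  rewrite !(inj_eq (addrI _)) => /eqP ->.
  by rewrite (_ : 2`! = 2%N) //; field.
have wa : cabs (w * a) <= 1 / 2.
  by rewrite cabsM; have := cabs_ge0 w; have := cabs_ge0 a; nra.
have h1 : 1 / 2 <= cabs (1 + w * a).
  by have := cabs_ge_sub 1 (w * a); rewrite cabs1; lra.
have n1 : 1 + w * a != 0.
  by apply/eqP => h; move: h1; rewrite h cabs0; lra.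
have -> : Dfun z - z ^- 2 = u ^+ 2 * (a - a ^+ 2 - 2 * b) * (1 + w * a) ^- 2.
  rewrite /Dfun -/w.
  have -> : cexp w - 1 = w * (1 + w * a) by rewrite Ea (_ : 1`! = 1%N) // divr1; ring.
  have -> : z = w / u by rewrite /w mulrC mulKf// two_pi_i_neq0.
  rewrite Ea; have := two_pi_i_neq0 R => u0.
  have -> : 1 + w / (1`!)%:R + w ^+ 2 * a = (1 + w * a) ^+ 2 + w ^+ 2 * (a - a ^+ 2 - 2 * b).
    have Ewb : 2 * w * b = 2 * a - 1 by rewrite Eab; field.
    have -> : w ^+ 2 * (a - a ^+ 2 - 2 * b) = w ^+ 2 * (a - a ^+ 2) - w * (2 * w * b) by ring.
    by rewrite Ewb (_ : 1`! = 1%N) // divr1; ring.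
  by field; rewrite n1 w0 u0.
rewrite !cabsM cabsV !cabsX cabs_2pii.
have hc : cabs (a - a ^+ 2 - 2 * b) <= 10.
  apply: le_trans (cabs_subD _ _) _.
  have := cabs_subD a (a ^+ 2); rewrite cabsX cabsM cabs_nat.
  have := cabs_ge0 a; nra.
have hp : (2 * pi) ^+ 2 <= 64 :> R by have := pi_lt4; have := pi_gt0 R; nra.
have hi : cabs (1 + w * a) ^- 2 <= 4.
  rewrite -[4%:R]invrK lef_pV2 ?posrE ?exprn_gt0 ?invr_gt0//; last by lra.
  have -> : 4^-1 = (1 / 2) ^+ 2 :> R by field.
  by rewrite lerXn2r ?nnegrE ?cabs_ge0; lra.
by apply: ler_pM => //; rewrite ?ler_pM ?mulr_ge0 ?invr_ge0 ?exprn_ge0 ?cabs_ge0 ?mulr_ge0 ?pi_ge0.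
Qed.

(** The difference of the two sides is (r - 1)^2, where r is the modulus of the exponential. *)
Lemma cabs_cexp_sub1 (x y : R) :
  4 * cabs (cexp (u * (x +i* y)%C)) * sin (pi * x) ^+ 2 <=
  cabs (cexp (u * (x +i* y)%C) - 1) ^+ 2.
Proof.
rewrite [X in _ <= X]cabs_sqr cabs_cexp.
have E : u * (x +i* y)%C = ((- (2 * pi * y)) +i* (2 * pi * x))%C.
  by rewrite /two_pi_i; simpc; rewrite //= ; congr Complex; ring.
rewrite E /cexp /=; set r := expR _.
have -> : 2 * pi * x = (pi * x) *+ 2 by rewrite -mulr_natl; ring.
rewrite cos_mulr2n sin_mulr2n !mulr2n.
have := cos2Dsin2 (pi * x); set c := cos _; set s := sin _ => cs.
have -> : c ^+ 2 = 1 - s ^+ 2 by lra.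
rewrite subr0 -subr_ge0.
have -> : (r * (1 - s ^+ 2 + (1 - s ^+ 2) - 1) - 1) ^+ 2 + (r * (c * s + c * s)) ^+ 2
   - 4 * r * s ^+ 2 = (r - 1) ^+ 2 + 4 * r ^+ 2 * s ^+ 2 * (c ^+ 2 + s ^+ 2 - 1) by ring.
by rewrite cs subrr mulr0 addr0 sqr_ge0.
Qed.

(** The sine of pi x stays away from 0, which bounds the denominator of [Dfun]. *)
Lemma Dfun_away0 : exists b : R, forall z : C,
  1 / 64 <= `|complex.Re z| <= 1 / 2 -> cabs (Dfun z - z ^- 2) <= b.
Proof.
pose s0 : R := sin (pi / 64).
have pi0 := pi_gt0 R.
have s0p : 0 < s0 by apply: sin_gt0_pihalf; rewrite divr_gt0//=; lra.
exists ((2 * pi) ^+ 2 / (4 * s0 ^+ 2) + 64 ^+ 2) => -[x y] /andP[/= x1 x2].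
apply: le_trans (cabs_subD _ _) _; apply: lerD; last first.
  rewrite cabsV cabsX -[64%:R]invrK exprVn lef_pV2 ?posrE ?exprn_gt0//.
  - have := Re_le_cabs (x +i* y)%C => /= h; rewrite lerXn2r ?nnegrE ?cabs_ge0//; lra.
  - have := Re_le_cabs (x +i* y)%C => /= h; lra.
have hs : s0 ^+ 2 <= sin (pi * x) ^+ 2.
  have -> : sin (pi * x) ^+ 2 = sin (pi * `|x|) ^+ 2.
    by case: (ger0P x) => // _; rewrite mulrN sinN sqrrN.
  rewrite lerXn2r ?nnegrE ?(ltW s0p)//.
    by apply: sin_ge0_pi; rewrite mulr_ge0 ?(ltW pi0)//=; nra.
  rewrite leNgt ltr_sin ?in_itv /= -?leNgt; nra.
have := cabs_cexp_sub1 x y; set e := cexp _ => /= he.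
have e0 : 0 < cabs e by apply/cabs_gt0/cexp_neq0.
rewrite /Dfun -/e !cabsM cabsV !cabsX cabs_2pii -mulrA; apply: ler_wpM2l; first exact: sqr_ge0.
have s1 : 0 < s0 ^+ 2 by rewrite exprn_gt0.
rewrite ler_pdivrMr; last by nra.
rewrite mulrC ler_pdivlMr; nra.
Qed.

Lemma Dfun_bound : exists2 b : R, 0 <= b & forall z : C, z != 0 ->
  `|complex.Re z| <= 1 / 2 -> `|complex.Im z| <= 1 / 64 ->
  cabs (Dfun z - z ^- 2) <= b.
Proof.
have [b hb] := Dfun_away0; pose K : R := 64 * 10 * 4.
have K0 : 0 <= K by rewrite /K !mulr_ge0.
exists (`|b| + K); first by rewrite addr_ge0.
move=> z z0 xz yz; case: (lerP (1 / 64) `|complex.Re z|) => h.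
  apply: le_trans (hb z _) _; first by rewrite h.
  by have := ler_norm b; lra.
apply: le_trans (Dfun_near0 z0 _) _; last by rewrite lerDr.
by apply: le_trans (cabs_le_ReIm z) _; lra.
Qed.

(** On the strip, |z + n| >= |n| / 2 for every nonzero integer n. *)
Lemma Esum_bound : exists2 b : R, 0 <= b & forall z : C,
  `|complex.Re z| <= 1 / 2 -> cabs (Esum z - z ^- 2) <= b.
Proof.
have h4 := abs_summable_le (c := cabs 4) inv2_int_summable
  (g := fun n => 4 * n%:~R ^- 2).
have [|b hb] := h4; first by move=> n; rewrite cabsM.
have b0 : 0 <= b by have := hb fset0; rewrite big_seq_fset0.
exists b => // z hz.
pose f (n : int) : C := if n == 0 then 0 else (z + n%:~R) ^- 2.
have hf : has_sum f (Esum z - z ^- 2).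
  have h1 := @has_sum1 R _ (fun n : int => if n == 0 then (z + n%:~R) ^- 2 else 0) 0.
  rewrite eqxx addr0 in h1.
  apply: eq_has_sum (has_sumB (Esum_has_sum z) (h1 _)) => [n|n /negbTE ->//].
  by rewrite /f; case: ifP; rewrite ?subrr ?subr0.
apply: (has_sum_le hf) => A; apply: le_trans (hb A); apply: ler_sum => n _.
rewrite /f; case: eqP => [_|/eqP n0]; first by rewrite cabs0 cabs_ge0.
have n1 : 1 <= cabs (n%:~R : C).
  by rewrite cabs_int -intr_norm ler1z; lia.
have zn : cabs (n%:~R : C) / 2 <= cabs (z + n%:~R).
  apply: le_trans (Re_le_cabs _).
  have -> : complex.Re (z + n%:~R) = complex.Re z + n%:~R :> R.
    by rewrite intC; case: (z).
  rewrite cabs_int in n1 *.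
  have := lerB_normD (n%:~R : R) (complex.Re z); rewrite (addrC (complex.Re z)); lra.
rewrite cabsM !cabsV !cabsX cabs_nat.
rewrite -[4%:R]invrK -invfM lef_pV2 ?posrE ?exprn_gt0//.
- have -> : 4^-1 * cabs (n%:~R : C) ^+ 2 = (cabs (n%:~R : C) / 2) ^+ 2 by field.
  by rewrite lerXn2r ?nnegrE// ?cabs_ge0// divr_ge0// ltW// ; lra.
- by apply: lt_le_trans zn; rewrite divr_gt0//; lra.
- by rewrite mulr_gt0 ?exprn_gt0//; lra.
Qed.

(** The points where [Esum] and [Dfun] have no pole. *)
Definition nonint (z : C) := forall m : int, z != m%:~R.

Lemma cexp_eq1 z : cexp (u * z) = 1 -> exists m : int, z = m%:~R.
Proof.
move=> ez; pose m := Num.floor (complex.Re z); exists m.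
pose t := z - m%:~R.
have et : cexp (u * t) = 1.
  by rewrite /t mulrBr cexpD cexpN cexp_int ez invr1 mulr1.
have tR : 0 <= complex.Re t < 1.
  have -> : complex.Re t = complex.Re z - m%:~R by rewrite /t intC; case: (z).
  by have := floor_itv (complex.Re z); rewrite -/m rmorphD /=; lra.
have tI : complex.Im t = 0.
  have := congr1 (@cabs R) et; rewrite cabs_cexp cabs1.
  have -> : complex.Re (u * t) = - (2 * pi) * complex.Im t.
    by rewrite /two_pi_i; case: (t) => a b; simpc.
  move=> h; have : - (2 * pi) * complex.Im t = 0 by apply: expR_inj; rewrite h expR0.
  by move/eqP; rewrite mulf_eq0 oppr_eq0 mulf_eq0 pnatr_eq0 /= (gt_eqF (pi_gt0 R)) => /eqP.
suff tR0 : complex.Re t = 0.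
  have t0 : t = 0 by rewrite [t]complexE tI tR0 mulr0 addr0.
  by apply/eqP; rewrite -subr_eq0 -/t t0.
apply/eqP/negPn/negP => tn.
have := cabs_cexp_sub1 (complex.Re t) (complex.Im t).
have -> : (complex.Re t +i* complex.Im t)%C = t by case: (t).
rewrite et subrr cabs0 cabs1 expr0n /=.
have : 0 < sin (pi * complex.Re t).
  have := pi_gt0 R => p0; apply: sin_gt0_pi.
  have t1 : 0 < complex.Re t by rewrite lt_neqAle eq_sym tn; case/andP: tR.
  by rewrite mulr_gt0//=; nra.
by move=> h; have := exprn_gt0 2 h; lra.
Qed.

Let g (z : C) := Esum z - Dfun z.

Lemma pf_duplication z : nonint z -> 4 * g z = g (z / 2) + g ((z + 1) / 2).
Proof.
move=> hz; rewrite /g mulrBr -Esum_duplication -Dfun_duplication; first by ring.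
by apply/eqP => /cexp_eq1 [m E]; have := hz m; rewrite E eqxx.
Qed.

(** Herglotz' trick.  After a translation by an integer, the arguments on the right-hand side
    of the duplication formula lie in the same rectangle, where [g] is bounded by some b since
    the poles cancel; the formula improves the bound to b / 2, and so on. *)
Lemma pf_strip z : nonint z -> `|complex.Re z| <= 1 / 2 ->
  `|complex.Im z| <= 1 / 64 -> g z = 0.
Proof.
have [b1 b10 hb1] := Dfun_bound; have [b2 b20 hb2] := Esum_bound.
have two_neq0 : (2 : C) != 0 by rewrite pnatr_eq0.
have half_nonint (y : C) (s : int) : nonint y -> nonint ((y - s%:~R) / 2).
  move=> hy m; apply/eqP => /(congr1 ( *%R^~ 2)); rewrite divfK// => h.
  have := hy (m * 2 + s); rewrite rmorphD rmorphM /= -h.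
  by rewrite subrK eqxx.
have ReD (y : C) (s : int) : complex.Re ((y - s%:~R) / 2) = (complex.Re y - s%:~R) / 2.
  by rewrite intC natC -fmorphV; case: (y) => c e; simpc.
have ImD (y : C) (s : int) : complex.Im ((y - s%:~R) / 2) = complex.Im y / 2.
  by rewrite intC natC -fmorphV; case: (y) => c e; simpc.
have H k : forall y, nonint y -> `|complex.Re y| <= 1 / 2 ->
    `|complex.Im y| <= 1 / 64 -> cabs (g y) * 2 ^+ k <= b1 + b2.
  elim: k => [|k IH] y hy xy yy.
    rewrite expr0 mulr1.
    have -> : g y = (Esum y - y ^- 2) - (Dfun y - y ^- 2) by rewrite /g; ring.
    apply: le_trans (cabs_subD _ _) _; rewrite addrC; apply: lerD; last exact: hb2.
    by apply: hb1 => //; exact: (hy 0).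
  (* Translating (y + 1) / 2 by 0 or -1 brings its real part back to [-1/2, 1/2]. *)
  pose s : int := if 0 <= complex.Re y then 1 else -1.
  have g1 : g ((y + 1) / 2) = g ((y - s%:~R) / 2).
    rewrite /s; case: ifP => _; last by rewrite mulrN1z opprK.
    have -> : (y + 1) / 2 = (y - 1%:~R) / 2 + 1%:~R by rewrite mulr1z; field.
    by rewrite /g EsumDint DfunDint.
  have g0 : g (y / 2) = g ((y - 0%:~R) / 2) by rewrite subr0.
  have h0 := IH _ (half_nonint _ 0 hy); have h1 := IH _ (half_nonint _ s hy).
  rewrite ReD ImD in h0; rewrite ReD ImD in h1.
  have {}h0 : cabs (g (y / 2)) * 2 ^+ k <= b1 + b2.
    by rewrite g0; apply: h0; rewrite ?subr0 normrM normfV normr_nat; lra.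
  have {}h1 : cabs (g ((y + 1) / 2)) * 2 ^+ k <= b1 + b2.
    rewrite g1; apply: h1; last by rewrite normrM normfV normr_nat; lra.
    rewrite /s; case: ifPn => sy; rewrite ?mulrN1z ?mulr1z ler_norml; move: xy;
      rewrite ler_norml; rewrite -?ltNge in sy; lra.
  have : cabs (4 * g y) <= cabs (g (y / 2)) + cabs (g ((y + 1) / 2)).
    by rewrite pf_duplication//; exact: cabsD.
  rewrite cabsM cabs_nat exprS; have : 0 < 2 ^+ k :> R by rewrite exprn_gt0.
  set K := 2 ^+ k in h0 h1 *; nra.
move=> hz xz yz; apply: cabs0_eq; apply/eqP/negPn/negP => n0.
have g0 : 0 < cabs (g z) by rewrite lt_neqAle eq_sym n0 cabs_ge0.
have [N hN] : exists N : nat, (b1 + b2) / cabs (g z) < N%:R.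
  by exists (Num.bound ((b1 + b2) / cabs (g z))); apply: archi_boundP;
    rewrite divr_ge0 ?addr_ge0 ?cabs_ge0.
have := H N z hz xz yz.
have : (N%:R : R) <= 2 ^+ N by rewrite -natrX ler_nat ltnW// ltn_expl.
move: hN; rewrite ltr_pdivrMr//; nra.
Qed.

(** The duplication formula halves imaginary parts, hence propagates the vanishing of [g] from
    a rectangle to the strip |Re z| <= 1/2, and periodicity does the rest. *)
Lemma Esum_Dfun z : nonint z -> Esum z = Dfun z.
Proof.
suff H z' : nonint z' -> g z' = 0 by move=> /H /eqP; rewrite subr_eq0 => /eqP.
have S j : forall y, nonint y -> `|complex.Re y| <= 1 / 2 ->
    `|complex.Im y| <= 2 ^+ j * (1 / 64) -> g y = 0.
  elim: j => [|j IH] y hy xy yy; first by apply: pf_strip => //; rewrite expr0 mul1r in yy.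
  have two_neq0 : (2 : C) != 0 by rewrite pnatr_eq0.
  pose s : int := if 0 <= complex.Re y then 1 else -1.
  have hs (e : int) : `|complex.Re y - e%:~R| <= 1 -> g ((y - e%:~R) / 2) = 0.
    move=> he; apply: IH.
    - move=> m; apply/eqP => /(congr1 ( *%R^~ 2)); rewrite divfK// => h.
      by have := hy (m * 2 + e); rewrite rmorphD rmorphM /= -h subrK eqxx.
    - have -> : complex.Re ((y - e%:~R) / 2) = (complex.Re y - e%:~R) / 2.
        by rewrite intC natC -fmorphV; case: (y) => c f; simpc.
      by rewrite normrM normfV normr_nat; lra.
    - have -> : complex.Im ((y - e%:~R) / 2) = complex.Im y / 2.
        by rewrite intC natC -fmorphV; case: (y) => c f; simpc.
      by rewrite normrM normfV normr_nat; move: yy; rewrite exprS; lra.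
  have h0 : g (y / 2) = 0.
    by have := hs 0; rewrite !subr0; apply; lra.
  have h1 : g ((y + 1) / 2) = 0.
    have <- : g ((y - s%:~R) / 2) = g ((y + 1) / 2).
      rewrite /s; case: ifP => _; last by rewrite mulrN1z opprK.
      have -> : (y + 1) / 2 = (y - 1%:~R) / 2 + 1%:~R by rewrite mulr1z; field.
      by rewrite /g EsumDint DfunDint.
    apply: hs; rewrite /s; case: ifPn => sy; rewrite ?mulrN1z ?mulr1z ler_norml; move: xy;
      rewrite ler_norml; rewrite -?ltNge in sy; lra.
  have := pf_duplication hy; rewrite h0 h1 addr0 => /eqP.
  by rewrite mulf_eq0 pnatr_eq0 /= => /eqP.
move=> hz; pose m := Num.floor (complex.Re z' + 1 / 2).
have -> : g z' = g (z' - m%:~R).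
  by rewrite -{1}(subrK m%:~R z') /g EsumDint DfunDint.
have [N hN] : exists N : nat, 64 * `|complex.Im z'| < N%:R.
  by exists (Num.bound (64 * `|complex.Im z'|)); apply: archi_boundP; rewrite mulr_ge0.
apply: (S N).
- move=> k; apply/eqP => h; have := hz (k + m); rewrite rmorphD /= -h.
  by rewrite subrK eqxx.
- have -> : complex.Re (z' - m%:~R) = complex.Re z' - m%:~R by rewrite intC; case: (z').
  have := floor_itv (complex.Re z' + 1 / 2); rewrite -/m rmorphD /= ler_norml; lra.
- have -> : complex.Im (z' - m%:~R) = complex.Im z'.
    by rewrite intC; case: (z') => a b /=; rewrite subr0.
  have : (N%:R : R) <= 2 ^+ N by rewrite -natrX ler_nat ltnW// ltn_expl.
  lra.
Qed.

End PartialFractions.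

(** * Lattice sums and the q-expansions of the Eisenstein series *)

Section SumTools.
Variable R : realType.
Local Notation C := R[i].

Lemma has_sum_extend (I J : choiceType) (f : I -> C) (h : J -> I) (h' : I -> J) s :
  cancel h h' -> (forall i, f i != 0 -> h (h' i) = i) ->
  has_sum (fun j => f (h j)) s -> has_sum f s.
Proof.
move=> hK h'K hs e /hs [A hA]; exists [fset h j | j in A]%fset => B AB.
have := hA [fset h' i | i in B & h (h' i) == i]%fset.
have -> : \sum_(j <- [fset h' i | i in B & h (h' i) == i]%fset) f (h j) =
    \sum_(i <- B) f i.
  rewrite big_imfset /=; last first.
    by move=> x y /andP[_ /eqP {2}<-] /andP[_ /eqP {2}<-] ->.
  rewrite big_filter big_mkcond /=; apply: eq_bigr => i _.
  case: eqP => [->//|n]; apply/esym/eqP/negPn/negP => /h'K //.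
apply; apply/fsubsetP => j jA; apply/imfsetP; exists (h j) => //=.
by rewrite inE hK eqxx andbT (fsubsetP AB)// in_imfset.
Qed.

Lemma has_sum_int (f : int -> C) s t :
  has_sum (fun n => f (Posz n)) s -> has_sum (fun n => f (Negz n)) t ->
  has_sum f (s + t).
Proof.
move=> hs ht.
have h1 : has_sum (fun n => if n is Posz _ then f n else 0) s.
  by apply: (has_sum_extend (h := Posz) (h' := absz)) hs => // -[n|n]; rewrite ?eqxx.
have h2 : has_sum (fun n => if n is Negz _ then f n else 0) t.
  apply: (has_sum_extend (h := Negz) (h' := fun n => `|n|.-1)) ht => // -[n|n].
    by rewrite eqxx.
  by [].
by apply: eq_has_sum (has_sumD h1 h2) => -[n|n]; rewrite ?addr0 ?add0r.
Qed.

Lemma has_sum_term_bound (I : choiceType) (f : I -> C) s : has_sum f s ->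
  exists b : R, forall i, cabs (f i) <= b.
Proof.
move=> /(_ 1 ltr01) [A hA].
exists (2 + \sum_(j <- A) cabs (f j)) => i.
have S0 : 0 <= \sum_(j <- A) cabs (f j).
  by apply: sumr_ge0 => j _; exact: cabs_ge0.
case iA: (i \in A).
  rewrite (big_fsetD1 i iA) /=.
  have : 0 <= \sum_(j <- (A `\ i)%fset) cabs (f j).
    by apply: sumr_ge0 => j _; exact: cabs_ge0.
  lra.
have h1 := hA _ (fsubset_refl A); have h2 := hA _ (fsubsetU1 i A).
rewrite big_fsetU1 /= ?iA// in h2.
have := cabs_subD (s - \sum_(j <- A) f j) (s - (f i + \sum_(j <- A) f j)).
rewrite (_ : _ - _ = f i); first lra.
ring.
Qed.

(** The terms at H are bounded, so that the terms at h <= H / 2 are dominated by a geometric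
    series. *)
Lemma abs_summable_half (c : nat -> C) (h H : R) S :
  has_sum (fun i => c i * H%:C%C ^+ i) S -> 0 < h <= H / 2 ->
  abs_summable (fun i => c i * h%:C%C ^+ i).
Proof.
move=> /has_sum_term_bound [b hb] /andP[h0 hH].
have H0 : 0 < H by lra.
apply: (@abs_summable_geom R b (1 / 2)) => [|i]; first by lra.
have b0 : 0 <= b by apply: le_trans (hb 0%N); exact: cabs_ge0.
have := hb i; rewrite !cabsM !cabsX !cabsR !gtr0_norm// => hbi.
have hi : h ^+ i <= H ^+ i * (1 / 2) ^+ i by rewrite -exprMn lerXn2r ?nnegrE; lra.
have := ler_wpM2l (cabs_ge0 (c i)) hi; rewrite mulrA => /le_trans; apply.
by apply: ler_wpM2r => //; rewrite exprn_ge0//; lra.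
Qed.

Lemma sum_geom_le (A : {fset nat}) (x : R) : 0 <= x < 1 ->
  \sum_(i <- A) x ^+ i <= (1 - x)^-1.
Proof.
move=> /andP[x0 x1].
pose N := (\max_(i <- A) i).+1.
apply: (@le_trans _ _ (\sum_(i < N) x ^+ i)).
  have E n : x ^+ n = cabs ((x%:C)%C ^+ n : C).
    by rewrite cabsX cabsR ger0_norm.
  rewrite -(sum_fset_iota N (fun i => x ^+ i)).
  rewrite (eq_bigr _ (fun i _ => E i)) [leRHS](eq_bigr _ (fun i _ => E i)).
  apply: sum_cabs_sub; apply/fsubsetP => i iA; rewrite in_fset_iota.
  by rewrite /N ltnS (leq_bigmax_seq (F := id)).
have : (1 - x) * \sum_(i < N) x ^+ i = 1 - x ^+ N.
  by rewrite -opprB mulNr -subrX1 opprB.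
have : 0 <= x ^+ N by rewrite exprn_ge0.
rewrite -div1r ler_pdivlMr; last by lra.
lra.
Qed.

Lemma expterm_sum_le (z : C) (A : {fset nat}) :
  \sum_(j <- A) cabs (z ^+ j / (j`!)%:R) <= expR (cabs z).
Proof.
pose N := (\max_(i <- A) i).+1.
apply: (@le_trans _ _ (\sum_(i <- [fset i | i in iota 0 N]%fset) cabs (z ^+ i / (i`!)%:R))).
  apply: sum_cabs_sub; apply/fsubsetP => i iA; rewrite in_fset_iota.
  by rewrite /N ltnS (leq_bigmax_seq (F := id)).
rewrite (sum_fset_iota N (fun i => cabs (z ^+ i / (i`!)%:R))).
under eq_bigr do rewrite cabs_expterm.
by apply: exp_coeff_partial; exact: cabs_ge0.
Qed.

(** If the coefficients before the n-th one vanish, then |c_n| h^n is at most the tail of the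
    series, which is O(h^(n+1)). *)
Lemma power_series_eq0 (c : nat -> C) (rho : R) : 0 < rho ->
  (forall h : R, 0 < h <= rho -> has_sum (fun j => c j * h%:C%C ^+ j) 0) ->
  forall n, c n = 0.
Proof.
move=> r0 hc.
have [|K hK] := has_sum_term_bound (hc rho _); first by rewrite r0 lexx.
have K0 : 0 <= K by apply: le_trans (hK 0%N); exact: cabs_ge0.
have cR (x : R) j : 0 < x -> cabs (x%:C%C ^+ j : C) = x ^+ j.
  by move=> x0; rewrite cabsX cabsR gtr0_norm.
elim/ltn_ind => n IH; apply: cabs0_eq; apply/eqP; rewrite eq_le cabs_ge0 andbT.
have B h : 0 < h -> h <= rho / 2 -> cabs (c n) <= 2 * K * h / rho ^+ n.+1.
  move=> h0 hr; have hs := hc h _; have {}hs := has_sum_shift n.+1 (hs _).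
  have E : \sum_(i < n.+1) c i * h%:C%C ^+ i = c n * h%:C%C ^+ n.
    by rewrite big_ord_recr big1 /= ?add0r// => i _; rewrite IH ?mul0r.
  rewrite E sub0r in hs.
  have x0 : 0 <= h / rho by rewrite divr_ge0 ?ltW.
  have x2 : h / rho <= 1 / 2 by rewrite ler_pdivrMr//; lra.
  have hle := has_sum_le (b := K * (h / rho) ^+ n.+1 * 2) (hs _).
  have {hle}: cabs (- (c n * h%:C%C ^+ n)) <= K * (h / rho) ^+ n.+1 * 2.
    apply: hle => [|A]; first by rewrite h0; lra.
    apply: (@le_trans _ _ (\sum_(i <- A) K * (h / rho) ^+ n.+1 * (h / rho) ^+ i)).
      apply: ler_sum => i _; rewrite cabsM cR//.
      have -> : K * (h / rho) ^+ n.+1 * (h / rho) ^+ i = K / rho ^+ (i + n.+1) * h ^+ (i + n.+1).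
        by rewrite -mulrA -exprD addnC expr_div_n; ring.
      apply: ler_wpM2r; first by rewrite exprn_ge0 ?ltW.
      by rewrite ler_pdivlMr ?exprn_gt0//; have := hK (i + n.+1)%N; rewrite cabsM cR.
    rewrite -mulr_sumr; apply: ler_wpM2l; first by rewrite mulr_ge0 ?exprn_ge0.
    apply: le_trans (sum_geom_le _ _) _; first by rewrite x0; lra.
    by rewrite -[leRHS]invrK lef_pV2 ?posrE; lra.
  rewrite cabsN cabsM cR// exprSr expr_div_n => H.
  have hn : 0 < h ^+ n by rewrite exprn_gt0.
  rewrite -(ler_pM2r hn); apply: le_trans H _.
  by rewrite exprS le_eqVlt; apply/orP; left; apply/eqP; field; rewrite expf_neq0 gt_eqF.
rewrite leNgt; apply/negP => cn.
pose D := 2 * K / rho ^+ n.+1.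
have D0 : 0 <= D by rewrite /D divr_ge0 ?mulr_ge0 ?exprn_ge0 ?(ltW r0).
pose h := Num.min (rho / 2) (cabs (c n) / (2 * (D + 1))).
have h0 : 0 < h by rewrite lt_min !divr_gt0//; lra.
have := B h h0; rewrite ge_min lexx /= => /(_ isT).
have -> : 2 * K * h / rho ^+ n.+1 = D * h by rewrite /D; ring.
have : h <= cabs (c n) / (2 * (D + 1)) by rewrite ge_min lexx orbT.
rewrite ler_pdivlMr; last by lra.
nra.
Qed.

Lemma power_series_unique (c c' : nat -> C) (S : R -> C) (rho : R) : 0 < rho ->
  (forall h : R, 0 < h <= rho -> has_sum (fun j => c j * h%:C%C ^+ j) (S h)) ->
  (forall h : R, 0 < h <= rho -> has_sum (fun j => c' j * h%:C%C ^+ j) (S h)) ->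
  forall n, c n = c' n.
Proof.
move=> r0 h1 h2 n; apply/eqP; rewrite -subr_eq0; apply/eqP.
apply: (power_series_eq0 (c := fun n => c n - c' n) r0) => h hr.
have := has_sumB (h1 h hr) (h2 h hr); rewrite subrr.
by apply: eq_has_sum => j; rewrite mulrBl.
Qed.

Lemma has_sum_geom (q : C) : cabs q < 1 -> has_sum (fun n => q ^+ n) (1 - q)^-1.
Proof.
move=> q1; have := subexp_summable (@subexp1 R) q1.
move=> /(abs_summable_le (c := 1)) => /(_ (fun n => q ^+ n)) H.
have [|s hs] := abs_summable_has_sum (H _); first by move=> n; rewrite !mul1r.
suff <- : s = (1 - q)^-1 by [].
have := has_sum_shift 1 hs; rewrite big_ord1 expr0 => h1.
have := has_sum_unique h1 (eq_has_sum _ (has_sumZ q hs)).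
move=> E; have {}E : s * (1 - q) = 1.
  rewrite mulrBr mulr1 (mulrC s) -E => [|n]; last by rewrite addn1 exprS.
  by rewrite opprB addrC subrK.
have q0 : 1 - q != 0 by apply/eqP => h; move: E; rewrite h mulr0 => /esym/eqP; rewrite oner_eq0.
by apply: (mulIf q0); rewrite mulVf.
Qed.

Lemma has_sum_geomS (q : C) : cabs q < 1 ->
  has_sum (fun n => n.+1%:R * q ^+ n) ((1 - q) ^- 2).
Proof.
move=> q1; have hg : has_sum (fun n => 1 * q ^+ n) (1 - q)^-1.
  by apply: eq_has_sum (has_sum_geom q1) => n; rewrite mul1r.
have hA := subexp_summable (@subexp1 R) q1.
have := has_sum_conv hA hA hg hg; rewrite -expr2 exprVn.
apply: eq_has_sum => n; congr (_ * _).
by rewrite /conv; under eq_bigr do rewrite mulr1; rewrite sumr_const card_ord.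
Qed.

Lemma has_sum_geom1 (q : C) : cabs q < 1 ->
  has_sum (fun n => n%:R * q ^+ n) (q / (1 - q) ^+ 2).
Proof.
move=> q1; have := subexp_summable (subexpMn (@subexp1 R)) q1.
move=> /(abs_summable_le (c := 1)) => /(_ (fun n => n%:R * q ^+ n)) H.
have [|s hs] := abs_summable_has_sum (H _); first by move=> n; rewrite mulr1 mul1r.
suff <- : s = q / (1 - q) ^+ 2 by [].
have := has_sum_shift 1 hs; rewrite big_ord1 mul0r subr0 => h1.
apply: has_sum_unique h1 _; apply: eq_has_sum (has_sumZ q (has_sum_geomS q1)) => n.
by rewrite addn1 exprS; ring.
Qed.

End SumTools.

Section LatticeSums.
Variable R : realType.
Local Notation C := R[i].
Local Notation cexp := (@cexp R).
Local Notation u := (two_pi_i R).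

(** Since |h| <= |a_i| / 2, each term is a binomial series in h / a_i, and the resulting double
    family is absolutely summable.  The coefficients c_i allow for excluding an index. *)
Lemma has_sum_taylor_inv2 (I : choiceType) (c a : I -> C) (rho : R) (h S : C)
    (L : nat -> C) :
  0 < rho -> (forall i, 2 * rho <= cabs (a i)) ->
  abs_summable (fun i => c i * a i ^- 2) -> cabs h <= rho ->
  has_sum (fun i => c i * (a i + h) ^- 2) S ->
  (forall j, has_sum (fun i => c i * a i ^- j.+2) (L j)) ->
  has_sum (fun j => j.+1%:R * (-1) ^+ j * L j * h ^+ j) S.
Proof.
move=> r0 ha hc hh hS hL.
pose F (x : I * nat) := c x.1 * a x.1 ^- 2 * (x.2.+1%:R * (- h / a x.1) ^+ x.2).
have a0 i : a i != 0.
  by apply/eqP => E; have := ha i; rewrite E cabs0; lra.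
have x2 i : cabs (- h / a i) <= 1 / 2.
  rewrite cabsM cabsN cabsV ler_pdivrMr ?cabs_gt0//.
  by have := ha i; lra.
have hh2 : cabs (2^-1 : C) = 1 / 2 by rewrite cabsV cabs_nat div1r.
have [K hK] : abs_summable (fun n => n.+1%:R * 2^-1 ^+ n : C).
  have q1 : cabs (2^-1 : C) < 1 by rewrite hh2; lra.
  have := abs_summableD (subexp_summable (subexpMn (@subexp1 R)) q1)
      (subexp_summable (@subexp1 R) q1).
  move=> /(abs_summable_le (c := 1)); apply => n.
  by rewrite -mulrDl mulr1 natr1 mul1r.
have [b hb] := hc.
have K0 : 0 <= K by have := hK fset0; rewrite big_seq_fset0.
have FS : abs_summable F.
  apply: (@abs_summable_prod _ _ _ F (fun i => cabs (c i * a i ^- 2) * K) (b * K)) => [i A|A].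
    under eq_bigr do rewrite /F cabsM /=; rewrite -mulr_sumr; apply: ler_wpM2l.
      exact: cabs_ge0.
    apply: le_trans (hK A); apply: ler_sum => j _ /=; rewrite !cabsM; apply: ler_wpM2l.
      exact: cabs_ge0.
    by rewrite !cabsX hh2 lerXn2r ?nnegrE ?cabs_ge0//; lra.
  by rewrite -mulr_suml; apply: ler_wpM2r.
have [T hT] := abs_summable_has_sum FS.
have TS : T = S.
  apply: has_sum_unique hS; apply: (has_sum_fubini hT) => i /=.
  have -> : c i * (a i + h) ^- 2 = c i * a i ^- 2 * (1 - (- h / a i)) ^- 2.
    rewrite -mulrA; congr (_ * _); rewrite -invfM -exprMn; congr (_ ^- 2).
    by field.
  by apply/has_sumZ/has_sum_geomS; have := x2 i; lra.
rewrite -TS; apply: (has_sum_fubini2 hT) => j /=.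
have := has_sumZ (j.+1%:R * (-1) ^+ j * h ^+ j) (hL j).
rewrite (_ : _ * L j = j.+1%:R * (-1) ^+ j * L j * h ^+ j); last by ring.
apply: eq_has_sum => i; rewrite /F /= expr_div_n (exprNn h).
have -> : a i ^- j.+2 = a i ^- 2 * a i ^- j by rewrite -invfM -exprD.
by ring.
Qed.

Lemma tau_summable (tau : C) k : 0 < complex.Im tau ->
  abs_summable (fun n : int => (tau + n%:~R) ^- k.+2).
Proof.
move=> t0; pose y := complex.Im tau.
have hy (n : int) : y <= cabs (tau + n%:~R).
  apply: le_trans (Im_le_cabs _); apply: le_trans (ler_norm _).
  by rewrite intC /y; case: (tau) => c e /=; rewrite addr0.
apply: (abs_summable_le (c := y ^- k) (inv2_shift_summable tau)) => n.
have -> : (tau + n%:~R) ^- k.+2 = (tau + n%:~R) ^- k * (tau + n%:~R) ^- 2.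
  by rewrite -invfM -exprD addn2.
rewrite cabsM; apply: ler_wpM2r; first exact: cabs_ge0.
have p : 0 < cabs (tau + n%:~R) by apply: lt_le_trans (hy n).
by rewrite cabsV cabsX lef_pV2 ?posrE ?exprn_gt0// lerXn2r ?nnegrE ?(ltW p) ?(ltW t0).
Qed.

Lemma cabs_q_lt1 (tau : C) : 0 < complex.Im tau -> cabs (cexp (u * tau)) < 1.
Proof.
move=> t0; rewrite cabs_cexp -expR0 ltr_expR.
have -> : complex.Re (u * tau) = - (2 * pi) * complex.Im tau.
  by rewrite /two_pi_i; case: (tau) => a b; simpc.
by rewrite mulNr oppr_lt0 mulr_gt0// mulr_gt0// pi_gt0.
Qed.

Lemma pow_series_summable s (q : C) : cabs q < 1 ->
  abs_summable (fun m => m%:R ^+ s * q ^+ m).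
Proof. by move=> q1; exact: subexp_summable (subexp_pow s) q1. Qed.

(** Lipschitz' formula: both sides are the k-th coefficients of the expansion of [Esum] in a
    real increment h at [tau].  On the left the partial fractions are expanded; on the right,
    [Esum] is [Dfun], a power series in exp (u (tau + h)), and the powers of exp (u h) are
    expanded. *)
Lemma lipschitz (tau L Q : C) k : 0 < complex.Im tau ->
  has_sum (fun n : int => (tau + n%:~R) ^- k.+2) L ->
  has_sum (fun m => m%:R ^+ k.+1 * cexp (u * tau) ^+ m) Q ->
  k.+1%:R * (-1) ^+ k * L = u ^+ k.+2 / (k`!)%:R * Q.
Proof.
move=> t0 hL hQ; set q := cexp (u * tau) in hQ.
have q1 := cabs_q_lt1 t0.
pose LL j := summability.sum (fun n : int => (tau + n%:~R) ^- j.+2 : C^o).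
have hLL j : has_sum (fun n : int => (tau + n%:~R) ^- j.+2) (LL j).
  exact/has_sum_sum/tau_summable.
pose QQ j := summability.sum (fun m : nat => m%:R ^+ j.+1 * q ^+ m : C^o).
have hQQ j : has_sum (fun m => m%:R ^+ j.+1 * q ^+ m) (QQ j).
  exact/has_sum_sum/pow_series_summable.
rewrite (has_sum_unique hL (hLL k)) (has_sum_unique hQ (hQQ k)).
pose y := complex.Im tau; have y2 : 0 < y / 2 by rewrite divr_gt0.
apply: (power_series_unique (S := fun h => Esum (tau + h%:C%C)) y2
  (c := fun j => j.+1%:R * (-1) ^+ j * LL j)
  (c' := fun j => u ^+ j.+2 / (j`!)%:R * QQ j)) => h /andP[h0 hy].
  apply: (has_sum_taylor_inv2 (c := fun=> 1) (a := fun n : int => tau + n%:~R) y2).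
  - move=> n; rewrite mulrC divfK ?pnatr_eq0//.
    apply: le_trans (Im_le_cabs _); apply: le_trans (ler_norm _).
    by rewrite intC /y; case: (tau) => c e /=; rewrite addr0.
  - by apply: (abs_summable_le (c := 1) (inv2_shift_summable tau)) => n; rewrite !mul1r.
  - by rewrite cabsR gtr0_norm.
  - by apply: eq_has_sum (Esum_has_sum _) => n; rewrite mul1r addrAC.
  - by move=> j; apply: eq_has_sum (hLL j) => n; rewrite mul1r.
have Ih : complex.Im (tau + h%:C%C) = y by rewrite /y; case: (tau) => c e /=; rewrite addr0.
have ni : nonint (tau + h%:C%C).
  move=> m; apply/eqP => /(congr1 (@complex.Im R)); rewrite Ih intC /= => y0.
  by move: t0; rewrite -/y y0 ltxx.
rewrite (Esum_Dfun ni) /Dfun mulrDr cexpD -/q; set e := cexp _.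
have e1 : cabs e = 1.
  rewrite cabs_cexp (_ : complex.Re _ = 0) ?expR0//.
  by rewrite /two_pi_i; simpc.
have qe1 : cabs (q * e) < 1 by rewrite cabsM e1 mulr1.
have hg := has_sumZ (u ^+ 2) (has_sum_geom1 qe1).
have -> : u ^+ 2 * (q * e) / (q * e - 1) ^+ 2 = u ^+ 2 * (q * e / (1 - q * e) ^+ 2).
  by rewrite (_ : (q * e - 1) ^+ 2 = (1 - q * e) ^+ 2) ?mulrA//; ring.
(* h <= Im tau / 2 makes the double family in (m, j) absolutely summable. *)
pose F (x : nat * nat) := u ^+ 2 * (x.1%:R * q ^+ x.1) * ((x.1%:R * (u * h%:C%C)) ^+ x.2 / (x.2`!)%:R).
have FS : abs_summable F.
  pose r := cabs q * expR (2 * pi * h).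
  have r0 : 0 <= r by rewrite mulr_ge0 ?cabs_ge0 ?expR_ge0.
  have r1 : cabs (r%:C%C : C) < 1.
    rewrite cabsR ger0_norm ?mulr_ge0 ?cabs_ge0 ?expR_ge0// /r cabs_cexp -expRD expR_lt1.
    have -> : complex.Re (u * tau) = - (2 * pi) * y.
      by rewrite /y /two_pi_i; case: (tau) => a b; simpc.
    have : 0 < pi * (y - h) by rewrite mulr_gt0 ?pi_gt0//; lra.
    lra.
  have [B hB] := subexp_summable (subexpMn (@subexp1 R)) r1.
  apply: (@abs_summable_prod _ _ _ F
    (fun m => cabs (u ^+ 2) * cabs (m%:R * 1 * (r%:C%C : C) ^+ m))
    (cabs (u ^+ 2) * B)) => [m A|A].
    rewrite /F /=; under eq_bigr do rewrite cabsM; rewrite -mulr_sumr.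
    apply: le_trans (ler_wpM2l _ (expterm_sum_le _ _)) _; first exact: cabs_ge0.
    rewrite !cabsM -!mulrA; apply: ler_wpM2l; first exact: cabs_ge0.
    apply: ler_wpM2l; first exact: cabs_ge0.
    rewrite cabs1 mul1r !cabsX (cabsR r) (ger0_norm r0) /r exprMn.
    apply: ler_wpM2l; first exact: cabs_ge0.
    apply: ler_wpM2l; first by rewrite exprn_ge0// cabs_ge0.
    by rewrite cabs_nat cabs_2pii cabsR gtr0_norm// expRM_natl.
  by rewrite -mulr_sumr; apply: ler_wpM2l => //; exact: cabs_ge0.
have [T hT] := abs_summable_has_sum FS.
have TS : T = u ^+ 2 * (q * e / (1 - q * e) ^+ 2).
  apply: has_sum_unique hg; apply: (has_sum_fubini hT) => m /=.
  have -> : u ^+ 2 * (m%:R * (q * e) ^+ m) = u ^+ 2 * (m%:R * q ^+ m) * cexp (m%:R * (u * h%:C%C)).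
    by rewrite cexp_natM -/e exprMn; ring.
  exact/has_sumZ/cexp_has_sum.
rewrite -TS; apply: (has_sum_fubini2 hT) => j /=.
have := has_sumZ (u ^+ j.+2 / (j`!)%:R * h%:C%C ^+ j) (hQQ j).
rewrite (mulrAC _ (h%:C%C ^+ j)); apply: eq_has_sum => m; rewrite /F /= !exprMn !exprS.
by ring.
Qed.

(** ** Values at even integers of the zeta function *)

Lemma fpsM_scale (f g : fps C) (x : C) :
  (fun n => x ^+ n * (f * g : fps C) n) =
  ((fun n => x ^+ n * f n) : fps C) * (fun n => x ^+ n * g n).
Proof.
apply/funext => n; rewrite !fpsM mulr_sumr; apply: eq_bigr => i _.
have il : (i <= n)%N by rewrite -ltnS.
have -> : x ^+ n = x ^+ i * x ^+ (n - i) by rewrite -exprD subnKC.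
by ring.
Qed.

(** The terms of the zeroth row of the lattice sum; for odd j they cancel in pairs. *)
Definition punctured_term (j : nat) (n : int) : C := if n == 0 then 0 else n%:~R ^- j.+2.

Lemma punctured_summable j : abs_summable (punctured_term j).
Proof.
apply: (abs_summable_le (c := 1) (@inv2_int_summable R)) => n; rewrite mul1r /punctured_term.
case: eqP => [_|/eqP n0]; first by rewrite cabs0 cabs_ge0.
have n1 : 1 <= cabs (n%:~R : C) by rewrite cabs_int -intr_norm ler1z; lia.
rewrite !cabsV !cabsX lef_pV2 ?posrE ?exprn_gt0//; try lra.
by rewrite ler_weXn2l.
Qed.

(** Both sides are coefficients of h^2 [Esum] h at h = 0: multiplied by the square of
    (exp w - 1) / w, w = u h, this function becomes exp w, and formal power series can be
    cancelled. *)
Lemma zeta_bern1 (j : nat) (Z : C) : has_sum (punctured_term j) Z ->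
  j.+1%:R * (-1) ^+ j * Z = u ^+ j.+2 * bern R 1 j.+2.
Proof.
pose ZZ j := summability.sum (punctured_term j : int -> C^o).
have hZ i : has_sum (punctured_term i) (ZZ i) by exact/has_sum_sum/punctured_summable.
move=> /has_sum_unique /(_ (hZ j)) ->.
pose P (h : R) : C := Esum h%:C%C - h%:C%C ^- 2.
pose p : fps C := fun n => if n is n'.+1 then if n' is i.+1 then i.+1%:R * (-1) ^+ i * ZZ i else 0 else 1.
have hP (h : R) : 0 < h <= 1 / 2 ->
    has_sum (fun i => i.+1%:R * (-1) ^+ i * ZZ i * h%:C%C ^+ i) (P h).
  move=> /andP[h0 h2].
  apply: (has_sum_taylor_inv2 (rho := 1 / 2)
     (c := fun n : int => (n != 0)%:R) (a := fun n : int => if n == 0 then 1 else n%:~R)).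
  - lra.
  - move=> n; case: eqP => [_|/eqP n0]; first by rewrite cabs1; lra.
    have : 1 <= cabs (n%:~R : C) by rewrite cabs_int -intr_norm ler1z; lia.
    lra.
  - apply: (abs_summable_le (c := 1) (punctured_summable 0)) => n; rewrite mul1r /punctured_term.
    by case: eqP => _; rewrite ?mul0r ?mul1r.
  - by rewrite cabsR gtr0_norm.
  - have h1 := @has_sum1 R _ (fun n : int => if n == 0 then (h%:C%C + n%:~R) ^- 2 else 0) 0.
    rewrite eqxx addr0 in h1.
    apply: eq_has_sum (has_sumB (Esum_has_sum h%:C%C) (h1 _)) => [n|n /negbTE ->//].
    by case: eqP => _; rewrite ?mul0r ?mul1r ?subrr// subr0 addrC.
  - move=> i; apply: eq_has_sum (hZ i) => n; rewrite /punctured_term.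
    by case: eqP => _; rewrite ?mul0r ?mul1r.
have hp (h : R) : 0 < h <= 1 / 2 ->
    has_sum (fun i => p i * h%:C%C ^+ i) (1 + h%:C%C ^+ 2 * P h).
  move=> hh; have h1 := has_sumZ (h%:C%C ^+ 2) (hP h hh).
  have h2 : has_sum (fun i => if i is i'.+2 then p i * h%:C%C ^+ i else 0) (h%:C%C ^+ 2 * P h).
    apply: (has_sum_extend (h := fun n => n.+2) (h' := fun n => n.-2)) => //.
    - by case=> [|[|n]]; rewrite ?eqxx.
    - by apply: eq_has_sum h1 => i; rewrite /p /= !exprS; ring.
  have h3 := @has_sum1 R _ (fun i : nat => if i == 0%N then 1 else 0) 0%N.
  rewrite eqxx in h3.
  apply: eq_has_sum (has_sumD (h3 _) h2) => [[|[|i]]|i /negbTE ->//] /=.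
  - by rewrite expr0 mulr1 addr0.
  - by rewrite mul0r addr0.
  - by rewrite add0r.
have ps h : 0 < h <= 1 / 4 -> abs_summable (fun i => p i * (h%:C%C : C) ^+ i).
  by move=> hh; apply: (abs_summable_half (hp (1 / 2) _)); lra.
pose eps : fps C := fun i => u ^+ i * fE R i.
have epsS (h : R) : 0 < h -> has_sum (fun i => eps i * h%:C%C ^+ i)
    ((cexp (u * h%:C%C) - 1) / (u * h%:C%C)).
  move=> h0; have w0 : u * h%:C%C != 0.
    by rewrite mulf_neq0 ?two_pi_i_neq0//; apply/eqP => -[] /eqP; rewrite gt_eqF.
  have := has_sumZ (u * h%:C%C)^-1 (has_sum_shift 1 (cexp_has_sum (u * h%:C%C))).
  rewrite big_ord1 expr0 fact0 divr1 (mulrC (cexp _ - 1)).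
  apply: eq_has_sum => i; rewrite addn1 /eps /fE exprS mulrA mulKf//.
  by rewrite exprMn mulrAC.
have epsA (h : R) : 0 < h -> abs_summable (fun i => eps i * (h%:C%C : C) ^+ i).
  move=> h0; apply: (abs_summable_le (c := 1) (expterm_summable (u * h%:C%C))) => i.
  rewrite mul1r /eps /fE !cabsM !cabsX cabsM exprMn mulrAC; apply: ler_wpM2l.
    by rewrite mulr_ge0 ?exprn_ge0 ?cabs_ge0.
  by rewrite !cabsV !cabs_nat lef_pV2 ?posrE ?ltr0n ?fact_gt0// ler_nat leq_fact.
have E2 : p * (eps * eps) = (fun i => u ^+ i * fexp (1 : C) i : C).
  apply/funext => n; apply: (power_series_unique (c := p * (eps * eps))
     (c' := fun i => u ^+ i * fexp (1 : C) i) (rho := 1 / 4)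
     (S := fun h => cexp (u * h%:C%C))); first by lra.
    move=> h hh; have /andP[h0 h4] := hh.
    have w0 : h%:C%C != 0 :> C by apply/eqP => -[] /eqP; rewrite gt_eqF.
    have hee := has_sum_conv (epsA h h0) (epsA h h0) (epsS h h0) (epsS h h0).
    have hh2 : 0 < h <= 1 / 2 by lra.
    have eeA : abs_summable (fun i => (eps * eps : fps C) i * (h%:C%C : C) ^+ i).
      have p2 : 0 < (1 / 2 : R) by lra.
      have := has_sum_conv (epsA _ p2) (epsA _ p2) (epsS _ p2) (epsS _ p2).
      by move=> /abs_summable_half; apply; lra.
    have := has_sum_conv (ps h hh) eeA (hp h hh2) hee.
    rewrite (_ : _ * _ = cexp (u * h%:C%C)) //.
    rewrite /P Esum_Dfun; last first.
      move=> m; apply/eqP; rewrite intC => -[] E; move: h0 h4; rewrite E.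
      rewrite ltr0z => m0; have : (1 : R) <= m%:~R by rewrite ler1z.
      lra.
    have e1 : cexp (u * h%:C%C) - 1 != 0.
      rewrite subr_eq0; apply/eqP => /cexp_eq1 [m]; rewrite intC => -[] E; move: h0 h4; rewrite E.
      rewrite ltr0z => m0; have : (1 : R) <= m%:~R by rewrite ler1z.
      lra.
    by rewrite /Dfun; field; rewrite e1 w0 two_pi_i_neq0.
  move=> h /andP[h0 h4]; apply: eq_has_sum (cexp_has_sum (u * h%:C%C)) => i.
  by rewrite /fexp expr1n exprMn; ring.
have p1 : p = (fun i => u ^+ i * bern R 1 i).
  have ee0 : (eps * eps) 0%N = 1 by rewrite fpsM0 /eps expr0 mul1r fE0 mulr1.
  apply: (fps_cancel ee0); rewrite mulrC E2 [RHS]mulrC /eps.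
  by rewrite -!fpsM_scale -expr2 bern1E2.
by have := congr1 (fun f : fps C => f j.+2) p1.
Qed.

End LatticeSums.

(** * The q-expansions of the Eisenstein series *)

Section Eisenstein.
Variable R : realType.
Local Notation C := R[i].
Local Notation cexp := (@cexp R).
Local Notation u := (two_pi_i R).

Definition sigma (s N : nat) : C :=
  \sum_(d < N.+1 | (0 < d)%N && (d %| N)%N) (d : nat)%:R ^+ s.

(** The coefficients of (2 pi i) ^ (-2k) G_2k as a power series in q. *)
Definition eis (k N : nat) : C :=
  if N is 0%N then - bern R 0 (2 * k) else 2 / ((2 * k).-1`!)%:R * sigma (2 * k).-1 N.

(** The double family l^s q^((m + 1) l) is summed once over l first, and once by the values N
    of (m + 1) l. *)
Lemma lambert s (q : C) (Q : nat -> C) : cabs q < 1 ->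
  (forall m, has_sum (fun l => l%:R ^+ s.+1 * (q ^+ m.+1) ^+ l) (Q m)) ->
  exists2 S, has_sum (fun N => sigma s.+1 N * q ^+ N) S & has_sum Q S.
Proof.
move=> q1 hQ.
pose F (x : nat * nat) : C := x.2%:R ^+ s.+1 * (q ^+ x.1.+1) ^+ x.2.
have q0 := cabs_ge0 q.
have FS : abs_summable F.
  have h1 : abs_summable (fun m => 1 * q ^+ m) := subexp_summable (@subexp1 R) q1.
  have h2 := pow_series_summable s.+1 q1.
  apply: (abs_summable_le (c := 1) (abs_summableM h1 h2)) => -[m [|l]] /=.
    by rewrite /F /= mulr0n expr0n /= mul0r cabs0 mul1r cabs_ge0.
  rewrite !mul1r /F /= mulrCA cabsM [leRHS]cabsM; apply: ler_wpM2l; first exact: cabs_ge0.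
  rewrite -exprM -exprD !cabsX; apply: ler_wiXn2l => //; first exact: ltW.
  by rewrite mulSn mulnS; lia.
have [S hS] := abs_summable_has_sum FS.
exists S; last by apply: (has_sum_fubini hS) => m; exact: hQ.
apply: (has_sum_fiber (p := fun x : nat * nat => (x.1.+1 * x.2)%N) hS) => N.
case: (posnP N) => [->|N0].
  rewrite (_ : sigma _ _ * _ = 0); last first.
    by rewrite /sigma big_pred0 ?mul0r// => -[[|]].
  apply: eq_has_sum (@has_sum0 _ _) => -[m [|l]]; last by [].
  by rewrite /= muln0 eqxx /F /= mulr0n expr0n mul0r.
pose A := [fset ((N %/ (nat_of_ord d)).-1, nat_of_ord d) |
  d in [pred d : 'I_N.+1 | (0 < d)%N && (d %| N)%N]]%fset.
have := @has_sum_fin R _ (fun x : nat * nat => if (x.1.+1 * x.2 == N)%N then F x else 0) A.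
rewrite (_ : \sum_(x <- A) _ = sigma s.+1 N * q ^+ N).
  apply; case=> m l mlA /=; case: eqP => // E; case/negP: mlA.
  have l0 : (0 < l)%N by case: l E => //; lia.
  have lN : (l < N.+1)%N by rewrite ltnS -E; lia.
  have lD : (l %| N)%N by rewrite -E dvdn_mull.
  apply/imfsetP; exists (Ordinal lN) => /=; first by apply/andP.
  by rewrite -E mulnK.
rewrite /A big_imfset /=; last by move=> i j _ _ [_ /val_inj].
rewrite /sigma mulr_suml.
rewrite big_enum /=; apply: eq_bigr => d /andP[d0 dN].
have E : ((N %/ d).-1.+1 * d)%N = N.
  by rewrite prednK ?divnK// divn_gt0// dvdn_leq.
by rewrite E eqxx /F /= -exprM E.
Qed.

Lemma eisS k N : eis k.+1 N.+1 = 2 / ((2 * k).+1`!)%:R * sigma (2 * k).+1 N.+1.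
Proof. by rewrite /eis (_ : (2 * k.+1).-1 = (2 * k).+1)//; lia. Qed.

Lemma sigma_subexp s : subexp (sigma s).
Proof.
apply: (subexp_le (subexpD (subexp_pow s.+1) (subexp_pow s))) => N.
rewrite /sigma; apply: le_trans (cabs_sum _ _ _) _.
rewrite big_mkcond; apply: (@le_trans _ _ (\sum_(d < N.+1) N%:R ^+ s)).
  apply: ler_sum => d _; case: ifP => [_|_]; last by rewrite exprn_ge0.
  rewrite cabsX cabs_nat lerXn2r ?nnegrE// ler_nat -ltnS; exact: ltn_ord.
rewrite sumr_const card_ord -(mulr_natl (_ ^+ s)).
have -> : N%:R ^+ s.+1 + N%:R ^+ s = (N.+1 * N ^ s)%:R :> C.
  by rewrite natrM natrX exprS -natr1; ring.
by rewrite cabs_nat natrM natrX.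
Qed.

Lemma eis_subexp k : subexp (eis k).
Proof.
have h := subexpD (subexpZ (2 / ((2 * k).-1`!)%:R) (sigma_subexp (2 * k).-1))
  (subexp_delta (- bern R 0 (2 * k))).
apply: (subexp_le h) => -[|N] /=; last by rewrite mulr0n addr0.
by rewrite {1}/sigma big_pred0 ?mulr0 ?add0r// => -[[|]].
Qed.

Definition qq (tau : upper_half R) : C := cexp (u * val tau).

Lemma cabs_qq tau : cabs (qq tau) < 1.
Proof. by apply: cabs_q_lt1; exact: (valP tau). Qed.

(** Lipschitz' formula at |m| tau; for negative m the row is reversed. *)
Lemma row_sum (k : nat) (tau : C) (m : int) (s : C) : 0 < complex.Im tau -> m != 0 ->
  has_sum (fun l => l%:R ^+ (2 * k).+1 * (cexp (u * tau) ^+ `|m|%N) ^+ l) s ->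
  has_sum (fun n : int => (m%:~R * tau + n%:~R) ^- (2 * k.+1))
    (u ^+ (2 * k.+1) / ((2 * k).+1`!)%:R * s).
Proof.
move=> t0 m0 hs.
have mt : 0 < complex.Im (`|m|%:R * tau).
  have -> : complex.Im (`|m|%:R * tau) = `|m|%:R * complex.Im tau.
    by rewrite natC; case: (tau) => a b; simpc.
  by rewrite mulr_gt0// ltr0n absz_gt0.
have E2 : (2 * k.+1)%N = (2 * k).+2 by lia.
have hL := has_sum_sum (tau_summable (2 * k) mt).
set L := summability.sum _ in hL.
have := lipschitz mt hL; rewrite mulrCA cexp_natM => /(_ _ hs) EL.
have {EL} : L = u ^+ (2 * k.+1) / ((2 * k).+1`!)%:R * s.
  have k0 : ((2 * k).+1%:R : C) != 0 by rewrite pnatr_eq0.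
  apply: (mulfI k0); move: EL; rewrite exprM sqrrN !expr1n mulr1 => ->.
  rewrite E2 factS natrM; have := fact_neq0 R (2 * k).
  by move=> f0; field; rewrite f0 -natrM nat1r k0.
move=> <-; rewrite E2; case: m m0 {hs mt} @L hL => m m0 /= hL.
  by apply: eq_has_sum hL.
have := has_sum_bij (h := -%R) (h' := -%R) (@opprK _) (@opprK _) hL.
apply: eq_has_sum => n; rewrite NegzE !rmorphN /=.
have -> : - m.+1%:~R * tau + n%:~R = - (m.+1%:R * tau - n%:~R) by rewrite -pmulrn; ring.
by rewrite -E2 !exprM sqrrN.
Qed.

(** [zeta_bern1], rewritten in terms of Bernoulli numbers. *)
Lemma row0_sum (k : nat) : has_sum (fun n : int => punctured_term R (2 * k) n)
   (u ^+ (2 * k.+1) * - bern R 0 (2 * k.+1)).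
Proof.
have hZ := has_sum_sum (punctured_summable R (2 * k)).
have := zeta_bern1 hZ; set Z := summability.sum _ in hZ *.
rewrite exprM sqrrN !expr1n mulr1 bern1_bern0.
have -> : (2 * k).+2 = (2 * k.+1)%N by lia.
have k0 : ((2 * k).+1%:R : C) != 0 by rewrite pnatr_eq0.
move=> E; suff <- : Z = u ^+ (2 * k.+1) * - bern R 0 (2 * k.+1) by [].
apply: (mulfI k0); rewrite E.
have -> : 1 - (2 * k.+1)%:R = - (2 * k).+1%:R :> C.
  by rewrite (_ : (2 * k.+1)%N = (2 * k).+2) -?natr1; [ring|lia].
by ring.
Qed.

(** The terms of [zeta_bern1] at n and - n cancel. *)
Lemma bern_odd n : bern R 1 n.*2.+3 = 0.
Proof.
have hZ := has_sum_sum (punctured_summable R n.*2.+1).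
have := zeta_bern1 hZ; set Z := summability.sum _ in hZ *.
have Z0 : Z = 0.
  have h2 := has_sum_bij (h := -%R) (h' := -%R) (@opprK int) (@opprK int) hZ.
  have h3 := has_sumN hZ.
  have E : Z = - Z.
    apply: has_sum_unique h2 (eq_has_sum _ h3) => m; rewrite /punctured_term oppr_eq0.
    case: eqP => _; first by rewrite oppr0.
    rewrite rmorphN /= exprNn -signr_odd /= odd_double /= expr1 mulN1r invrN //.
  apply/eqP; move/eqP: E; rewrite -subr_eq0 opprK -mulr2n -mulr_natl mulf_eq0 pnatr_eq0 /=.
  by [].
rewrite Z0 mulr0 => /esym/eqP; rewrite mulf_eq0 expf_eq0 /= => /orP[|/eqP//].
by rewrite (negbTE (two_pi_i_neq0 R)).
Qed.

Lemma bern1_1 : bern R 1 1 = 0.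
Proof. by rewrite bern1_bern0 subrr mul0r. Qed.

Lemma bern1_2 : bern R 1 2 = - (1 / 12).
Proof.
have := congr1 (fun f : fps C => f 2) (bern1E2 R).
rewrite expr2 !fpsM !big_ord_recr !big_ord0 /= !fpsM !big_ord_recr !big_ord0 /=.
rewrite /fE /fexp /= !bern_at0 !(fact0, expr1n).
rewrite (_ : 1`! = 1%N) // (_ : 2`! = 2%N) // (_ : 3`! = 6%N) // bern1_1.
move=> /eqP; rewrite -subr_eq0 => /eqP h2.
by apply/eqP; rewrite -subr_eq0 -[X in _ == X]h2; apply/eqP; field.
Qed.

(** The definite quadratic form |m tau + n|^2 is bounded below by a multiple of m^2 + n^2, so
    that the terms are dominated by the products of 1 / (1 + m^2) and 1 / (1 + n^2). *)
Lemma lattice_summable (k : nat) (tau : C) : 0 < complex.Im tau ->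
  abs_summable (fun mn : int * int => @lattice_term R k.+2 tau mn.1 mn.2 : C).
Proof.
move=> t0; case: tau t0 => x y /= y0.
(* From n^2 <= 2 (m x + n)^2 + 2 (m x)^2 and m^2 = (m y)^2 / y^2. *)
pose B : R := (1 + 2 * x ^+ 2) / y ^+ 2 + 2.
have y2 : 0 < y ^+ 2 by rewrite exprn_gt0.
have A0 : 0 <= (1 + 2 * x ^+ 2) / y ^+ 2.
  by rewrite divr_ge0 ?(ltW y2)//; have := sqr_ge0 x; lra.
have B0 : 0 < B by rewrite /B; lra.
have hB (m n : int) : (m%:~R ^+ 2 + n%:~R ^+ 2 : R) <= B * cabs (m%:~R * (x +i* y)%C + n%:~R) ^+ 2.
  rewrite cabs_sqr !intC; simpc; rewrite /=.
  set a : R := m%:~R; set b : R := n%:~R.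
  have h1 : b ^+ 2 <= 2 * (a * x + b) ^+ 2 + 2 * (a * x) ^+ 2.
    by have := sqr_ge0 (2 * (a * x) + b); nra.
  rewrite /B mulrDl.
  have -> : (1 + 2 * x ^+ 2) / y ^+ 2 * ((a * x + b) ^+ 2 + (a * y) ^+ 2) =
    (1 + 2 * x ^+ 2) / y ^+ 2 * (a * x + b) ^+ 2 + (1 + 2 * x ^+ 2) * a ^+ 2.
    by field; rewrite gt_eqF.
  have : 0 <= (1 + 2 * x ^+ 2) / y ^+ 2 * (a * x + b) ^+ 2.
    by rewrite mulr_ge0 ?sqr_ge0.
  have := sqr_ge0 (a * y); have := sqr_ge0 (a * x + b); have := sqr_ge0 a; have := sqr_ge0 (a * x); nra.
pose w (n : int) : C := (1 + n%:~R ^+ 2)^-1.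
have wE n : cabs (w n) = (1 + n%:~R ^+ 2)^-1 :> R.
  rewrite /w cabsV intC -rmorphXn -(rmorph1 (real_complex R)) -rmorphD /= cabsR ger0_norm//.
  by rewrite addr_ge0// sqr_ge0.
have ws : abs_summable w.
  apply: (abs_summable_near (A := [fset (0 : int)]%fset) (@inv2_int_summable R)) => n.
  rewrite inE => n0; rewrite wE cabsV cabsX cabs_int -normrX ger0_norm ?sqr_ge0//.
  have : 0 < (n%:~R : R) ^+ 2 by rewrite lt_neqAle sqr_ge0 andbT eq_sym expf_neq0// intr_eq0.
  by move=> p; rewrite lef_pV2 ?posrE; lra.
apply: (abs_summable_le (c := 3 * B ^+ k.+2) (abs_summableM ws ws)) => -[m n] /=.
rewrite /lattice_term; case: eqP => [_|/eqP mn0].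
  rewrite cabs0 mulr_ge0 ?cabs_ge0// mulr_ge0// exprn_ge0// ltW//.
rewrite cabsM !wE cabsV cabsX exprM.
have s1 : 1 <= m%:~R ^+ 2 + n%:~R ^+ 2 :> R.
  rewrite -!rmorphXn -rmorphD /= ler1z.
  have : (m != 0) || (n != 0) by move: mn0; rewrite xpair_eqE negb_and.
  nia.
have hm := sqr_ge0 (m%:~R : R); have hn := sqr_ge0 (n%:~R : R).
have := hB m n; set S := cabs _ ^+ 2.
set a := m%:~R ^+ 2 in s1 hm *; set b := n%:~R ^+ 2 in s1 hn *; clearbody S.
move=> hS; have S0 : 0 < S by rewrite -(pmulr_rgt0 S B0); lra.
have -> : 3 * B ^+ k.+2 * ((1 + a)^-1 / (1 + b)) = (3 / ((1 + a) * (1 + b))) * B ^+ k.+2.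
  by rewrite invfM; ring.
have S1 : (B * S) ^- k.+2 <= (a + b) ^- 2.
  rewrite lef_pV2 ?posrE; first last.
  - by rewrite exprn_gt0//; lra.
  - by rewrite exprn_gt0// mulr_gt0.
  apply: (@le_trans _ _ ((a + b) ^+ k.+2)).
    by apply: ler_weXn2l.
  have BS : 0 <= B * S by rewrite mulr_ge0 ?ltW.
  by rewrite lerXn2r ?nnegrE//; lra.
have -> : S ^- k.+2 = (B * S) ^- k.+2 * B ^+ k.+2.
  rewrite exprMn; have : B ^+ k.+2 != 0 by rewrite expf_neq0// gt_eqF.
  have : S ^+ k.+2 != 0 by rewrite expf_neq0// gt_eqF.
  move: (B ^+ _) (S ^+ _) => b' s' s0 b0; by field; rewrite s0 b0.
apply: ler_wpM2r; first by rewrite exprn_ge0// ltW.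
apply: le_trans S1 _.
rewrite ler_pdivlMr; last by rewrite mulr_gt0//; lra.
rewrite mulrC ler_pdivrMr; last by rewrite exprn_gt0//; lra.
nra.
Qed.

(** The row m = 0 gives the constant term, and the rows m and - m together a Lambert series.
    For k = 1 only the iterated sum converges, and its constant term pi^2 / 3 is explicit. *)
Lemma eisenstein_q (k : nat) (tau : upper_half R) : (1 <= k)%N ->
  has_sum (fun N => u ^+ (2 * k) * eis k N * qq tau ^+ N) (eisenstein k tau).
Proof.
case: k => // k _; have t0 := valP tau; have q1 := cabs_qq tau.
have q1m m : cabs (qq tau ^+ m.+1) < 1.
  by rewrite cabsX exprn_ilt1// cabs_ge0.
pose Q m := summability.sum (fun l : nat => l%:R ^+ (2 * k).+1 * (qq tau ^+ m.+1) ^+ l : C^o).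
have hQ m : has_sum (fun l => l%:R ^+ (2 * k).+1 * (qq tau ^+ m.+1) ^+ l) (Q m).
  exact/has_sum_sum/pow_series_summable.
have [S hS hQS] := lambert q1 hQ.
pose c : C := u ^+ (2 * k.+1) / ((2 * k).+1`!)%:R.
pose z : C := u ^+ (2 * k.+1) * - bern R 0 (2 * k.+1).
(* z is the zeroth row, and c S is the sum of the rows with m > 0. *)
have hq : has_sum (fun N => u ^+ (2 * k.+1) * eis k.+1 N * qq tau ^+ N) (z + 2 * c * S).
  have h0 := @has_sum1 R _ (fun N : nat => if N == 0%N then z else 0) 0%N.
  rewrite eqxx in h0.
  apply: eq_has_sum (has_sumD (h0 _) (has_sumZ (2 * c) hS)) => [[|N]|N /negbTE ->//].
    rewrite /sigma big_pred0 => [|[[]]//].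
    by rewrite eqxx mul0r mulr0 addr0 expr0 mulr1.
  by rewrite [X in X + _]/= add0r eisS /c; ring.
pose row (m : int) : C := if m == 0 then 0 else c * Q `|m|.-1.
have hrow : has_sum row (2 * c * S).
  have -> : 2 * c * S = c * S + c * S by ring.
  have h1 := has_sumZ c hQS.
  apply: has_sum_int; last exact: eq_has_sum h1.
  apply: (has_sum_extend (h := succn) (h' := predn)); last exact: eq_has_sum h1.
    by [].
  by case=> [|n]; rewrite ?eqxx.
have hr m : m != 0 -> has_sum (fun n : int => (m%:~R * val tau + n%:~R) ^- (2 * k.+1)) (row m).
  move=> m0; rewrite /row (negbTE m0); apply: row_sum => //.
  by have := hQ `|m|.-1; rewrite prednK // absz_gt0.
case: k @c @z Q hQ hS hQS hq @row hrow hr => [|k] c z Q hQ hS hQS hq row hrow hr.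
  rewrite /eisenstein eqxx.
  rewrite (_ : (fun m : int => _) = row); last first.
    apply/funext => m; case: (eqVneq m 0) => [->|m0]; first by rewrite /row eqxx.
    apply: has_sum_cvg; apply: eq_has_sum (hr m m0) => n.
    by rewrite /lattice_term xpair_eqE (negbTE m0).
  rewrite (has_sum_cvg hrow).
  suff <- : z = (pi ^+ 2 / 3)%:C%C by [].
  have := bern1_2; rewrite bern1_bern0 => b2.
  have -> : z = - (u ^+ 2 / 12).
    have -> : z = u ^+ 2 * ((1 - 2%:R) * bern R 0 2) by rewrite /z; ring.
    by rewrite b2; field.
  have -> : u ^+ 2 = - ((4 * pi ^+ 2)%:C)%C.
    by rewrite /two_pi_i expr2; simpc; congr Complex; ring.
  rewrite mulNr opprK (natC R 12) -fmorphV -rmorphM; congr (_%:C)%C.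
  by field.
rewrite /eisenstein /=.
have [T hT] := abs_summable_has_sum (lattice_summable k t0).
rewrite (has_sum_cvg hT).
suff -> : T = z + 2 * c * S by [].
pose row' (m : int) := row m + if m == 0 then z else 0.
have hrow' : has_sum row' (2 * c * S + z).
  have h1 := @has_sum1 R _ (fun m : int => if m == 0 then z else 0) 0.
  rewrite eqxx in h1.
  by apply: has_sumD => //; apply: h1 => m /negbTE ->.
rewrite addrC; apply: has_sum_unique hrow'; apply: (has_sum_fubini hT) => m /=.
case: (eqVneq m 0) => [->|m0].
  rewrite /row' /row eqxx add0r; apply: eq_has_sum (row0_sum k.+1) => n.
  rewrite /lattice_term /punctured_term xpair_eqE eqxx mul0r add0r.
  by rewrite (_ : (2 * k.+1).+2 = (2 * k.+2)%N)//; lia.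
rewrite /row' (negbTE m0) addr0; apply: eq_has_sum (hr m m0) => n.
by rewrite /lattice_term xpair_eqE (negbTE m0).
Qed.

End Eisenstein.

(** ** Cauchy products *)

Section CauchyProducts.
Variable R : realType.
Local Notation C := R[i].

Lemma convA (f g h : nat -> C) n : conv f (conv g h) n = conv (conv f g) h n.
Proof. exact (congr1 (fun F : fps C => F n) (mulrA (f : fps C) g h)). Qed.

Lemma convC (f g : nat -> C) n : conv f g n = conv g f n.
Proof. exact (congr1 (fun F : fps C => F n) (mulrC (f : fps C) g)). Qed.

Lemma convDl (f f' g : nat -> C) n : conv (fun m => f m + f' m) g n = conv f g n + conv f' g n.
Proof. exact (congr1 (fun F : fps C => F n) (mulrDl (f : fps C) f' g)). Qed.

Lemma convZl c (f g : nat -> C) n : conv (fun m => c * f m) g n = c * conv f g n.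
Proof. by rewrite /conv mulr_sumr; apply: eq_bigr => i _; rewrite mulrA. Qed.

Lemma conv_delta c (g : nat -> C) n : conv (fun m => c *+ (m == 0%N)) g n = c * g n.
Proof. exact: (fpsCM (K := C) c g n). Qed.

Lemma eq_conv (f g g' : nat -> C) n : g =1 g' -> conv f g n = conv f g' n.
Proof. by move=> h; apply: eq_bigr => i _; rewrite h. Qed.

Lemma conv0r f g n : (forall i, g i = 0) -> conv f g n = 0 :> C.
Proof. by move=> h; rewrite /conv big1// => i _; rewrite h mulr0. Qed.

Lemma conv_sumr f (I : Type) (s : seq I) (g : I -> nat -> C) n :
  conv f (fun i => \sum_(x <- s) g x i) n = \sum_(x <- s) conv f (g x) n.
Proof.
by rewrite /conv exchange_big /=; apply: eq_bigr => i _; rewrite mulr_sumr.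
Qed.

Lemma sum_pairs (S : nmodType) (F : nat -> S) K :
  \sum_(s < 2 * K) F s = \sum_(p < K) (F (2 * p)%N + F (2 * p).+1).
Proof.
elim: K => [|K IH]; first by rewrite muln0 !big_ord0.
by rewrite mulnS !big_ord_recr /= IH addrA.
Qed.

(** In the applications the odd terms beyond the first vanish, Bernoulli numbers of odd index
    being 0. *)
Lemma sum_pairs_tail (S : nmodType) (F : nat -> S) K :
  \sum_(s < 2 * K.+1) F s =
  F 0%N + F 1%N + \sum_(p < K) (F (2 * p).+2 + F (2 * p).+3).
Proof.
rewrite sum_pairs big_ord_recl; congr (_ + _); apply: eq_bigr => p _.
by rewrite (_ : (2 * lift ord0 p)%N = (2 * p).+2)//= /bump /=; lia.
Qed.

Lemma sum_pairs_last (S : nmodType) (F : nat -> S) K :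
  (forall s, (2 * K <= s)%N -> F s = 0) ->
  \sum_(s < 2 * K.+1) F s = \sum_(p < K) (F (2 * p)%N + F (2 * p).+1).
Proof.
move=> h; rewrite sum_pairs big_ord_recr /= [X in _ + X](_ : _ = 0) ?addr0//.
by rewrite h// h ?addr0//; lia.
Qed.

Lemma bern0_odd p : bern R 0 (2 * p).+3 = 0.
Proof.
have := bern_odd R p; rewrite -mul2n bern1_bern0 => /eqP; rewrite mulf_eq0 => /orP[|/eqP//].
by rewrite -(natr1 (2 * p).+2) opprD addrCA subrr addr0 oppr_eq0 pnatr_eq0.
Qed.

(** Separates the constant term of the Eisenstein series from its divisor sums. *)
Lemma conv_eis p f n : conv (eis R p.+1) f n =
  - bern R 0 (2 * p).+2 * f n + 2 / ((2 * p).+1`!)%:R * conv (sigma R (2 * p).+1) f n.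
Proof.
rewrite /conv mulr_sumr [LHS]big_ord_recl [in RHS]big_ord_recl subn0.
have -> : eis R p.+1 (ord0 : 'I_n.+1) = - bern R 0 (2 * p).+2.
  by rewrite -[nat_of_ord _]/0%N; congr (- bern _ _ _); lia.
have -> : sigma R (2 * p).+1 (ord0 : 'I_n.+1) = 0 by rewrite /sigma big_pred0// => -[[]].
rewrite mul0r mulr0 add0r; congr (_ + _); apply: eq_bigr => i _.
by rewrite [lift _ _]/= eisS mulrA.
Qed.

Lemma sign_even p : (-1) ^+ (2 * p) = 1 :> C.
Proof. by rewrite exprM sqrrN !expr1n. Qed.

End CauchyProducts.

(** * Differentiation of q-series *)

Section Derivatives.
Variable R : realType.
Local Notation C := R[i].
Local Notation H := (upper_half R).
Implicit Types (f g rho : H -> C) (tau t : H).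

Definition close_to tau (Q : H -> Prop) := exists2 D : R, 0 < D &
  forall t, cabs (val t - val tau) < D -> Q t.

Lemma close_and tau Q Q' : close_to tau Q -> close_to tau Q' ->
  close_to tau (fun t => Q t /\ Q' t).
Proof.
move=> [D D0 h] [D' D0' h']; exists (Num.min D D'); first by rewrite lt_min D0.
by move=> t; rewrite lt_min => /andP[/h ? /h' ?].
Qed.

Lemma close_imp tau (Q Q' : H -> Prop) : close_to tau Q -> (forall t, Q t -> Q' t) ->
  close_to tau Q'.
Proof. by move=> [D D0 h] hQ; exists D => // t /h /hQ. Qed.

Lemma close_lt tau (D : R) : 0 < D -> close_to tau (fun t => cabs (val t - val tau) < D).
Proof. by move=> D0; exists D. Qed.

(** [rho] is o(t - tau). *)
Definition small tau rho := forall e : R, 0 < e ->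
  close_to tau (fun t => cabs (rho t) <= e * cabs (val t - val tau)).

Lemma smallD tau rho rho' : small tau rho -> small tau rho' ->
  small tau (fun t => rho t + rho' t).
Proof.
move=> h h' e e0; have e2 : 0 < e / 2 by lra.
apply: close_imp (close_and (h _ e2) (h' _ e2)) _ => t [h1 h2].
by apply: le_trans (cabsD _ _) _; lra.
Qed.

Lemma small_quad tau rho (K : R) : 0 <= K ->
  close_to tau (fun t => cabs (rho t) <= K * cabs (val t - val tau) ^+ 2) -> small tau rho.
Proof.
move=> K0 h e e0; have D0 : 0 < e / (K + 1) by apply: divr_gt0 => //; lra.
apply: close_imp (close_and h (close_lt tau D0)) _ => t [h1 h2].
apply: le_trans h1 _; rewrite expr2 mulrA; apply: ler_wpM2r; first exact: cabs_ge0.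
have := cabs_ge0 (val t - val tau); move: h2; rewrite ltr_pdivlMr; last by lra.
by set x := cabs _ => h2 x0; nra.
Qed.

Lemma smallM tau rho g (K : R) : 0 <= K -> small tau rho ->
  close_to tau (fun t => cabs (g t) <= K) -> small tau (fun t => rho t * g t).
Proof.
move=> K0 h hg e e0; have e1 : 0 < e / (K + 1) by apply: divr_gt0 => //; lra.
apply: close_imp (close_and (h _ e1) hg) _ => t [h1 h2].
rewrite cabsM; apply: (@le_trans _ _ (e / (K + 1) * cabs (val t - val tau) * (K + 1))).
  apply: ler_pM => //; rewrite ?cabs_ge0//; lra.
by rewrite mulrAC divfK//; lra.
Qed.

Lemma small_ext tau rho rho' : small tau rho -> rho =1 rho' -> small tau rho'.
Proof. by move=> h E e /h; rewrite (funext E). Qed.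

(** The derivative at [tau] as a first-order expansion over the points of the half-plane, which
    avoids the extension by 0. *)
Definition has_ddtau f tau (l : C) :=
  small tau (fun t => f t - f tau - l * (val t - val tau)).

Lemma small0 tau : small tau (fun=> 0).
Proof.
move=> e e0; exists 1; first by [].
by move=> t _; rewrite cabs0 mulr_ge0 ?cabs_ge0 ?ltW.
Qed.

Lemma has_ddtau_eq f tau l m : l = m -> has_ddtau f tau m -> has_ddtau f tau l.
Proof. by move=> ->. Qed.

Lemma has_ddtau_cst c tau : has_ddtau (fun=> c) tau 0.
Proof. by apply: small_ext (small0 tau) _ => t; rewrite subrr mul0r subr0. Qed.

Lemma has_ddtau_id tau : has_ddtau val tau 1.
Proof. by apply: small_ext (small0 tau) _ => t; rewrite mul1r subrr. Qed.

Lemma has_ddtauD f g tau l m : has_ddtau f tau l -> has_ddtau g tau m ->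
  has_ddtau (fun t => f t + g t) tau (l + m).
Proof. by move=> hf hg; apply: small_ext (smallD hf hg) _ => t; ring. Qed.

Lemma has_ddtau_lip f tau l : has_ddtau f tau l -> exists2 K : R, 0 <= K &
  close_to tau (fun t => cabs (f t - f tau) <= K * cabs (val t - val tau)).
Proof.
move=> hf; exists (cabs l + 1); first by rewrite addr_ge0 ?cabs_ge0.
apply: close_imp (hf 1 ltr01) _ => t h.
rewrite -[f t - _](subrK (l * (val t - val tau))).
by apply: le_trans (cabsD _ _) _; rewrite cabsM; lra.
Qed.

(** f g - f(tau) g(tau) - (l g(tau) + f(tau) m) h is the sum of the remainder of f times g, the
    remainder of g times f(tau), and l h (g - g(tau)), where h is the increment. *)
Lemma has_ddtauM f g tau l m : has_ddtau f tau l -> has_ddtau g tau m ->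
  has_ddtau (fun t => f t * g t) tau (l * g tau + f tau * m).
Proof.
move=> hf hg; have [K K0 hK] := has_ddtau_lip hg.
pose b := cabs (g tau) + K.
have b0 : 0 <= b by rewrite addr_ge0 ?cabs_ge0.
have hb : close_to tau (fun t => cabs (g t) <= b).
  apply: close_imp (close_and hK (close_lt tau ltr01)) _ => t [h1 h2].
  rewrite -[g t](subrK (g tau)); apply: le_trans (cabsD _ _) _.
  rewrite /b addrC lerD2l; apply: le_trans h1 _; rewrite -[leRHS]mulr1; apply: ler_wpM2l => //.
  exact: ltW.
have h1 := smallM b0 hf hb.
have h2 : small tau (fun t => (g t - g tau - m * (val t - val tau)) * f tau).
  apply: (smallM (cabs_ge0 (f tau)) hg); exists 1 => // t _; exact: lexx.
have h3 : small tau (fun t => l * (val t - val tau) * (g t - g tau)).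
  apply: (@small_quad _ _ (cabs l * K)); first by rewrite mulr_ge0 ?cabs_ge0.
  apply: close_imp hK _ => t h; rewrite !cabsM expr2 -!mulrA; apply: ler_wpM2l; first exact: cabs_ge0.
  by rewrite mulrCA; apply: ler_wpM2l => //; exact: cabs_ge0.
by apply: small_ext (smallD h1 (smallD h2 h3)) _ => t; ring.
Qed.

Lemma has_ddtau_sum (I : Type) (s : seq I) (F : I -> H -> C) tau (l : I -> C) :
  (forall i, has_ddtau (F i) tau (l i)) ->
  has_ddtau (fun t => \sum_(i <- s) F i t) tau (\sum_(i <- s) l i).
Proof.
move=> h; elim: s => [|i s IH].
  by rewrite big_nil; under eq_fun do rewrite big_nil; exact: has_ddtau_cst.
by rewrite big_cons; under eq_fun do rewrite big_cons; exact: has_ddtauD.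
Qed.

Lemma has_ddtauX f tau l n : has_ddtau f tau l ->
  has_ddtau (fun t => f t ^+ n.+1) tau (n.+1%:R * f tau ^+ n * l).
Proof.
move=> hf; elim: n => [|n IH].
  by rewrite expr0 mulr1 mul1r; under eq_fun do rewrite expr1.
under eq_fun do rewrite exprS.
by have := has_ddtauM hf IH; congr has_ddtau; rewrite -(natr1 n.+1) exprS; ring.
Qed.

Lemma cexp_taylor2 (w : C) : exists2 a : C, cabs a <= expR (cabs w) &
  cexp w = 1 + w + w ^+ 2 * a.
Proof.
have [a ha E] := cexp_taylor 2 w; exists a => //.
by rewrite E !big_ord_recr big_ord0 /= expr0 expr1 add0r !divr1.
Qed.

Lemma has_ddtau_cexp c tau :
  has_ddtau (fun t => cexp (c * val t)) tau (c * cexp (c * val tau)).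
Proof.
apply: (@small_quad _ _ (cabs (cexp (c * val tau)) * cabs c ^+ 2 * expR (cabs c))).
  by rewrite !mulr_ge0 ?exprn_ge0 ?cabs_ge0 ?expR_ge0.
apply: close_imp (close_lt tau ltr01) _ => t h1.
set h := val t - val tau in h1 *.
have -> : val t = val tau + h by rewrite /h addrC subrK.
have [a ha E] := cexp_taylor2 (c * h).
rewrite mulrDr cexpD E.
rewrite (_ : _ - _ = cexp (c * val tau) * (c ^+ 2 * (h ^+ 2 * a))); last by ring.
rewrite cabsM (cabsM (_ ^+ 2)) (cabsM (_ ^+ 2)) !cabsX -!mulrA; apply: ler_wpM2l; first exact: cabs_ge0.
do 2 (apply: ler_wpM2l; first exact: cabs_ge0).
rewrite mulrA -expr2 mulrC; apply: ler_wpM2r; first by rewrite exprn_ge0 ?cabs_ge0.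
apply: le_trans ha _; rewrite ler_expR cabsM -[leRHS]mulr1; apply: ler_wpM2l; first exact: cabs_ge0.
exact: ltW.
Qed.

(** With h the increment, the n-th term of the remainder is at most
    |a_n| |q|^n n^2 |u h|^2 exp (n |u h|), by Taylor's formula for exp (n u h).  For |q| = exp x
    and |u h| < - x / 2, the factor |q|^n exp (n |u h|) is at most exp (x / 2)^n, and the sum over
    n converges, uniformly in h. *)
Lemma has_ddtau_qseries (a : nat -> C) f tau s : subexp a ->
  (forall t, has_sum (fun n => a n * qq t ^+ n) (f t)) ->
  has_sum (fun n => n%:R * a n * qq tau ^+ n) s ->
  has_ddtau f tau (two_pi_i R * s).
Proof.
move=> sa hf hs.
pose x := complex.Re (two_pi_i R * val tau).
have hx : cabs (qq tau) = expR x by rewrite cabs_cexp.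
have x0 : x < 0 by rewrite -expR_lt1 -hx cabs_qq.
pose y : C := (expR (x / 2))%:C%C.
have cy : cabs y = expR (x / 2) by rewrite /y cabsR ger0_norm// expR_ge0.
have y1 : cabs y < 1 by rewrite cy expR_lt1; lra.
have sa2 : subexp (fun n => n%:R ^+ 2 * a n).
  by under eq_fun do rewrite expr2 -mulrA; do 2 apply: subexpMn.
have [B hB] := subexp_summable sa2 y1.
have B0 : 0 <= B by have := hB fset0; rewrite big_seq_fset0.
have u0 : 0 < cabs (two_pi_i R) by rewrite cabs_2pii mulr_gt0// pi_gt0.
have D0 : 0 < - x / 2 / cabs (two_pi_i R) by apply: divr_gt0 => //; lra.
apply: (@small_quad _ _ (cabs (two_pi_i R) ^+ 2 * B)).
  by rewrite mulr_ge0 ?exprn_ge0 ?cabs_ge0.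
apply: close_imp (close_lt tau D0) _ => t.
set h := val t - val tau; rewrite ltr_pdivlMr// => hD.
have hq n : qq t ^+ n = qq tau ^+ n * cexp (n%:R * (two_pi_i R * h)).
  rewrite cexp_natM -exprMn -cexpD -mulrDr /qq; congr (cexp (_ * _) ^+ _).
  by rewrite /h addrC subrK.
have hsum := has_sumB (has_sumB (hf t) (hf tau)) (has_sumZ (two_pi_i R * h) hs).
rewrite (_ : _ - _ - _ = f t - f tau - two_pi_i R * h * s); last by rewrite mulrAC.
apply: (has_sum_le hsum) => X.
apply: (@le_trans _ _ (\sum_(n <- X) (cabs (two_pi_i R) ^+ 2 * cabs h ^+ 2) *
   cabs (n%:R ^+ 2 * a n * y ^+ n))); last first.
  rewrite -mulr_sumr [leRHS]mulrAC; apply: ler_wpM2l; last exact: hB.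
  by rewrite mulr_ge0 ?exprn_ge0 ?cabs_ge0.
apply: ler_sum => n _; rewrite hq.
have [b hb ->] := cexp_taylor2 (n%:R * (two_pi_i R * h)).
rewrite (_ : _ - _ - _ = two_pi_i R ^+ 2 * h ^+ 2 *
   (n%:R ^+ 2 * a n * (qq tau ^+ n * b))); last by ring.
rewrite (cabsM (two_pi_i R ^+ 2 * _)) !(cabsM (_ ^+ _)) (cabsM (_ * _)) (cabsM (_ * a n)).
rewrite !(cabsM (_ ^+ _)) !cabsX -!mulrA.
do 7 (apply: ler_wpM2l; first by rewrite ?exprn_ge0 ?cabs_ge0).
rewrite hx cy -!expRM_natl.
apply: (@le_trans _ _ (expR (n%:R * x) * expR (n%:R * (- x / 2)))); last first.
  by rewrite -expRD ler_expR; lra.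
apply: ler_wpM2l; first exact: expR_ge0.
apply: le_trans hb _.
rewrite ler_expR !cabsM cabs_nat; apply: ler_wpM2l => //.
by rewrite mulrC; exact: ltW.
Qed.

(** The half-plane is open: for small h the extension by 0 is the function itself. *)
Lemma has_ddtauP f tau l : has_ddtau f tau l ->
  (fun h : C^o => h^-1 *: ((extend0 f \o shift (val tau : C^o)) (h *: (1 : C^o)) - extend0 f (val tau)))
    @ (0 : C^o)^' --> (l : C^o).
Proof.
move=> hf; apply/cvgrPdist_le => e e0.
have ei : complex.Im e = 0 by apply: ger0_Im; exact: ltW.
have er : 0 < complex.Re e by move: e0; rewrite ltcE => /andP[].
have ee : e = (complex.Re e)%:C%C by apply/eqP; rewrite eq_complex /= ei !eqxx.
have [D D0 hD] := hf _ er.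
have I0 : 0 < complex.Im (val tau) := valP tau.
pose D' := Num.min D (complex.Im (val tau)).
have D'0 : 0 < D'%:C%C :> C by rewrite ltcR lt_min D0.
near=> h.
have hn : h != 0 by near: h; exact: nbhs_dnbhs_neq.
have hD' : cabs h < D'.
  rewrite -ltcR -normE; near: h; exact: dnbhs0_lt.
move: hD'; rewrite lt_min => /andP[hlD hlI].
have It : 0 < complex.Im (h + val tau).
  have := Im_le_cabs h; rewrite ler_norml => /andP[h1 _].
  have -> : complex.Im (h + val tau) = complex.Im h + complex.Im (val tau).
    by case: (h) (val tau) => [? ?] [? ?].
  lra.
pose t : H := exist _ (h + val tau) It.
have vt : val t - val tau = h by rewrite /= addrK.
have -> : (extend0 f \o shift (val tau : C^o)) (h *: (1 : C^o)) = f t.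
  by rewrite /extend0 /= [_%:A]mulr1 (insubT (fun z : C => 0 < complex.Im z) It).
have -> : extend0 f (val tau) = f tau.
  by rewrite /extend0 (valK tau).
have := hD t; rewrite vt => /(_ hlD) hb.
rewrite ee normE lecR.
rewrite [h^-1 *: _](_ : _ = h^-1 * (f t - f tau))//.
have -> : l - h^-1 * (f t - f tau) = - (h^-1 * (f t - f tau - l * h)).
  by rewrite !mulrBr (mulrCA _ l) mulVf// mulr1; ring.
rewrite cabsN cabsM cabsV mulrC ler_pdivrMr//; exact: cabs_gt0.
Unshelve. all: by end_near.
Qed.

Lemma has_ddtau_derivable f tau l : has_ddtau f tau l -> derivable (extend0 f) (val tau : C^o) 1.
Proof. by move=> /has_ddtauP h; apply/cvg_ex; exists l. Qed.

Lemma has_ddtau_qddq f tau l : has_ddtau f tau (two_pi_i R * l) -> qddq f tau = l.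
Proof.
move=> /has_ddtauP h; rewrite /qddq /ddtau /derive1.
apply: (canLR (mulKf (two_pi_i_neq0 R))).
apply: (cvg_lim (@norm_hausdorff _ C^o)).
apply: cvg_trans h; apply: near_eq_cvg; near=> h.
by rewrite /= [h%:A]mulr1.
Unshelve. all: by end_near.
Qed.

Lemma eisenstein_has_ddtau k tau : (0 < k)%N -> exists l, has_ddtau (eisenstein k) tau l.
Proof.
move=> k0; pose a n := two_pi_i R ^+ (2 * k) * eis R k n.
have sa : subexp a by apply: subexpZ; exact: eis_subexp.
have [s hs] := abs_summable_has_sum (subexp_summable (subexpMn sa) (cabs_qq tau)).
exists (two_pi_i R * s); apply: (has_ddtau_qseries sa) hs => t; exact: eisenstein_q.
Qed.

Lemma modular_has_ddtau f tau : @modular_ring R f -> exists l, has_ddtau f tau l.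
Proof.
move=> [p hp].
pose F i j t := p`_i`_j * eisenstein 2 t ^+ j * eisenstein 3 t ^+ i.
have hX k n : (0 < k)%N -> exists l, has_ddtau (fun t => eisenstein k t ^+ n) tau l.
  move=> k0; case: n => [|n].
    by exists 0; under eq_fun do rewrite expr0; exact: has_ddtau_cst.
  by have [l hl] := eisenstein_has_ddtau tau k0; eexists; exact: (has_ddtauX n hl).
have /choice [l hl] (i : nat) : exists l : nat -> C, forall j, has_ddtau (F i j) tau (l j).
  suff /choice [l hl] j : exists x, has_ddtau (F i j) tau x by exists l.
  have [l1 h1] := hX 2 j isT; have [l2 h2] := hX 3 i isT.
  by eexists; apply: has_ddtauM h2; apply: has_ddtauM h1; exact: has_ddtau_cst.
exists (\sum_(i < size p) \sum_(j < size p`_i) l i j).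
have -> : f = fun t => \sum_(i < size p) \sum_(j < size p`_i) F i j t.
  apply/funext => t; rewrite hp (horner_coef p) horner_sum; apply: eq_bigr => i _.
  by rewrite hornerM -rmorphXn /= hornerC horner_coef mulr_suml.
by apply: has_ddtau_sum => i; apply: has_ddtau_sum => j; exact: hl.
Qed.

End Derivatives.

(** * Modes of vertex algebra modules *)

Section FiniteSums.

Lemma fsum_ord (S : nmodType) (f : nat -> S) N :
  (forall i, (N <= i)%N -> f i = 0) -> \sum_(i \in [set: nat]) f i = \sum_(i < N) f i.
Proof.
move=> h; rewrite fsbig_ord; apply/esym/fsbig_widen => // i [_ /=] /negP.
by rewrite -leqNgt => /h.
Qed.

Lemma fsum_from (S : nmodType) (f : nat -> S) m K :
  (forall p, (K <= p)%N -> f (p + m)%N = 0) ->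
  \sum_(l \in [set l | (m <= l)%N]) f l = \sum_(p < K) f (p + m)%N.
Proof.
move=> h; rewrite fsbig_mkcond (fsum_ord (N := m + K)).
  rewrite big_split_ord /= big1 ?add0r => [|i _].
    by apply: eq_bigr => p _; rewrite addnC /patch mem_set//= ?leq_addl.
  by rewrite /patch memNset//=; apply/negP; rewrite -ltnNge.
move=> l hl; rewrite /patch; case: ifP => // /set_mem /= ml.
by rewrite -(subnK ml) h//; lia.
Qed.

Lemma finite_bound (S : nmodType) (f : nat -> S) : finite_set [set n | f n != 0] ->
  exists N, forall i, (N <= i)%N -> f i = 0.
Proof.
move=> /finite_fsetP [X hX]; exists (\max_(i <- X) i).+1 => i hi.
apply/eqP/negPn/negP => fi.
have : i \in X by have : [set` X] i by rewrite -hX.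
by move=> iX; move: hi; rewrite ltnNge (leq_bigmax_seq (F := id)).
Qed.

Variables (C : pzRingType) (U W : lmodType C) (f : U -> W).
Hypothesis fl : linear f.

Lemma linf0 : f 0 = 0.
Proof. by have := fl (-1) 0 0; rewrite !scaleN1r oppr0 addr0 addNr. Qed.

Lemma linfD u v : f (u + v) = f u + f v.
Proof. by have := fl 1 u v; rewrite !scale1r. Qed.

Lemma linfZ c u : f (c *: u) = c *: f u.
Proof. by have := fl c u 0; rewrite linf0 !addr0. Qed.

Lemma linfN u : f (- u) = - f u.
Proof. by rewrite -scaleN1r linfZ scaleN1r. Qed.

Lemma linfB u v : f (u - v) = f u - f v.
Proof. by rewrite linfD linfN. Qed.

Lemma linf_sum (I : Type) (s : seq I) (p : pred I) (F : I -> U) :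
  f (\sum_(i <- s | p i) F i) = \sum_(i <- s | p i) f (F i).
Proof. by elim/big_rec2: _ => [|i x y _ <-]; rewrite ?linf0// linfD. Qed.

End FiniteSums.

Section VertexModule.
Variable R : realType.
Local Notation C := R[i].
Variables (V : lmodType C) (A : voa V) (M : lmodType C) (act : V -> int -> M -> M).
Hypothesis W : weak_module_axioms (nprod A) (vac A) act.

Lemma act0l n u : act 0 n u = 0. Proof. exact: linf0 (act_linearl W n u). Qed.

Lemma act0r a n : act a n 0 = 0. Proof. exact: linf0 (act_linearr W a n). Qed.

Lemma actZl c a n u : act (c *: a) n u = c *: act a n u.
Proof. exact: linfZ (act_linearl W n u) _ _. Qed.

Lemma act_sumr a n I (s : seq I) (F : I -> M) :
  act a n (\sum_(i <- s) F i) = \sum_(i <- s) act a n (F i).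
Proof. exact: (linf_sum (act_linearr W a n)). Qed.

Lemma act_suml n u I (s : seq I) (F : I -> V) :
  act (\sum_(i <- s) F i) n u = \sum_(i <- s) act (F i) n u.
Proof. exact: (linf_sum (act_linearl W n u)). Qed.

Lemma prod_trunc a b (m : int) : exists N : nat, forall i : nat, (N <= i)%N -> nprod A a (m + i%:Z) b = 0.
Proof.
have [N hN] := act_trunc (prod_weak_module A) a b.
exists `|N - m|%N => i hi; apply: hN; lia.
Qed.

(** The Borcherds identity for r = 0. *)
Lemma commutator a b u (p q : int) N : (forall i : nat, (N <= i)%N -> nprod A a i b = 0) ->
  act a p (act b q u) - act b q (act a p u) =
  \sum_(i < N) binz R p i *: act (nprod A a i b) (p + q - i%:Z) u.
Proof.
move=> hN; have := act_borcherds W a b u p q 0.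
rewrite (fsum_ord (N := N)); last first.
  by move=> i hi; rewrite add0r hN// act0l scaler0.
rewrite (fsum_ord (N := 1)); last first.
  by case=> // i _; rewrite binz0l mulr0 scale0r.
rewrite big_ord1 /= expr0 binz0r mul1r scale1r expr0z scale1r subr0 !addr0 => <-.
by apply: eq_bigr => i _; rewrite add0r.
Qed.

Lemma binzN1 i : binz R (-1) i = (-1) ^+ i.
Proof.
elim: i => [|i IH]; first by rewrite binz0r expr0.
have := binz_pascal R (-1) i; rewrite addNr binz0l IH => /esym/eqP.
by rewrite addr_eq0 exprS mulN1r => /eqP.
Qed.

Lemma binzN2 i : (-1) ^+ i * binz R (-2) i = i.+1%:R.
Proof.
elim: i => [|i IH]; first by rewrite binz0r expr0 mulr1.
have := binz_pascal R (-2) i; rewrite (_ : -2 + 1 = -1)// binzN1.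
move=> E; have -> : binz R (-2) i.+1 = (-1) ^+ i.+1 - binz R (-2) i by rewrite E addrK.
rewrite mulrBr -expr2 -exprM mulnC exprM sqrrN !expr1n exprS mulN1r mulNr opprK IH.
by rewrite nat1r.
Qed.

(** L_(-1) a = a_(-2) |0>, whose modes are given by the Borcherds identity for p = 0 and
    r = -2; at most one term of the sum is nonzero. *)
Lemma derivation_act a n u :
  act (nprod A (conf A) 0 a) n u = - n%:~R *: act a (n - 1) u.
Proof.
have -> : nprod A (conf A) 0 a = nprod A a (-2) (vac A).
  have := L1_derivation A a (-1) (vac A).
  by rewrite prod_creation opprK scale1r.
have := act_borcherds W a (vac A) u 0 n (-2).
rewrite (fsum_ord (N := 1)); last first.
  by case=> // i _; rewrite binz0l scale0r.
rewrite big_ord1 binz0r scale1r addr0 subr0 add0r => ->.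
have E i : ((-1) ^+ i * binz R (-2) i) *:
        (act a (0 - 2 - i%:Z) (act (vac A) (n + i%:Z) u) -
         (-1) ^ (-2) *: act (vac A) (n - 2 - i%:Z) (act a (0 + i%:Z) u)) =
   if i%:Z == - n - 1 then - n%:~R *: act a (n - 1) u
   else if i%:Z == n - 1 then - n%:~R *: act a (n - 1) u else 0.
  rewrite binzN2 !(act_vac W).
  have -> : (n + i%:Z == -1) = (i%:Z == - n - 1) by lia.
  have -> : (n - 2 - i%:Z == -1) = (i%:Z == n - 1) by lia.
  have -> : ((-1) ^ (-2) : C) = 1 by rewrite -exprnN sqrrN expr1n invr1.
  rewrite scale1r; case: eqP => [i1|_]; case: eqP => [i2|_].
  - by lia.
  - rewrite subr0; congr (_ *: act a _ u); last by lia.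
    by rewrite [LHS]pmulrn -rmorphN /=; congr (_%:~R); lia.
  - rewrite act0r sub0r scalerN -scaleNr; congr (_ *: act a _ u); last by lia.
    by rewrite [X in - X]pmulrn; congr (- _%:~R); lia.
  - by rewrite act0r subr0 scaler0.
rewrite (fsum_ord (N := `|n|.+1)); last first.
  by move=> i hi; rewrite E; case: eqP; [lia|case: eqP; [lia|]].
under eq_bigr do rewrite E.
case: (ltgtP n 0) => n0.
- have lt1 : (`|n|.-1 < `|n|.+1)%N by lia.
  rewrite (bigD1 (Ordinal lt1)) //= big1 ?addr0; first by case: eqP => //; lia.
  move=> i /eqP ni; case: eqP => h1; last by case: eqP => // h2; lia.
  by case: ni; apply: val_inj => /=; lia.
- have lt1 : (`|n|.-1 < `|n|.+1)%N by lia.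
  rewrite (bigD1 (Ordinal lt1)) //= big1 ?addr0.
    by case: eqP => h; [lia|case: eqP => //; lia].
  move=> i /eqP ni; case: eqP => h1; first by lia.
  case: eqP => // h2; by case: ni; apply: val_inj => /=; lia.
- have z : - n%:~R *: act a (n - 1) u = 0 by rewrite n0 mulr0z oppr0 scale0r.
  by rewrite z big1// => i _; rewrite !if_same.
Qed.

Lemma binz_1 i : binz R 1 i.+2 = 0.
Proof. by rewrite (binz_pascal R 0) !binz0l addr0. Qed.

(** The commutator formula for omega_(1), in which only L_(-1) a and L_0 a contribute. *)
Lemma L0_comm k a n u : homogeneous A k a ->
  Lop A act 0 (act a n u) - act a n (Lop A act 0 u) = (k%:Z - n - 1)%:~R *: act a n u.
Proof.
move=> ha; have [N hN] := prod_trunc (conf A) a 0.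
rewrite /Lop add0r (commutator _ _ _ (N := N.+2)); last first.
  by move=> i hi; have := hN i; rewrite add0r; apply; lia.
rewrite !big_ord_recl big1 => [|i _]; last by rewrite /= /bump /= binz_1 scale0r.
have -> : nprod A (conf A) 1 a = k%:R *: a by have := L0_grading A k a; rewrite ha.
rewrite binz0r /= derivation_act /bump /= actZl addr0 scale1r.
rewrite (binz_pascal R 0) binz0l add0r binz0r scale1r.
have -> : 1 + n - Posz 1 = n by lia.
rewrite addr0.
by rewrite -scalerDl; congr (_ *: _); rewrite !(rmorphB, rmorphD) /=; ring.
Qed.

(** ** Homogeneous components *)

Lemma hcompH k j a : homogeneous A k a -> hcomp A j a = if j == k then a else 0.
Proof. by move=> ha; rewrite -ha comp_proj; case: eqP => // ->. Qed.

Lemma hcomp_homog k a : homogeneous A k (hcomp A k a).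
Proof. by rewrite /homogeneous comp_proj eqxx. Qed.

Lemma hcomp_decomp a : exists N, (forall k, (N <= k)%N -> hcomp A k a = 0) /\
   a = \sum_(k < N) hcomp A k a.
Proof.
have [N hN] := finite_bound (comp_fin A a); exists N; split => //.
by rewrite {1}(comp_sum A a) (fsum_ord hN).
Qed.

Lemma hcomp_L0 j v : hcomp A j (nprod A (conf A) 1 v) = j%:R *: hcomp A j v.
Proof.
have [N [hN hv]] := hcomp_decomp v.
rewrite {1}hv (linf_sum (act_linearr (prod_weak_module A) _ _)).
rewrite (linf_sum (comp_linear A j)).
case: (ltnP j N) => jN.
  rewrite (bigD1 (Ordinal jN)) //= big1 ?addr0; last first.
    move=> i /eqP ij; rewrite L0_grading (linfZ (comp_linear A j)) comp_proj.
    by case: eqP => [E|_]; [case: ij; apply: val_inj|rewrite scaler0].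
  by rewrite L0_grading (linfZ (comp_linear A j)) comp_proj eqxx.
rewrite (hN j jN) scaler0 big1// => i _.
rewrite L0_grading (linfZ (comp_linear A j)) comp_proj.
by case: eqP => [E|_]; [have := ltn_ord i; lia|rewrite scaler0].
Qed.

(** The homogeneous components of an eigenvector of L_0 are eigenvectors for two eigenvalues,
    hence vanish except in degree [w]; for negative [w] they all do. *)
Lemma eigen_homog (w : int) v : nprod A (conf A) 1 v = w%:~R *: v ->
  forall j, hcomp A j v = if j%:Z == w then v else 0.
Proof.
move=> hv.
have H j : j%:Z != w -> hcomp A j v = 0.
  move=> jw; have := hcomp_L0 j v; rewrite hv (linfZ (comp_linear A j)) => /eqP.
  rewrite -subr_eq0 -scalerBl scaler_eq0 pmulrn -rmorphB intr_eq0 subr_eq0 eq_sym.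
  by rewrite (negbTE jw) => /eqP.
move=> j; case: eqP => [E|/eqP/H//].
have [N [hN hv']] := hcomp_decomp v; rewrite {2}hv'.
case: (ltnP j N) => jN.
  rewrite (bigD1 (Ordinal jN)) //= big1 ?addr0// => i /eqP ij.
  by apply: H; apply/eqP => E'; case: ij; apply: val_inj => /=; lia.
rewrite hN// big1// => i _; apply: H; apply/eqP => E'.
by have := ltn_ord i; lia.
Qed.

End VertexModule.

Section Modes.
Variable R : realType.
Local Notation C := R[i].
Variables (V : lmodType C) (A : voa V).

(** By [L0_comm], a_(n) b is an eigenvector of L_0. *)
Lemma prod_weight k l a b n j : homogeneous A k a -> homogeneous A l b ->
  hcomp A j (nprod A a n b) = if j%:Z == k%:Z + l%:Z - n - 1 then nprod A a n b else 0.
Proof.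
move=> ha hb; apply: eigen_homog.
have := L0_comm (prod_weak_module A) n b ha; rewrite /Lop add0r.
have -> : nprod A (conf A) 1 b = l%:R *: b by have := L0_grading A l b; rewrite hb.
rewrite (linfZ (act_linearr (prod_weak_module A) _ _)) => /eqP.
rewrite subr_eq -scalerDl => /eqP ->; congr (_ *: _).
by rewrite [l%:R]pmulrn -rmorphD /=; congr (_%:~R); lia.
Qed.

Lemma prod_neg k l a b n : homogeneous A k a -> homogeneous A l b ->
  k%:Z + l%:Z - n - 1 < 0 -> nprod A a n b = 0.
Proof.
move=> ha hb h; have [N [_ ->]] := hcomp_decomp A (nprod A a n b).
rewrite big1// => j _; rewrite (prod_weight n j ha hb).
by case: eqP => //; lia.
Qed.

Lemma L0_vac : nprod A (conf A) 1 (vac A) = 0.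
Proof. by rewrite prod_creation0. Qed.

Lemma vac_homog : homogeneous A 0 (vac A).
Proof.
have := @eigen_homog R V A 0 (vac A); rewrite L0_vac scale0r => /(_ erefl 0%N).
by rewrite eqxx.
Qed.

(** [L_0, L_(-2)] = 2 L_(-2), applied to the vacuum. *)
Lemma conf_homog : homogeneous A 2 (conf A).
Proof.
have := @eigen_homog R V A 2 (conf A).
have -> : nprod A (conf A) 1 (conf A) = 2%:~R *: conf A.
  have := virasoro A 0 (-2) (vac A); rewrite !add0r.
  rewrite (_ : -2 + 1 = -1 :> int)// prod_creation L0_vac.
  rewrite (linf0 (act_linearr (prod_weak_module A) _ _)) subr0 addr0.
  by rewrite opprK.
by move=> /(_ erefl 2%N); rewrite eqxx.
Qed.

Variables (M : lmodType C) (act : V -> int -> M -> M).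
Hypothesis W : weak_module_axioms (nprod A) (vac A) act.
Local Notation J := (J A act).

Lemma JH k a n u : homogeneous A k a -> J n a u = act a (k%:Z - 1 + n) u.
Proof.
move=> ha; rewrite /Defs.J (fsum_ord (N := k.+1)).
  rewrite (bigD1 ord_max) //= big1 ?addr0 ?ha// => i /eqP ik.
  rewrite (hcompH _ ha); case: eqP => [E|_]; last exact: act0l W _ _.
  by case: ik; apply: val_inj.
move=> i ik; rewrite (hcompH _ ha); case: eqP => [E|_]; last exact: act0l W _ _.
by move: ik; rewrite E ltnn.
Qed.

Lemma J_decomp a : exists N, forall n u, J n a u = \sum_(k < N) act (hcomp A k a) (k%:Z - 1 + n) u.
Proof.
have [N [hN _]] := hcomp_decomp A a; exists N => n u.
by apply: fsum_ord => i /hN ->; exact: act0l W _ _.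
Qed.

Lemma J_linearr n a : linear (J n a).
Proof.
move=> c u v; have [N hN] := J_decomp a; rewrite !hN scaler_sumr -big_split.
by apply: eq_bigr => i _; exact: act_linearr W _ _ _ _ _.
Qed.

Lemma J_linearl n u : linear (fun a => J n a u).
Proof.
move=> c a b; rewrite /Defs.J.
have [N1 [h1 _]] := hcomp_decomp A a; have [N2 [h2 _]] := hcomp_decomp A b.
pose N := maxn N1 N2.
rewrite !(fsum_ord (N := N)).
- rewrite scaler_sumr -big_split; apply: eq_bigr => i _.
  by rewrite comp_linear; exact: act_linearl W _ _ _ _ _.
- by move=> i; rewrite geq_max => /andP[_ /h2 ->]; exact: act0l W _ _.
- by move=> i; rewrite geq_max => /andP[/h1 -> _]; exact: act0l W _ _.
- move=> i; rewrite geq_max => /andP[/h1 E1 /h2 E2].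
  by rewrite comp_linear E1 E2 scaler0 addr0; exact: act0l W _ _.
Qed.

Lemma J_prod k l a b (n m : int) u : homogeneous A k a -> homogeneous A l b ->
  J m (nprod A a n b) u = act (nprod A a n b) (k%:Z + l%:Z - n - 2 + m) u.
Proof.
move=> ha hb; case: (lerP 0 (k%:Z + l%:Z - n - 1)) => h; last first.
  by rewrite (prod_neg ha hb h) (linf0 (J_linearl m u)) (act0l W).
have -> : nprod A a n b = hcomp A `|(k%:Z + l%:Z - n - 1)%R|%N (nprod A a n b).
  by rewrite (prod_weight n _ ha hb); case: eqP => //; lia.
rewrite (JH _ _ (@hcomp_homog _ _ A _ _)); congr (act _ _ u); lia.
Qed.

Lemma J_comm k l a b (m p : int) u N : homogeneous A k a -> homogeneous A l b ->
  (forall i : nat, (N <= i)%N -> nprod A a i b = 0) ->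
  J m a (J p b u) - J p b (J m a u) =
  \sum_(i < N) binz R (m + k%:Z - 1) i *: J (m + p) (nprod A a i b) u.
Proof.
move=> ha hb hN; rewrite !(JH _ _ ha) !(JH _ _ hb) (commutator W _ _ _ hN).
apply: eq_bigr => i _; rewrite (J_prod _ _ _ ha hb).
by congr (binz R _ _ *: act _ _ u); lia.
Qed.

(** The Borcherds identity for p = k and r = - 1 - e.  The left-hand side is the zero mode of
    Res (1 + z)^k / z^(1 + e) Y(a, z) b, which is Zhu's product of a and b for e = 0 and lies
    in Zhu's ideal for e = 1. *)
Lemma J0_zhu (e : nat) k l a b u N N' : homogeneous A k a -> homogeneous A l b ->
  (forall i : nat, (N <= i)%N -> nprod A a (i%:Z - 1 - e%:Z) b = 0) ->
  (forall i : nat, (N' <= i)%N -> J (i%:Z + e%:Z) b u = 0 /\ J (i%:Z + 1) a u = 0) ->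
  \sum_(i < N) binz R k i *: J 0 (nprod A a (i%:Z - 1 - e%:Z) b) u =
  \sum_(i < N') ((-1) ^+ i * binz R (- 1 - e%:Z) i) *:
    (J (- (i%:Z + e%:Z)) a (J (i%:Z + e%:Z) b u) +
     (-1) ^+ e *: J (- (i%:Z + 1)) b (J (i%:Z + 1) a u)).
Proof.
move=> ha hb hN hN'.
have := act_borcherds W a b u k%:Z (l%:Z - 1 + e%:Z) (- 1 - e%:Z).
rewrite (fsum_ord (N := N)); last first.
  move=> i hi; rewrite (_ : - 1 - e%:Z + i%:Z = i%:Z - 1 - e%:Z); last by lia.
  by rewrite hN// (act0l W) scaler0.
rewrite (fsum_ord (N := N')); last first.
  move=> i /hN'; rewrite (JH _ _ ha) (JH _ _ hb) => -[h1 h2].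
  rewrite (_ : l%:Z - 1 + e%:Z + i%:Z = l%:Z - 1 + (i%:Z + e%:Z)); last by lia.
  rewrite (_ : k%:Z + i%:Z = k%:Z - 1 + (i%:Z + 1)); last by lia.
  by rewrite h1 h2 !(act0r W) scaler0 subr0 scaler0.
move=> E; transitivity (\sum_(i < N) binz R k i *:
    act (nprod A a (- 1 - e%:Z + i%:Z) b) (k%:Z + (l%:Z - 1 + e%:Z) - i%:Z) u).
  apply: eq_bigr => i _; rewrite (J_prod _ _ _ ha hb).
  by rewrite (_ : - 1 - e%:Z + i%:Z = i%:Z - 1 - e%:Z);
    [congr (_ *: act _ _ u)|]; lia.
rewrite E; apply: eq_bigr => i _; congr (_ *: _).
rewrite !(JH _ _ ha) !(JH _ _ hb); congr (_ + _).
  by congr (act a _ (act b _ u)); lia.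
have -> : (-1) ^ (- 1 - e%:Z) = - (-1) ^+ e :> C.
  have -> : - 1 - e%:Z = - e.+1%:Z by lia.
  by rewrite -exprnN -exprVn invrN invr1 exprS mulN1r.
rewrite scaleNr opprK; congr (_ *: act b _ (act a _ u)); lia.
Qed.

Lemma L0_J m a u : Lop A act 0 (J m a u) = J m a (Lop A act 0 u) - m%:~R *: J m a u.
Proof.
have [N hN] := J_decomp a; rewrite !hN /Lop add0r (linf_sum (act_linearr W _ _)).
rewrite scaler_sumr -sumrB; apply: eq_bigr => k _.
have := L0_comm W (k%:Z - 1 + m) u (@hcomp_homog _ _ A k a); rewrite /Lop add0r => /eqP.
rewrite subr_eq => /eqP ->; rewrite addrC; congr (_ + _).
by rewrite -scaleNr -rmorphN; congr (_%:~R *: _); lia.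
Qed.

End Modes.

(** * Pseudo-traces *)

(** [M] already carries a structure of module over the complex numbers, so that the one over [P]
    is put on an alias. *)
Definition rho_module (C : fieldType) (P : algType C) (M : lmodType C)
  (rho : P -> M -> M) : Type := M.

Section RhoModule.
Variable R : realType.
Local Notation C := R[i].
Variables (P : algType C) (M : lmodType C) (rho : P -> M -> M).
Hypothesis rl : forall u, linear (rho ^~ u).
Hypothesis rE : forall x, linear (rho x).
Hypothesis r1 : forall u, rho 1 u = u.
Hypothesis rM : forall x y u, rho (x * y) u = rho x (rho y u).

Local Notation N := (rho_module rho).

HB.instance Definition _ := GRing.Zmodule.on N.

Lemma rho_scaleA (x y : P) (u : N) : rho x (rho y u) = rho (x * y) u.
Proof. by rewrite rM. Qed.

Lemma rho_scaleDr : right_distributive (rho : P -> N -> N) +%R.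
Proof. by move=> x u v; exact: linfD (rE x) _ _. Qed.

Lemma rho_scaleDl (u : N) : {morph (rho ^~ u : P -> N) : x y / x + y}.
Proof. by move=> x y; exact: linfD (rl u) _ _. Qed.

HB.instance Definition _ := GRing.Zmodule_isLmodule.Build P N
  rho_scaleA r1 rho_scaleDr rho_scaleDl.

(** Lifting the identity of [M] through the surjection of P^k x M onto M given by
    (x, m) |-> sum_i x_i e_i + (m - pr m) yields coordinates on the image of a
    [P]-linear projection [pr] that are defined and [P]-linear on the whole of [M]. *)
Lemma projective_coordinates (W : set M) (pr : M -> M) k (e : 'I_k -> M) :
  P_projective rho ->
  (forall x u v, pr (rho x u + v) = rho x (pr u) + pr v) ->
  (forall u, W (pr u)) -> (forall u, W u -> pr u = u) ->
  (forall u, W u -> exists x : 'I_k -> P, u = \sum_i rho (x i) (e i)) ->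
  (forall i, W (e i)) ->
  exists f : 'I_k -> M -> P,
    (forall i x u v, f i (rho x u + v) = x * f i u + f i v) /\
    (forall w, W w -> w = \sum_i rho (f i w) (e i)).
Proof.
move=> proj prl prW prid gen eW.
pose X : lmodType P := ({ffun 'I_k -> P^o} * N)%type.
pose g (x : X) : N := \sum_i rho (x.1 i) (e i) + ((x.2 : M) - pr x.2).
have gl : linear g.
  move=> c [x1 x2] [y1 y2]; rewrite /g /=.
  have -> : \sum_i rho ((c *: x1 + y1) i) (e i) = c *: (\sum_i rho (x1 i) (e i) : N) + \sum_i rho (y1 i) (e i).
    rewrite scaler_sumr -big_split; apply: eq_bigr => i _.
    by rewrite !ffunE (linfD (rl _)) rM.
  have -> : pr (c *: x2 + y2 : N) = rho c (pr x2) + pr y2 by exact: prl.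
  rewrite -[rho c (pr x2)]/(c *: (pr x2 : N)) scalerDr scalerBr opprD.
  by rewrite [X in _ + _ + X = _]addrACA [LHS]addrACA.
pose gL := GRing.isLinear.Build P X N *:%R g gl.
pose G : {linear X -> N} := HB.pack g gL.
have [] := proj X N G (fun u => u).
- move=> y; have [x hx] := gen _ (prW y).
  exists ([ffun i => x i], y); rewrite /= /g /=.
  under eq_bigr do rewrite ffunE.
  by rewrite -hx addrC subrK.
- by [].
move=> h hl hg; exists (fun i u => (h u).1 i); split.
  by move=> i x u v; rewrite hl /= !ffunE.
move=> w Ww.
have E : pr (g (h w)) = w by rewrite -[RHS](prid w Ww); congr (pr _); exact: hg.
have p0 : pr 0 = 0.
  have := prl 1 0 0; rewrite (linf0 (rE 1)) addr0 r1 => /eqP.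
  by rewrite -[X in X == _]addr0 (inj_eq (addrI _)) eq_sym => /eqP.
have prD u v : pr (u + v) = pr u + pr v by have := prl 1 u v; rewrite !r1.
have prN u : pr (- u) = - pr u.
  by apply/eqP; rewrite -addr_eq0 -prD addNr p0.
rewrite -[LHS]E /g !prD prN [pr (pr _)]prid// subrr addr0.
rewrite (big_morph pr prD p0); apply: eq_bigr => i _.
have := prl ((h w).1 i) (e i) 0; rewrite !addr0 p0 addr0 => ->.
by rewrite prid.
Qed.

End RhoModule.

Section PseudoTrace.
Variable R : realType.
Local Notation C := R[i].
Variables (M : lmodType C) (P : algType C) (rho : P -> M -> M) (phi : {scalar P}).
Hypothesis rE : forall x, linear (rho x).
Hypothesis r1 : forall u, rho 1 u = u.
Hypothesis phiC : forall x y : P, phi (x * y) = phi (y * x).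

Definition ctrace n (u : 'I_n -> M) (f : 'I_n -> M -> P) (alpha : M -> M) : C :=
  \sum_i phi (f i (alpha (u i))).

Definition rho_linear_map (alpha : M -> M) :=
  forall x u v, alpha (rho x u + v) = rho x (alpha u) + alpha v.

Definition rho_closed (W : set M) := forall x u v, W u -> W v -> W (rho x u + v).

Lemma coord0 (W : set M) n (u : 'I_n -> M) (f : 'I_n -> M -> P) i :
  W 0 -> coordinate_system rho W u f -> f i 0 = 0.
Proof.
move=> W0 [_ fl _]; have := fl i 1 0 0 W0 W0.
rewrite (linf0 (rE 1)) addr0 mul1r => /eqP.
by rewrite -[X in X == _]addr0 (inj_eq (addrI _)) eq_sym => /eqP.
Qed.

Lemma coord_sum (W : set M) n (u : 'I_n -> M) (f : 'I_n -> M -> P) i :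
  W 0 -> rho_closed W -> coordinate_system rho W u f ->
  forall (I : Type) (s : seq I) (x : I -> P) (w : I -> M), (forall j, W (w j)) ->
  f i (\sum_(j <- s) rho (x j) (w j)) = \sum_(j <- s) x j * f i (w j).
Proof.
move=> W0 Wc cs I s x w Ww.
suff [] : W (\sum_(j <- s) rho (x j) (w j)) /\
  f i (\sum_(j <- s) rho (x j) (w j)) = \sum_(j <- s) x j * f i (w j) by [].
elim: s => [|j s [IH1 IH2]]; first by rewrite !big_nil (coord0 _ W0 cs).
rewrite !big_cons; split; first exact: Wc.
by have [_ fl _] := cs; rewrite fl// IH2.
Qed.

Lemma rlin_sum (alpha : M -> M) : rho_linear_map alpha ->
  forall (I : Type) (s : seq I) (x : I -> P) (w : I -> M),
  alpha (\sum_(j <- s) rho (x j) (w j)) = \sum_(j <- s) rho (x j) (alpha (w j)).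
Proof.
move=> al I s x w; have a0 : alpha 0 = 0.
  have := al 1 0 0; rewrite (linf0 (rE 1)) addr0 r1 => /eqP.
  by rewrite -[X in X == _]addr0 (inj_eq (addrI _)) eq_sym => /eqP.
by elim: s => [|j s IH]; rewrite ?big_nil// !big_cons al IH.
Qed.

(** Expanding beta (u_i) and alpha (u'_j) in coordinates, both sides become double sums of the
    values of [phi] at products in the two orders. *)
Lemma ctrace_cyclic (W W' : set M) n n' u f u' f' (alpha beta : M -> M) :
  W 0 -> W' 0 -> rho_closed W -> rho_closed W' ->
  @coordinate_system R M P rho W n u f -> @coordinate_system R M P rho W' n' u' f' ->
  rho_linear_map alpha -> rho_linear_map beta ->
  (forall w, W w -> W' (beta w)) -> (forall w, W' w -> W (alpha w)) ->
  ctrace u f (alpha \o beta) = ctrace u' f' (beta \o alpha).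
Proof.
move=> W0 W0' Wc Wc' cs cs' al bl bW aW.
have [uW _ exp] := cs; have [uW' _ exp'] := cs'.
rewrite /ctrace.
transitivity (\sum_i \sum_j phi (f' j (beta (u i)) * f i (alpha (u' j)))).
  apply: eq_bigr => i _ /=; rewrite {1}(exp' _ (bW _ (uW i))) (rlin_sum al).
  rewrite (coord_sum _ W0 Wc cs) ?linear_sum// => j.
  exact: aW.
rewrite exchange_big; apply: eq_bigr => j _ /=.
rewrite [in RHS](exp _ (aW _ (uW' j))) (rlin_sum bl).
rewrite (coord_sum _ W0' Wc' cs') ?linear_sum//.
  by apply: eq_bigr => i _; rewrite phiC.
by move=> i; exact: bW.
Qed.

(** Cyclicity with the identity map compares two coordinate systems. *)
Lemma pseudo_traceE (W : set M) n u f (alpha : M -> M) :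
  W 0 -> rho_closed W -> @coordinate_system R M P rho W n u f ->
  rho_linear_map alpha -> (forall w, W w -> W (alpha w)) ->
  pseudo_trace rho phi W alpha = ctrace u f alpha.
Proof.
move=> W0 Wc cs al aW; rewrite /pseudo_trace.
case: xgetP => [t _ [n' [u' [f' [cs' ->]]]]|no].
  have idl : rho_linear_map id by [].
  exact: (ctrace_cyclic W0 W0 Wc Wc cs' cs al idl).
by case: (no (ctrace u f alpha)); exists n, u, f.
Qed.

End PseudoTrace.

(** * Graded pieces *)

Section GradedModule.
Variable R : realType.
Local Notation C := R[i].
Variables (V : lmodType C) (A : voa V) (M : lmodType C) (act : V -> int -> M -> M).
Variables (r : C) (d : nat).
Hypothesis W : weak_module_axioms (nprod A) (vac A) act.
Hypothesis gr : is_graded A act r d.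
Local Notation J := (J A act).
Local Notation piece := (graded_piece A act r).
Local Notation Nil := (L0_nil A act r).

Lemma Lop_linear m : linear (Lop A act m).
Proof. exact: act_linearr W _ _. Qed.

Lemma Nil_linear n : linear (Nil n).
Proof.
move=> c u v; rewrite /L0_nil Lop_linear scalerDr opprD addrACA scalerBr.
by rewrite !scalerA (mulrC c).
Qed.

Lemma iter_linear (f : M -> M) k : linear f -> linear (iter k f).
Proof. by move=> fl; elim: k => [|k IH] c u v //=; rewrite IH fl. Qed.

Lemma pieceP n u : piece n u <-> iter d.+1 (Nil n) u = 0.
Proof. by split=> [|h]; [exact: graded_nil gr _ _|exists d.+1]. Qed.

Lemma piece_lin n c u v : piece n u -> piece n v -> piece n (c *: u + v).
Proof.
move=> /pieceP hu /pieceP hv; apply/pieceP.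
by rewrite (iter_linear _ (Nil_linear n)) hu hv scaler0 addr0.
Qed.

Lemma piece0 n : piece n 0.
Proof. by exists 0%N. Qed.

Definition pr (n : nat) (u : M) : M := projT1 (cid (graded_sum gr u)) n.

Lemma prP u : [/\ forall n, piece n (pr n u), finite_set [set n | pr n u != 0]
      & u = \sum_(n \in [set: nat]) pr n u].
Proof. by have [h _] := projT2 (cid (graded_sum gr u)). Qed.

Lemma pr_uniq u (w : nat -> M) N : (forall n, piece n (w n)) ->
  (forall n, (N <= n)%N -> w n = 0) -> u = \sum_(n < N) w n -> forall n, pr n u = w n.
Proof.
move=> hw hN hu n; rewrite /pr; case: cid => w' [_ uniq] /=.
rewrite (uniq w)//; split=> //; last by rewrite (fsum_ord hN).
apply: (sub_finite_set (B := `I_N)); last exact: finite_II.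
by move=> i /= /eqP wi; rewrite ltnNge; apply/negP => /hN.
Qed.

Lemma pr_bound u : exists N, (forall n, (N <= n)%N -> pr n u = 0) /\ u = \sum_(n < N) pr n u.
Proof.
have [_ fin E] := prP u; have [N hN] := finite_bound fin.
by exists N; split => //; rewrite {1}E (fsum_ord hN).
Qed.

Lemma pr_piece n u : piece n (pr n u). Proof. by have [] := prP u. Qed.

Lemma pr_id n u : piece n u -> pr n u = u.
Proof.
move=> hu; have := @pr_uniq u (fun i => if i == n then u else 0) n.+1.
move=> /(_ _ _ _ n); rewrite eqxx; apply.
- by move=> i; case: eqP => [->//|_]; exact: piece0.
- by move=> i; case: eqP => // -> ; rewrite ltnn.
- rewrite big_ord_recr /= eqxx big1 ?add0r// => i _.
  by case: eqP => // E; have := ltn_ord i; rewrite E ltnn.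
Qed.

Lemma pr_comm (f : M -> M) : linear f -> (forall n u, piece n u -> piece n (f u)) ->
  forall n u, pr n (f u) = f (pr n u).
Proof.
move=> fl hf n u; have [N [hN E]] := pr_bound u.
apply: (@pr_uniq _ (fun i => f (pr i u)) N).
- by move=> i; apply/hf/pr_piece.
- by move=> i /hN ->; exact: linf0 fl.
- by rewrite {1}E (linf_sum fl).
Qed.

Lemma pr_linear n : linear (pr n).
Proof.
move=> c u v; have [N1 [h1 E1]] := pr_bound u; have [N2 [h2 E2]] := pr_bound v.
apply: (@pr_uniq _ (fun i => c *: pr i u + pr i v) (maxn N1 N2)).
- by move=> i; apply: piece_lin; exact: pr_piece.
- by move=> i; rewrite geq_max => /andP[/h1 -> /h2 ->]; rewrite scaler0 addr0.
have E (w : M) N N' : (forall n, (N <= n)%N -> pr n w = 0) -> w = \sum_(n < N) pr n w ->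
    (N <= N')%N -> w = \sum_(n < N') pr n w.
  move=> h Ew NN; rewrite {1}Ew -!(fsum_ord) // => i hi; apply: h; exact: leq_trans hi.
rewrite {1}(E u _ _ h1 E1 (leq_maxl N1 N2)) {1}(E v _ _ h2 E2 (leq_maxr N1 N2)).
by rewrite scaler_sumr -big_split.
Qed.

(** On the n-th piece, L_0 - l is the sum of a nilpotent map and a nonzero scalar. *)
Lemma no_eigen (l : C) k u : (forall n : nat, l != r + n%:R) ->
  iter k (fun v => Lop A act 0 v - l *: v) u = 0 -> u = 0.
Proof.
move=> hl; set f := fun v => _.
have fl : linear f.
  by move=> c v w; rewrite /f Lop_linear scalerDr opprD addrACA scalerBr !scalerA (mulrC c).
suff inj v : f v = 0 -> v = 0.
  by elim: k u => [|k IH] u //; rewrite iterS => /inj /IH.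
move=> fv.
have fE n w : f w = Nil n w + (r + n%:R - l) *: w.
  by rewrite /f /L0_nil scalerBl addrA subrK.
have hp n w : piece n w -> piece n (f w).
  move=> hw; rewrite (fE n) addrC; apply: piece_lin => //.
  case: hw => j hj; exists j; rewrite -[LHS]/(iter j (Nil n) (Nil n w)) -iterSr iterS.
  by rewrite (hj : iter j (Nil n) w = 0) (linf0 (Nil_linear n)).
have fp n : f (pr n v) = 0.
  by rewrite -(pr_comm fl hp) fv (linf0 (pr_linear n)).
have [N [hN ->]] := pr_bound v; rewrite big1// => n _.
have := fp n; rewrite (fE n) => /eqP; rewrite addr_eq0 => /eqP h.
have c0 : l - (r + n%:R) != 0 by rewrite subr_eq0.
have hi j : iter j (Nil n) (pr n v) = (l - (r + n%:R)) ^+ j *: pr n v.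
  elim: j => [|j IH]; first by rewrite expr0 scale1r.
  rewrite iterS IH (linfZ (Nil_linear n)) h -scaleNr scalerA exprSr.
  by congr (_ *: _); ring.
have /pieceP := pr_piece n v; rewrite hi => /eqP.
by rewrite scaler_eq0 expf_eq0 (negbTE c0) /= => /eqP.
Qed.

(** J_m lowers the generalized eigenvalue of L_0 by m and commutes with the nilpotent part. *)
Lemma J_Nil m a (n n' : nat) u : n'%:Z = n%:Z - m ->
  Nil n' (J m a u) = J m a (Nil n u).
Proof.
move=> h; rewrite /L0_nil (L0_J W) (linfB (J_linearr W m a)) (linfZ (J_linearr W m a)).
rewrite -addrA -opprD -scalerDl; congr (_ - _ *: _).
have -> : m = n%:Z - n'%:Z by lia.
by rewrite rmorphB /=; ring.
Qed.

Lemma J_iterNil m a (n n' : nat) j u : n'%:Z = n%:Z - m ->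
  iter j (Nil n') (J m a u) = J m a (iter j (Nil n) u).
Proof. by move=> h; elim: j => //= j ->; exact: J_Nil. Qed.

Lemma J_piece m a (n n' : nat) u : n'%:Z = n%:Z - m -> piece n u -> piece n' (J m a u).
Proof.
move=> h [k hk]; exists k.
by have := J_iterNil a k u h; rewrite hk (linf0 (J_linearr W m a)).
Qed.

(** The result would have a generalized eigenvalue below the lowest one. *)
Lemma J_piece_eq0 m a (n : nat) u : n%:Z < m -> piece n u -> J m a u = 0.
Proof.
move=> h [k hk]; apply: (@no_eigen (r + n%:R - m%:~R) k).
  move=> n'; rewrite -subr_eq0.
  have -> : r + n%:R - m%:~R - (r + n'%:R) = (n%:Z - m - n'%:Z)%:~R.
    by rewrite !rmorphB /=; ring.
  by rewrite intr_eq0; lia.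
set f := fun v => _.
have E v : f (J m a v) = J m a (Nil n v).
  rewrite /f /L0_nil (L0_J W) (linfB (J_linearr W m a)) (linfZ (J_linearr W m a)).
  by rewrite -addrA -opprD -scalerDl; congr (_ - _ *: _); ring.
have -> j : iter j f (J m a u) = J m a (iter j (Nil n) u).
  by elim: j => //= j ->.
by rewrite -[iter k _ u]/(iter k (fun v => Lop A act 0 v - (r + n%:R) *: v) u) hk (linf0 (J_linearr W m a)).
Qed.

Lemma Nil_piece n u : piece n u -> piece n (Nil n u).
Proof.
case=> j hj; exists j; rewrite -[LHS]/(iter j (Nil n) (Nil n u)) -iterSr iterS.
by rewrite (hj : iter j (Nil n) u = 0) (linf0 (Nil_linear n)).
Qed.

Lemma iterNil_piece n j u : piece n u -> piece n (iter j (Nil n) u).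
Proof. by move=> hu; elim: j => //= j; exact: Nil_piece. Qed.

(** ** The trace functionals *)

Variables (P : algType C) (rho : P -> M -> M) (phi : {scalar P}).
Hypothesis pc : projective_commutant act rho.
Hypothesis phiC : forall x y : P, phi (x * y) = phi (y * x).

Let cs : commutant_subalgebra act rho := pc.1.

Lemma rho_scalar (c : C) u : rho (c *: 1) u = c *: u.
Proof. by rewrite (linfZ (rho_linear cs u)) (rho1 cs). Qed.

Lemma rho_Nil n x u : rho x (Nil n u) = Nil n (rho x u).
Proof.
by rewrite /L0_nil (linfB (rho_End cs x)) (linfZ (rho_End cs x)) /Lop (rho_commute cs).
Qed.

Lemma rho_piece n x u : piece n u -> piece n (rho x u).
Proof.
case=> k hk; exists k; suff E j : iter j (Nil n) (rho x u) = rho x (iter j (Nil n) u).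
  rewrite -[LHS]/(iter k (Nil n) (rho x u)) E.
  rewrite -[iter k _ u]/(iter k (fun v => Lop A act 0 v - (r + n%:R) *: v) u).
  by rewrite hk (linf0 (rho_End cs x)).
by elim: j => //= j ->; rewrite rho_Nil.
Qed.

Lemma piece_rho_closed n : rho_closed rho (piece n).
Proof. by move=> x u v hu hv; rewrite -[rho x u]scale1r; apply: piece_lin => //; exact: rho_piece. Qed.

Lemma rho_linear_comm (f : M -> M) : linear f -> (forall x u, rho x (f u) = f (rho x u)) ->
  rho_linear_map rho f.
Proof. by move=> fl fr x u v; rewrite (linfD fl) fr. Qed.

Lemma J_rho_linear m a : rho_linear_map rho (J m a).
Proof.
apply: rho_linear_comm; first exact: J_linearr.
move=> x u; have [N hN] := J_decomp W a; rewrite !hN (linf_sum (rho_End cs x)).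
by apply: eq_bigr => i _; rewrite (rho_commute cs).
Qed.

Lemma iterNil_rho_linear n j : rho_linear_map rho (iter j (Nil n)).
Proof.
apply: rho_linear_comm; first exact/iter_linear/Nil_linear.
by move=> x u; elim: j => //= j <-; rewrite rho_Nil.
Qed.

Lemma piece_coordinates n : exists k (e : 'I_k -> M) (f : 'I_k -> M -> P),
  (forall i x u v, f i (rho x u + v) = x * f i u + f i v) /\
  coordinate_system rho (piece n) e f.
Proof.
have [k [e he]] := graded_finite_dim gr n.
have prr x u v : pr n (rho x u + v) = rho x (pr n u) + pr n v.
  rewrite (linfD (pr_linear n)) (pr_comm (rho_End cs x)) //.
  by move=> i w; exact: rho_piece.
have := projective_coordinates (rho_linear cs) (rho_End cs) (rho1 cs) (rhoM cs)
  (W := piece n) (pr := pr n) (e := fun i => pr n (e i)) pc.2 prr (pr_piece n) (@pr_id n).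
case=> [u hu|i|f [fl fE]]; first last.
- exists k, (fun i => pr n (e i)), f; split=> //; split=> //.
  by move=> i; exact: pr_piece.
- exact: pr_piece.
have [c hc] := he u hu; exists (fun i => c i *: 1).
rewrite -{1}(pr_id hu) {1}hc (linf_sum (pr_linear n)); apply: eq_bigr => i _.
by rewrite rho_scalar (linfZ (pr_linear n)).
Qed.

(** The coordinates of [piece_coordinates] are defined on all of [M], so that the functionals
    are linear and local on all maps, and cyclicity is needed only for [P]-linear ones. *)
Lemma trace_functionals : exists T : nat -> (M -> M) -> C,
  [/\ forall n alpha, rho_linear_map rho alpha -> (forall w, piece n w -> piece n (alpha w)) ->
        pseudo_trace rho phi (piece n) alpha = T n alpha,
      forall n c alpha beta, T n (fun u => c *: alpha u + beta u) = c * T n alpha + T n beta,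
      forall n alpha beta, (forall u, piece n u -> alpha u = beta u) -> T n alpha = T n beta
    & forall n n' alpha beta, rho_linear_map rho alpha -> rho_linear_map rho beta ->
        (forall w, piece n w -> piece n' (beta w)) ->
        (forall w, piece n' w -> piece n (alpha w)) ->
        T n (alpha \o beta) = T n' (beta \o alpha)].
Proof.
have H n : exists x : {k & (('I_k -> M) * ('I_k -> M -> P))%type},
    (forall i y u v, (projT2 x).2 i (rho y u + v) = y * (projT2 x).2 i u + (projT2 x).2 i v) /\
    coordinate_system rho (piece n) (projT2 x).1 (projT2 x).2.
  by have [k [e [f h]]] := piece_coordinates n; exists (existT _ k (e, f)).
have /choice [g hg] := H.
exists (fun n => ctrace phi (projT2 (g n)).1 (projT2 (g n)).2); split.
- move=> n alpha al aW; have [fl csn] := hg n.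
  exact: (pseudo_traceE (rho_End cs) (rho1 cs) phiC (piece0 n) (@piece_rho_closed n) csn al aW).
- move=> n c alpha beta; have [fl _] := hg n; rewrite /ctrace mulr_sumr -big_split.
  apply: eq_bigr => i _; rewrite -rho_scalar fl -scalerAl mul1r.
  by rewrite linearD linearZ.
- move=> n alpha beta h; rewrite /ctrace; apply: eq_bigr => i _.
  by rewrite h//; have [_ [+ _ _]] := hg n; apply.
- move=> n n' alpha beta al bl hb ha.
  have [_ cn] := hg n; have [_ cn'] := hg n'.
  exact: (ctrace_cyclic (rho_End cs) (rho1 cs) phiC (piece0 n) (piece0 n')
    (@piece_rho_closed n) (@piece_rho_closed n') cn cn' al bl hb ha).
Qed.

End GradedModule.

(** * Zhu's recursion for traces *)

Section SquareModes.
Variable R : realType.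
Local Notation C := R[i].
Variables (V : lmodType C) (A : voa V).

(** The square-bracket modes in the variable w = 2 pi i z, for [a] of weight [k]; compared with
    [sq_prod] the power of 2 pi i and the decomposition of [a] are left out. *)
Definition wprod (k : nat) (a : V) (n : int) (b : V) : V :=
  \sum_(j \in [set: nat]) exp_coef R (- (n + j%:Z) - 1) k j *: nprod A a (n + j%:Z) b.

Lemma wprodE k a n b N : (forall j : nat, (N <= j)%N -> nprod A a (n + j%:Z) b = 0) ->
  wprod k a n b =
  \sum_(j < N) exp_coef R (- (n + j%:Z) - 1) k j *: nprod A a (n + j%:Z) b.
Proof. by move=> h; apply: fsum_ord => j /h ->; rewrite scaler0. Qed.

Lemma wprod_linear k a n : linear (wprod k a n).
Proof.
move=> c b b'.
have [N1 h1] := prod_trunc A a b n; have [N2 h2] := prod_trunc A a b' n.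
pose N := maxn N1 N2.
have h1' j : (N <= j)%N -> nprod A a (n + j%:Z) b = 0.
  by rewrite geq_max => /andP[/h1].
have h2' j : (N <= j)%N -> nprod A a (n + j%:Z) b' = 0.
  by rewrite geq_max => /andP[_ /h2].
have pl j := act_linearr (prod_weak_module A) a (n + j%:Z).
rewrite (wprodE k h1') (wprodE k h2') (@wprodE _ _ _ _ N); last first.
  by move=> j hj; rewrite pl h1'// h2'// scaler0 addr0.
rewrite scaler_sumr -big_split; apply: eq_bigr => j _.
by rewrite pl scalerDr !scalerA (mulrC c).
Qed.

Lemma sq_prod_homog k a n b : homogeneous A k a ->
  sq_prod A a n b = two_pi_i R ^ (- n - 1) *: wprod k a n b.
Proof.
move=> ha; rewrite /sq_prod (fsum_ord (N := k.+1)); last first.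
  move=> i ik; rewrite (fsum_ord (N := 0)) ?big_ord0// => j _.
  rewrite (hcompH _ ha); case: eqP => [E|_]; first by move: ik; rewrite E ltnn.
  by rewrite (act0l (prod_weak_module A)) scaler0.
rewrite big_ord_recr /= ha big1 ?add0r; last first.
  move=> i _; rewrite (fsum_ord (N := 0)) ?big_ord0// => j _.
  rewrite (hcompH _ ha); case: eqP => [E|_]; first by have := ltn_ord i; rewrite E ltnn.
  by rewrite (act0l (prod_weak_module A)) scaler0.
have [N hN] := prod_trunc A a b n.
rewrite (wprodE k hN) (fsum_ord (N := N)); last by move=> j /hN ->; rewrite scaler0.
by rewrite scaler_sumr; apply: eq_bigr => j _; rewrite scalerA.
Qed.

Lemma sum_ord_shift (S : nmodType) (F : nat -> S) N s :
  (forall i, (N <= i)%N -> F i = 0) ->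
  \sum_(j < N) F (s + j)%N = \sum_(i < N | (s <= i)%N) F i.
Proof.
move=> hF; case: (leqP s N) => sN; last first.
  rewrite !big1// => i; first by move=> si; have := ltn_ord i; lia.
  by move=> _; apply: hF; lia.
rewrite -(big_mkord xpredT (fun j => F (s + j)%N)).
rewrite (big_cat_nat _ (n := (N - s)%N)) ?leq_subr//= [X in _ + X]big_nat_cond.
rewrite [X in _ + X]big1 ?addr0; last first.
  by move=> i /andP[/andP[h1 h2] _]; apply: hF; lia.
rewrite -(big_mkord (fun i => (s <= i)%N) F).
rewrite [RHS](big_cat_nat _ (n := s)) //= [X in _ = X + _]big_nat_cond.
rewrite [X in _ = X + _]big1 ?add0r; last first.
  by move=> i /andP[/andP[h1 h2] h3]; lia.
rewrite -[s in X in _ = X]add0n big_addn.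
rewrite big_nat_cond [RHS]big_nat_cond; apply: eq_big => i.
  by rewrite leq_addl !andbT.
by rewrite addnC.
Qed.

(** Regroup a combination of the modes a_(i) b as one of the modes in the variable w, given the
    corresponding identity for the coefficients. *)
Lemma change_of_modes k (c : int) (w x : nat -> C) (g : nat -> V) N :
  (forall i, x i = \sum_(s < i.+1) w s * exp_coef R (c - i%:Z) k (i - s)) ->
  (forall i, (N <= i)%N -> g i = 0) ->
  \sum_(i < N) x i *: g i =
  \sum_(s < N) w s *: \sum_(j < N) exp_coef R (c - (s + j)%N%:Z) k j *: g (s + j)%N.
Proof.
move=> hx hg.
transitivity (\sum_(s < N) \sum_(i < N | (s <= i)%N)
    w s *: (exp_coef R (c - i%:Z) k (i - s) *: g i)); last first.
  apply: eq_bigr => s _; rewrite -scaler_sumr; congr (_ *: _).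
  rewrite -(sum_ord_shift (F := fun i => exp_coef R (c - i%:Z) k (i - s) *: g i)).
    by apply: eq_bigr => j _; rewrite addKn.
  by move=> i /hg ->; rewrite scaler0.
rewrite (exchange_big_dep xpredT) //=; apply: eq_bigr => i _.
rewrite hx scaler_suml.
rewrite (big_ord_widen_cond N xpredT (fun s => (w s * exp_coef R (c - i%:Z) k (i - s)) *: g i)) //.
by apply: eq_big => [s|s _]; rewrite ?ltnS ?scalerA.
Qed.

Lemma wprod_res0 k a b (m : int) N : (forall i : nat, (N <= i)%N -> nprod A a i b = 0) ->
  \sum_(i < N) binz R (m + k%:Z - 1) i *: nprod A a i b =
  \sum_(s < N) (m%:~R ^+ s / (s`!)%:R) *: wprod k a s b.
Proof.
move=> hN.
rewrite (change_of_modes (c := -1) (w := fun s => m%:~R ^+ s / (s`!)%:R) (k := k)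
  (x := binz R (m + k%:Z - 1)) (g := fun i => nprod A a i b)) //; last first.
  by move=> i; rewrite binz_exp_coef (_ : - i.+1%:Z = -1 - i%:Z)//; lia.
apply: eq_bigr => s _; congr (_ *: _).
rewrite (@wprodE _ _ _ _ N).
  by apply: eq_bigr => j _; rewrite PoszD (_ : - (s%:Z + j%:Z) - 1 = -1 - (s%:Z + j%:Z))//; lia.
by move=> j hj; rewrite -PoszD; apply: hN; lia.
Qed.

Lemma wprod_res (e k : nat) a b N :
  (forall i : nat, (N <= i)%N -> nprod A a (i%:Z - 1 - e%:Z) b = 0) ->
  \sum_(i < N) binz R k%:Z i *: nprod A a (i%:Z - 1 - e%:Z) b =
  \sum_(s < N) bern R e s *: wprod k a (s%:Z - 1 - e%:Z) b.
Proof.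
move=> hN.
rewrite (change_of_modes (c := e%:Z) (w := bern R e) (k := k)
  (x := binz R k%:Z) (g := fun i : nat => nprod A a (i%:Z - 1 - e%:Z) b)) //; last first.
  by move=> i; exact: binz_bern.
apply: eq_bigr => s _; congr (_ *: _).
rewrite (@wprodE _ _ _ _ N).
  apply: eq_bigr => j _; congr (exp_coef _ _ _ _ *: nprod A a _ _); lia.
move=> j hj; rewrite (_ : s%:Z - 1 - e%:Z + j%:Z = (s + j)%N%:Z - 1 - e%:Z); last by lia.
by apply: hN; lia.
Qed.

End SquareModes.

Section SquareProducts.
Variable R : realType.
Local Notation C := R[i].
Variables (V : lmodType C) (A : voa V).

Lemma exp_coef00 j : exp_coef R 0 0 j = (j == 0%N)%:R.
Proof.
rewrite exp_coefE fEpow0 mul1r /fexp.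
by case: j => [|j]; rewrite ?expr0n /= ?mul0r// fact0 divr1.
Qed.

Lemma wprod_linearl k n b : linear (fun a => wprod A k a n b).
Proof.
move=> c a a'.
have [N1 h1] := prod_trunc A a b n; have [N2 h2] := prod_trunc A a' b n.
pose N := maxn N1 N2.
have h1' j : (N <= j)%N -> nprod A a (n + j%:Z) b = 0.
  by rewrite geq_max => /andP[/h1].
have h2' j : (N <= j)%N -> nprod A a' (n + j%:Z) b = 0.
  by rewrite geq_max => /andP[_ /h2].
have pl j := act_linearl (prod_weak_module A) (n + j%:Z) b.
rewrite (wprodE k h1') (wprodE k h2') (@wprodE _ _ _ _ _ _ _ N); last first.
  by move=> j hj; rewrite pl h1'// h2'// scaler0 addr0.
rewrite scaler_sumr -big_split; apply: eq_bigr => j _.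
by rewrite pl scalerDr !scalerA (mulrC c).
Qed.

Lemma sq_prodE a n b N : (forall k, (N <= k)%N -> hcomp A k a = 0) ->
  sq_prod A a n b = \sum_(k < N) two_pi_i R ^ (- n - 1) *: wprod A k (hcomp A k a) n b.
Proof.
move=> hN; rewrite {1}/sq_prod (fsum_ord (N := N)); last first.
  move=> i /hN ->; rewrite (fsum_ord (N := 0)) ?big_ord0// => j _.
  by rewrite (act0l (prod_weak_module A)) scaler0.
apply: eq_bigr => k _.
have [N' hN'] := prod_trunc A (hcomp A k a) b n.
rewrite (wprodE k hN') (fsum_ord (N := N')); last by move=> j /hN' ->; rewrite scaler0.
by rewrite scaler_sumr; apply: eq_bigr => j _; rewrite scalerA.
Qed.

(** omega has weight 2 and the vacuum weight 0. *)
Lemma sq_conf_prod n b : sq_prod A (sq_conf A) n b =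
  two_pi_i R ^ (- n - 1) *: (two_pi_i R ^+ 2 *:
    (wprod A 2 (conf A) n b - (Defs.charge A / 24) *: wprod A 0 (vac A) n b)).
Proof.
have hk k : hcomp A k (sq_conf A) = two_pi_i R ^+ 2 *:
    ((if k == 2%N then conf A else 0) - (Defs.charge A / 24) *: (if k == 0%N then vac A else 0)).
  rewrite /sq_conf (linfZ (comp_linear A k)) (linfB (comp_linear A k)).
  rewrite (linfZ (comp_linear A k)) (hcompH _ (conf_homog A)) (hcompH _ (vac_homog A)).
  by [].
rewrite (@sq_prodE _ _ _ 3); last first.
  by move=> [|[|[|k]]]// _; rewrite hk /= scaler0 subr0 scaler0.
have z k : wprod A k 0 n b = 0 := linf0 (wprod_linearl k n b).
rewrite !big_ord_recr big_ord0 /= add0r !hk /= !scaler0 !subr0 scaler0 z scaler0 addr0.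
rewrite !(linfZ (wprod_linearl _ _ _)) sub0r (linfN (wprod_linearl _ _ _)).
rewrite (linfZ (wprod_linearl _ _ _)) -scalerDr -scalerDr.
by rewrite [X in _ *: (_ *: X)]addrC.
Qed.

Lemma wprod_vac n b : wprod A 0 (vac A) n b = if n == -1 then b else 0.
Proof.
have h j : nprod A (vac A) j b = if j == -1 then b else 0 := act_vac (prod_weak_module A) j b.
case: (lerP n (-1)) => hn; last first.
  rewrite (@wprodE _ _ _ _ _ _ _ 0) ?big_ord0.
    by case: eqP => // ?; lia.
  by move=> j _; rewrite h; case: eqP => // ?; lia.
pose m := `|(n + 1)%R|%N.
have hm : n = - 1 - m%:Z by rewrite /m; lia.
rewrite (@wprodE _ _ _ _ _ _ _ m.+1); last first.
  by move=> j hj; rewrite h; case: eqP => // ?; lia.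
rewrite big_ord_recr /= big1 ?add0r; last first.
  by move=> i _; rewrite h; case: eqP => [?|_]; [have := ltn_ord i; lia|rewrite scaler0].
rewrite h hm (_ : - 1 - m%:Z + m%:Z = -1) ?eqxx; last by lia.
rewrite (_ : - -1 - 1 = 0 :> int)// exp_coef00.
by case: m {hm} => [|m]; rewrite ?scale1r ?scale0r.
Qed.

Lemma sq_L_m2 b : sq_L A (-2) b =
  two_pi_i R ^+ 2 *: (wprod A 2 (conf A) (-1) b - (Defs.charge A / 24) *: b).
Proof. by rewrite /sq_L sq_conf_prod wprod_vac /= expr0z scale1r. Qed.

Lemma sq_L_even p b : wprod A 2 (conf A) (2 * p).+1 b =
  two_pi_i R ^+ (2 * p) *: sq_L A (2 * p)%N b.
Proof.
rewrite /sq_L sq_conf_prod wprod_vac; case: eqP => [?|_]; first by lia.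
rewrite scaler0 subr0 !scalerA (_ : (2 * p)%N%:Z + 1 = (2 * p).+1); last by lia.
rewrite !exprnP -!expfzDr ?two_pi_i_neq0//.
by rewrite (_ : _ + _ = 0 :> int) ?expr0z ?scale1r//; lia.
Qed.

Lemma low_weights_span K : exists (I : finType) (e : I -> V),
  forall k v, (k < K)%N -> homogeneous A k v -> exists c : I -> C, v = \sum_i c i *: e i.
Proof.
elim: K => [|K [I [e he]]]; first by exists 'I_0, (fun=> 0).
have [n [f hf]] := comp_finite_dim A K.
exists (I + 'I_n)%type, (fun x => match x with inl i => e i | inr i => f i end) => k v kK hv.
have [E|kK'] := eqVneq k K; last first.
  have [|c ->] := he k v _ hv; first by lia.
  exists (fun x => match x with inl i => c i | inr i => 0 end).
  by rewrite big_sumType /= [X in _ + X]big1 ?addr0// => i _; rewrite scale0r.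
have [|c ->] := hf v; first by exists v => //; rewrite -E.
exists (fun x => match x with inl i => 0 | inr i => c i end).
by rewrite big_sumType /= [X in X + _]big1 ?add0r// => i _; rewrite scale0r.
Qed.

End SquareProducts.

Section SequenceRecursion.
Variable C : zmodType.

(** As power series in q, Z = (Z + c) q^m, that is, Z = c q^m / (1 - q^m). *)
Lemma geometric_recursion (Z c : nat -> C) m : (0 < m)%N ->
  (forall n, (n < m)%N -> Z n = 0) -> (forall n, Z (n + m)%N = Z n + c n) ->
  forall n, Z n = \sum_(i < n.+1 | (0 < i)%N && (m %| i)%N) c (n - i)%N.
Proof.
move=> m0 Z0 ZS n; elim/ltn_ind: n => n IH.
case: (ltnP n m) => nm.
  rewrite Z0// big1// => i /andP[i0 mi]; have := dvdn_leq i0 mi.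
  by have := ltn_ord i; lia.
rewrite -(subnK nm) ZS IH; last by lia.
set n' := (n - m)%N.
rewrite -(big_mkord (fun i => (0 < i)%N && (m %| i)%N) (fun i => c (n' + m - i)%N)).
rewrite (big_cat_nat _ (n := m)) //=; last by lia.
rewrite [X in _ = X + _]big_nat_cond [X in _ = X + _]big1 ?add0r; last first.
  move=> i /andP[im /andP[i0 mi]]; have := dvdn_leq i0 mi; lia.
rewrite -[m in X in _ = X]add0n big_addn.
rewrite (_ : ((n' + m).+1 - m = n'.+1)%N); last by lia.
rewrite big_ltn_cond // add0n m0 dvdnn /= addnK addrC; congr (_ + _).
rewrite -(big_mkord (fun i => (0 < i)%N && (m %| i)%N) (fun i => c (n' - i)%N)).
rewrite [LHS]big_ltn_cond //=.
rewrite big_nat_cond [RHS]big_nat_cond; apply: eq_big => i.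
  by rewrite dvdn_addl ?dvdnn// addn_gt0 m0 orbT; case: (posnP i) => [->|].
by move=> _; congr c; lia.
Qed.

End SequenceRecursion.

Section Recursion.
Variable R : realType.
Local Notation C := R[i].
Variables (V : lmodType C) (A : voa V) (M : lmodType C) (act : V -> int -> M -> M).
Variables (r : C) (d : nat).
Hypothesis W : weak_module_axioms (nprod A) (vac A) act.
Hypothesis gr : is_graded A act r d.
Local Notation J := (J A act).
Local Notation piece := (graded_piece A act r).
Local Notation Nil := (L0_nil A act r).
Variables (P : algType C) (rho : P -> M -> M).
Hypothesis pc : projective_commutant act rho.
Variable T : nat -> (M -> M) -> C.
Hypothesis Tl : forall n c alpha beta, T n (fun u => c *: alpha u + beta u) = c * T n alpha + T n beta.
Hypothesis Te : forall n alpha beta, (forall u, piece n u -> alpha u = beta u) -> T n alpha = T n beta.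
Hypothesis Tc : forall n n' alpha beta, rho_linear_map rho alpha -> rho_linear_map rho beta ->
        (forall w, piece n w -> piece n' (beta w)) ->
        (forall w, piece n' w -> piece n (alpha w)) ->
        T n (alpha \o beta) = T n' (beta \o alpha).

Lemma T0 n : T n (fun=> 0) = 0.
Proof.
have := Tl n (-1) (fun=> 0) (fun=> 0); rewrite mulN1r addNr => <-.
by apply: Te => u _; rewrite scaler0 addr0.
Qed.

Lemma T_sum n (I : Type) (s : seq I) (c : I -> C) (alpha : I -> M -> M) :
  T n (fun u => \sum_(i <- s) c i *: alpha i u) = \sum_(i <- s) c i * T n (alpha i).
Proof.
elim: s => [|i s IH].
  by rewrite big_nil -(T0 n); apply: Te => u _; rewrite big_nil.
rewrite big_cons -IH -Tl; apply: Te => u _; by rewrite big_cons.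
Qed.

(** Powers of the nilpotent part of L_0 are built in, because they come out of q^(L_0) and of
    the action of L_0. *)
Definition tr j n (alpha : M -> M) : C := T n (fun u => alpha (iter j (Nil n) u)).

Lemma tr_ext j n alpha beta : (forall u, piece n u -> alpha u = beta u) ->
  tr j n alpha = tr j n beta.
Proof. by move=> h; apply: Te => u hu; apply/h/iterNil_piece. Qed.

Lemma tr_sum j n (I : Type) (s : seq I) (c : I -> C) (alpha : I -> M -> M) :
  tr j n (fun u => \sum_(i <- s) c i *: alpha i u) = \sum_(i <- s) c i * tr j n (alpha i).
Proof. exact: T_sum. Qed.

Lemma trD j n alpha beta : tr j n (fun u => alpha u + beta u) = tr j n alpha + tr j n beta.
Proof.
rewrite /tr -[T n _ in RHS]mul1r -Tl; apply: Te => u _; by rewrite scale1r.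
Qed.

Lemma tr_zero j n alpha : (forall u, piece n u -> alpha u = 0) -> tr j n alpha = 0.
Proof. by move=> h; rewrite (tr_ext _ h); exact: T0. Qed.

Definition ch j n (a : V) : C := tr j n (J 0 a).

Lemma ch_linear j n : scalar (ch j n).
Proof.
move=> c a b; rewrite /ch /tr -Tl; apply: Te => u _; exact: J_linearl.
Qed.

Lemma ch0 j n : ch j n 0 = 0.
Proof. by have := ch_linear j n (-1) 0 0; rewrite scaleN1r addNr mulN1r addNr. Qed.

Lemma chD j n a b : ch j n (a + b) = ch j n a + ch j n b.
Proof. by have := ch_linear j n 1 a b; rewrite scale1r mul1r. Qed.

Lemma chZ j n c a : ch j n (c *: a) = c * ch j n a.
Proof. by have := ch_linear j n c a 0; rewrite !addr0 ch0 addr0. Qed.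

Lemma ch_sum j n (I : Type) (s : seq I) (F : I -> V) :
  ch j n (\sum_(i <- s) F i) = \sum_(i <- s) ch j n (F i).
Proof. by elim: s => [|i s IH]; rewrite ?big_nil ?ch0// !big_cons chD IH. Qed.

(** Cyclicity for J_m(a) followed by the power of the nilpotent part, with which the modes
    commute. *)
Lemma tr_cyclic j (n n' : nat) (m : int) a b : n'%:Z = n%:Z + m ->
  tr j n (fun u => J m a (J (- m) b u)) = tr j n' (fun u => J (- m) b (J m a u)).
Proof.
move=> hn; rewrite /tr.
have h1 : n'%:Z = n%:Z - (- m) by lia.
have h2 : n%:Z = n'%:Z - m by lia.
transitivity (T n (J m a \o (fun u => J (- m) b (iter j (Nil n) u)))) => //.
rewrite (@Tc n n').
- by apply: Te => u _ /=; rewrite (J_iterNil r W _ _ _ h2).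
- by apply: J_rho_linear.
- move=> x u v; rewrite (iterNil_rho_linear r W pc) (J_rho_linear W pc) //.
- by move=> u hu; apply: (J_piece W _ h1); exact: iterNil_piece.
- by move=> u hu; apply: (J_piece W _ h2).
Qed.

Section TwoModes.
Variables (k l : nat) (a b : V) (N : nat) (j : nat).
Hypotheses (ha : homogeneous A k a) (hb : homogeneous A l b).
Hypothesis hN : forall n : int, N%:Z <= n + 2 -> nprod A a n b = 0.

(** The trace of the commutator of J_m(a) and J_(-m)(b). *)
Definition tr_commutator (n : nat) (m : int) : C :=
  \sum_(s < N) (m%:~R ^+ s / (s`!)%:R) * ch j n (wprod A k a s b).

Lemma tr_comm n (m : int) :
  tr j n (fun u => J m a (J (- m) b u)) = tr j n (fun u => J (- m) b (J m a u)) + tr_commutator n m.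
Proof.
have hN0 (i : nat) : (N <= i)%N -> nprod A a i b = 0 by move=> h; apply: hN; lia.
rewrite -(@tr_ext j n (fun u => J (- m) b (J m a u) +
   \sum_(i < N) binz R (m + k%:Z - 1) i *: J 0 (nprod A a i b) u)); last first.
  move=> u _; apply/eqP; rewrite addrC eq_sym -subr_eq (J_comm W _ _ _ ha hb hN0).
  by rewrite addrN.
rewrite trD tr_sum; congr (_ + _).
rewrite -(eq_bigr _ (fun i _ => chZ j n _ _)) -(ch_sum j n _ (fun i : 'I_N => _)).
by rewrite wprod_res0// ch_sum; apply: eq_bigr => s _; rewrite chZ.
Qed.

(** For m = 0 both orders have the same trace, and only s = 0 contributes to the commutator. *)
Lemma ch_sq0 n : ch j n (wprod A k a 0 b) = 0.
Proof.
have hN0 (i : nat) : (N <= i)%N -> nprod A a i b = 0 by move=> h; apply: hN; lia.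
case: (posnP N) => N0.
  by rewrite (@wprodE _ _ _ _ _ _ _ 0) ?big_ord0 ?ch0// => i _; rewrite add0r; apply: hN0; lia.
have := tr_comm n 0; rewrite (@tr_cyclic j n n 0) ?addr0//.
move/eqP; rewrite -[X in X == _]addr0 (inj_eq (addrI _)) eq_sym /tr_commutator.
rewrite (bigD1 (Ordinal N0)) //= big1 ?addr0.
  by rewrite expr0 fact0 divr1 mul1r => /eqP.
by move=> -[[|s] hs] // _; rewrite mulr0z expr0n /= !mul0r.
Qed.

(** Cyclicity moves the mode J_m(a) around, from the n-th piece to the piece of index n + m, at
    the cost of a commutator: the generating series Z satisfies Z = (Z + c) q^m. *)
Lemma tr_lower_raise (m : nat) n : (0 < m)%N ->
  tr j n (fun u => J (- m%:Z) b (J m a u)) =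
  \sum_(i < n.+1 | (0 < i)%N && (m %| i)%N) tr_commutator (n - i) m.
Proof.
move=> m0; pose Z n := tr j n (fun u => J (- m%:Z) b (J m a u)).
apply: (@geometric_recursion _ Z (fun n => tr_commutator n m) m m0) => i.
  move=> im; apply: tr_zero => u hu; rewrite (J_piece_eq0 W gr _ (_ : i%:Z < m%:Z) hu); last by lia.
  exact: linf0 (J_linearr W _ _).
by rewrite /Z -(tr_cyclic j (n := i) (m := m)) ?tr_comm// ; lia.
Qed.

Lemma tr_raise_lower (m : nat) n : (0 < m)%N ->
  tr j n (fun u => J (- m%:Z) a (J m b u)) =
  - \sum_(i < n.+1 | (0 < i)%N && (m %| i)%N) tr_commutator (n - i) (- m%:Z).
Proof.
move=> m0; pose Z n := tr j n (fun u => J (- m%:Z) a (J m b u)).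
rewrite -sumrN.
apply: (@geometric_recursion _ Z (fun n => - tr_commutator n (- m%:Z)) m m0) => i.
  move=> im; apply: tr_zero => u hu; rewrite (J_piece_eq0 W gr _ (_ : i%:Z < m%:Z) hu); last by lia.
  exact: linf0 (J_linearr W _ _).
have := tr_comm i (- m%:Z); have := @tr_cyclic j (i + m)%N i (- m%:Z) a b.
rewrite /Z opprK => -> => [->|]; last by lia.
by rewrite addrK.
Qed.

Lemma zhu_coef (e i : nat) : (e <= 1)%N ->
  (-1) ^+ i * binz R (- 1 - e%:Z) i = (i + e)%:R ^+ e.
Proof.
case: e => [|[|//]] _.
  by rewrite subr0 binzN1 -expr2 -exprM mulnC exprM sqrrN !expr1n.
by rewrite (_ : -1 - 1%:Z = -2)// binzN2 expr1 addn1.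
Qed.

(** Take the trace of [J0_zhu].  The pairs of modes J_(-m) J_m are replaced by their geometric
    series, and the sum over the multiples i' of m becomes a divisor sum; the signs come from
    the commutators with m and with - m. *)
Lemma zhu_recursion (e n : nat) : (e <= 1)%N ->
  \sum_(s < N) bern R e s * ch j n (wprod A k a (s%:Z - 1 - e%:Z) b) =
  (e == 0%N)%:R * tr j n (fun u => J 0 a (J 0 b u)) +
  \sum_(s < N) (((-1) ^+ e - (-1) ^+ s) / (s`!)%:R) *
     conv (sigma R (e + s)) (fun i => ch j i (wprod A k a s b)) n.
Proof.
move=> e1.
have hNe (i : nat) : (N <= i)%N -> nprod A a (i%:Z - 1 - e%:Z) b = 0.
  by move=> h; apply: hN; lia.
transitivity (\sum_(i < n.+1) (i + e)%:R ^+ e *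
   (tr j n (fun u => J (- (i + e)%N%:Z) a (J (i + e)%N b u)) +
    (-1) ^+ e * tr j n (fun u => J (- i.+1%:Z) b (J i.+1 a u)))).
  under eq_bigr do rewrite -chZ; rewrite -ch_sum -(wprod_res (e := e) k hNe).
  rewrite ch_sum; under eq_bigr do rewrite chZ.
  rewrite -tr_sum.
  under [RHS]eq_bigr => i _ do rewrite -(zhu_coef _ e1).
  rewrite (@tr_ext j n _ (fun u => \sum_(i < n.+1) ((-1) ^+ i * binz R (- 1 - e%:Z) i) *:
    (J (- (i%:Z + e%:Z)) a (J (i%:Z + e%:Z) b u) +
     (-1) ^+ e *: J (- (i%:Z + 1)) b (J (i%:Z + 1) a u)))); last first.
    move=> u hu; apply: (J0_zhu W ha hb hNe) => i hi.
    by split; apply: (J_piece_eq0 W gr _ _ hu); lia.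
  rewrite tr_sum; apply: eq_bigr => i _; congr (_ * _).
  rewrite trD; congr (_ + _).
  rewrite /tr -[RHS]addr0 -(T0 n) -Tl; apply: Te => u _; rewrite addr0.
  by rewrite -PoszD addn1.
have -> : \sum_(i < n.+1) (i + e)%:R ^+ e *
     (tr j n (fun u => J (- (i + e)%N%:Z) a (J (i + e)%N b u)) +
      (-1) ^+ e * tr j n (fun u => J (- i.+1%:Z) b (J i.+1 a u))) =
   (e == 0%N)%:R * tr j n (fun u => J 0 a (J 0 b u)) +
   \sum_(i < n.+1) i.+1%:R ^+ e *
     (tr j n (fun u => J (- i.+1%:Z) a (J i.+1 b u)) +
      (-1) ^+ e * tr j n (fun u => J (- i.+1%:Z) b (J i.+1 a u))) :> C.
  case: e e1 {hNe} => [|[|//]] _ /=.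
    rewrite mul1r.
    under eq_bigr => i _ do rewrite addn0 expr0 !mul1r.
    under [X in _ = _ + X]eq_bigr => i _ do rewrite expr0 !mul1r.
    rewrite !big_split /= addrA; congr (_ + _).
    rewrite big_ord_recl /= oppr0 [X in _ = _ + X]big_ord_recr /=; congr (_ + _).
    rewrite [X in _ = _ + X]tr_zero ?addr0//.
    move=> u hu; rewrite (J_piece_eq0 W gr _ _ hu); last by lia.
    exact: linf0 (J_linearr W _ _).
  rewrite mul0r add0r; apply: eq_bigr => i _; by rewrite !addn1.
congr (_ + _).
under eq_bigr => i _ do rewrite tr_raise_lower// tr_lower_raise//.
transitivity (\sum_(i < n.+1) \sum_(i' < n.+1 | (0 < i')%N && (i.+1 %| i')%N)
    \sum_(s < N) (((-1) ^+ e - (-1) ^+ s) / (s`!)%:R) *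
      (i.+1%:R ^+ (e + s) * ch j (n - i') (wprod A k a s b))).
  apply: eq_bigr => i _; rewrite addrC mulr_sumr -sumrB mulr_sumr.
  apply: eq_bigr => i' _; rewrite /tr_commutator mulr_sumr -sumrB mulr_sumr.
  apply: eq_bigr => s _.
  have -> : (- i.+1%:Z)%:~R = - i.+1%:R :> C by rewrite rmorphN.
  by rewrite (exprNn i.+1%:R) exprD -pmulrn; ring.
rewrite (exchange_big_dep xpredT) //=.
under eq_bigr do rewrite exchange_big /=.
rewrite exchange_big /=; apply: eq_bigr => s _.
rewrite /conv mulr_sumr; apply: eq_bigr => i' _.
rewrite -mulr_sumr -mulr_suml; congr (_ * (_ * _)).
rewrite /sigma -(big_mkord (fun i => (0 < i' )%N && (i.+1 %| i')%N) (fun i => i.+1%:R ^+ (e + s))).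
case: (posnP i') => [->|i0].
  by rewrite !big_pred0// => -[[|x] hx].
rewrite -(big_mkord (fun d => (0 < d)%N && (d %| i')%N) (fun d => (d%:R : C) ^+ (e + s))).
rewrite [RHS]big_ltn_cond //= big_add1 /=.
have il := ltn_ord i'.
rewrite [LHS](big_cat_nat _ (n := i')) //=; last by lia.
rewrite [X in _ + X]big_nat_cond [X in _ + X]big1 ?addr0//.
move=> i /andP[/andP[h1 h2] h3]; have := dvdn_leq i0 h3; lia.
Qed.

End TwoModes.

(** The shift by 2 covers all the modes that occur for e <= 1. *)
Definition vanish_from (N : nat) a b := forall n : int, N%:Z <= n + 2 -> nprod A a n b = 0.

Lemma wprod_vanish N k a b (s : nat) : vanish_from N a b -> (N <= s)%N -> wprod A k a s b = 0.
Proof.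
move=> h Ns; rewrite (@wprodE _ _ _ _ _ _ _ 0) ?big_ord0// => i _; apply: h; lia.
Qed.

(** The recursion for e = 0: the factor 1 - (-1)^s removes the divisor sums for even s, the odd
    Bernoulli numbers vanish, and what remains for the mode 2 p + 1 is the Bernoulli number and
    the divisor sum that make up one Eisenstein series.  The term of index 1 vanishes as the
    trace of a_[0] b. *)
Lemma trace_sqm1_homog k l a b K j n : homogeneous A k a -> homogeneous A l b ->
  vanish_from (2 * K) a b ->
  ch j n (wprod A k a (-1) b) = tr j n (fun u => J 0 a (J 0 b u)) +
    \sum_(p < K) conv (eis R p.+1) (fun i => ch j i (wprod A k a (2 * p).+1 b)) n.
Proof.
move=> ha hb hK.
have hN : vanish_from (2 * K.+1) a b by move=> m hm; apply: hK; lia.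
pose F s := bern R 0 s * ch j n (wprod A k a (s%:Z - 1 - 0%N%:Z) b).
pose G s := (((-1) ^+ 0 - (-1) ^+ s) / (s`!)%:R) *
     conv (sigma R (0 + s)) (fun i => ch j i (wprod A k a s b)) n.
have := zhu_recursion j ha hb hN n (leq0n 1).
rewrite (sum_pairs_tail F) (sum_pairs_last (F := G)); last first.
  move=> s hs; rewrite /G conv0r ?mulr0// => i.
  by rewrite (wprod_vanish _ hK hs) ch0.
have -> : F 1%N = 0.
  by rewrite /F (_ : 1%N%:Z - 1 - 0%N%:Z = 0) ?(ch_sq0 j ha hb hN) ?mulr0.
have -> : F 0%N = ch j n (wprod A k a (-1) b).
  by rewrite /F bern_at0 mul1r.
rewrite /= mul1r addr0 => /(canRL (addrK _)) ->.
rewrite -addrA -sumrB; congr (_ + _); apply: eq_bigr => p _.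
have -> : F (2 * p).+3 = 0 by rewrite /F bern0_odd mul0r.
have -> : G (2 * p)%N = 0 by rewrite /G sign_even expr0 subrr !mul0r.
rewrite conv_eis /G /F add0n expr0 exprS sign_even mulr1 opprK.
by rewrite (_ : (2 * p).+2%:Z - 1 - 0%N%:Z = (2 * p).+1%:Z); [ring|lia].
Qed.

(** The recursion for e = 1, where the roles of even and odd s are exchanged and the coefficients
    are multiplied by - (2 p + 1). *)
Lemma trace_sqm2_homog k l a b K j n : homogeneous A k a -> homogeneous A l b ->
  vanish_from (2 * K) a b ->
  ch j n (wprod A k a (-2) b) =
    - \sum_(p < K) (2 * p).+1%:R *
       conv (eis R p.+1) (fun i => ch j i (wprod A k a (2 * p)%N b)) n.
Proof.
move=> ha hb hK.
have hN : vanish_from (2 * K.+1) a b by move=> m hm; apply: hK; lia.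
pose F s := bern R 1 s * ch j n (wprod A k a (s%:Z - 1 - 1%N%:Z) b).
pose G s := (((-1) ^+ 1 - (-1) ^+ s) / (s`!)%:R) *
     conv (sigma R (1 + s)) (fun i => ch j i (wprod A k a s b)) n.
have := zhu_recursion j ha hb hN n (leqnn 1).
rewrite (sum_pairs_tail F) (sum_pairs_last (F := G)); last first.
  move=> s hs; rewrite /G conv0r ?mulr0// => i.
  by rewrite (wprod_vanish _ hK hs) ch0.
have -> : F 1%N = 0 by rewrite /F bern1_1 mul0r.
have -> : F 0%N = ch j n (wprod A k a (-2) b) by rewrite /F bern_at0 mul1r.
rewrite /= mul0r add0r addr0 => /(canRL (addrK _)) ->.
rewrite -sumrB -sumrN; apply: eq_bigr => p _.
have -> : F (2 * p).+3 = 0 by rewrite /F bern1_bern0 bern0_odd mulr0 mul0r.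
have -> : G (2 * p).+1 = 0.
  by rewrite /G (expr1 (-1)) [(-1) ^+ (2 * p).+1]exprS sign_even mulr1 subrr !mul0r.
rewrite conv_eis /G /F add1n (expr1 (-1)) sign_even bern1_bern0.
rewrite (_ : (2 * p).+2%:Z - 1 - 1%N%:Z = (2 * p)%N%:Z); last by lia.
have := fact_neq0 R (2 * p).+1; rewrite factS natrM mulf_eq0 negb_or => /andP[h1 h2].
rewrite -(natr1 (2 * p).+1).
move: h1 h2; set x : C := (2 * p).+1%:R; set f : C := (_`!)%:R => h1 h2.
set c := conv _ _ _; set y := ch _ _ _; set z := bern _ _ _.
clearbody x f c y z; field; by rewrite h1 h2.
Qed.

(** ** Traces of the square-bracket products *)

(** A bound that is uniform in the homogeneous components of b. *)
Lemma vanish_exists a b : exists N, forall l, forall n : int, N%:Z <= n + 2 ->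
  nprod A a n (hcomp A l b) = 0.
Proof.
have [L [hL _]] := hcomp_decomp A b.
have H l : exists N : nat, forall n : int, N%:Z <= n + 2 -> nprod A a n (hcomp A l b) = 0.
  have [N hN] := prod_trunc A a (hcomp A l b) (-2); exists N => n hn.
  have := hN `|(n + 2)%R|%N; rewrite (_ : -2 + `|(n + 2)%R|%N%:Z = n); last by lia.
  by apply; lia.
have /choice [N hN] := H.
exists (\max_(l < L) N l) => l n hn; case: (ltnP l L) => lL; last first.
  by rewrite hL// (act0r (prod_weak_module A)).
have h : (N l <= \max_(l < L) N l)%N := leq_bigmax (F := fun l : 'I_L => N l) (Ordinal lL).
by apply: hN; lia.
Qed.

Lemma wprod_hcomp_sum k a n b L : b = \sum_(l < L) hcomp A l b ->
  wprod A k a n b = \sum_(l < L) wprod A k a n (hcomp A l b).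
Proof. by move=> hb; rewrite {1}hb (linf_sum (wprod_linear A k a n)). Qed.

Lemma trace_sq0 k a b j n : homogeneous A k a -> ch j n (wprod A k a 0 b) = 0.
Proof.
move=> ha; have [L [_ hb]] := hcomp_decomp A b.
have [N hN] := vanish_exists a b.
rewrite (wprod_hcomp_sum _ _ _ hb) ch_sum big1// => l _.
by apply: (ch_sq0 j ha (@hcomp_homog _ _ A l b) (N := N)) => m; exact: hN.
Qed.

Lemma trace_sqm2 k a b : homogeneous A k a -> exists K0, forall K, (K0 <= K)%N -> forall j n,
  ch j n (wprod A k a (-2) b) =
    - \sum_(p < K) (2 * p).+1%:R *
       conv (eis R p.+1) (fun i => ch j i (wprod A k a (2 * p)%N b)) n.
Proof.
move=> ha; have [L [_ hb]] := hcomp_decomp A b.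
have [N hN] := vanish_exists a b; exists N => K NK j n.
rewrite (wprod_hcomp_sum _ _ _ hb) ch_sum.
under eq_bigr => l _.
  rewrite (trace_sqm2_homog (K := K) j n ha (@hcomp_homog _ _ A l b)); last first.
    by move=> m hm; apply: hN; lia.
  over.
rewrite sumrN exchange_big /=; congr (- _); apply: eq_bigr => p _.
rewrite -mulr_sumr -conv_sumr; congr (_ * conv _ _ _); apply/funext => i.
by rewrite (wprod_hcomp_sum _ _ _ hb) ch_sum.
Qed.

Lemma trace_sqm1 k a b : homogeneous A k a -> exists K0, forall K, (K0 <= K)%N -> forall j n,
  ch j n (wprod A k a (-1) b) = tr j n (fun u => J 0 a (J 0 b u)) +
    \sum_(p < K) conv (eis R p.+1) (fun i => ch j i (wprod A k a (2 * p).+1 b)) n.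
Proof.
move=> ha; have [L [_ hb]] := hcomp_decomp A b.
have [N hN] := vanish_exists a b; exists N => K NK j n.
rewrite (wprod_hcomp_sum _ _ _ hb) ch_sum.
under eq_bigr => l _.
  rewrite (trace_sqm1_homog (K := K) j n ha (@hcomp_homog _ _ A l b)); last first.
    by move=> m hm; apply: hN; lia.
  over.
rewrite big_split exchange_big /=; congr (_ + _).
  under eq_bigr do rewrite -[tr _ _ _]mul1r.
  rewrite -tr_sum; apply: tr_ext => u _; rewrite [in RHS]hb.
  rewrite (linf_sum (J_linearl W 0 u)) (linf_sum (J_linearr W 0 a)).
  by apply: eq_bigr => l _; rewrite scale1r.
apply: eq_bigr => p _; rewrite -conv_sumr; congr (conv _ _ _); apply/funext => i.
by rewrite (wprod_hcomp_sum _ _ _ hb) ch_sum.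
Qed.

(** ** The conformal vector *)

(** o(omega) is L_0. *)
Lemma tr_L0 j n b : tr j n (fun u => J 0 (conf A) (J 0 b u)) =
  (r + n%:R) * ch j n b + ch j.+1 n b.
Proof.
rewrite /ch /tr -Tl; apply: Te => u _.
rewrite (JH W _ _ (conf_homog A)) (_ : 2%:Z - 1 + 0 = 0 + 1)// -/(Lop A act 0 _).
rewrite iterS -(J_Nil r W b (n := n) (n' := n)) ?subr0//.
by rewrite {2}/L0_nil addrC subrK.
Qed.

Lemma ch_top n b : ch d.+1 n b = 0.
Proof.
rewrite /ch /tr -[RHS](T0 n); apply: Te => u hu.
by rewrite (graded_nil gr hu) (linf0 (J_linearr W _ _)).
Qed.

(** The coefficientwise form of the differential equation: [trace_sqm1] for a = omega, in which
    o(omega) o(b) is evaluated by [tr_L0]. *)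
Lemma trace_conf b : exists K0, forall K, (K0 <= K)%N -> forall j n,
  ch j n (sq_L A (-2) b) =
    two_pi_i R ^+ 2 * ((r + n%:R - Defs.charge A / 24) * ch j n b + ch j.+1 n b) +
    \sum_(p < K) two_pi_i R ^+ (2 * p.+1) *
      conv (eis R p.+1) (fun i => ch j i (sq_L A (2 * p)%N b)) n.
Proof.
have [K0 hK] := trace_sqm1 b (conf_homog A); exists K0 => K /hK h j n.
rewrite sq_L_m2 chZ -scaleNr chD chZ h tr_L0.
have -> : \sum_(p < K) two_pi_i R ^+ (2 * p.+1) *
      conv (eis R p.+1) (fun i => ch j i (sq_L A (2 * p)%N b)) n =
   two_pi_i R ^+ 2 * \sum_(p < K) conv (eis R p.+1) (fun i => ch j i (wprod A 2 (conf A) (2 * p).+1 b)) n.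
  rewrite mulr_sumr; apply: eq_bigr => p _.
  rewrite mulnS exprD -mulrA; congr (_ * _); rewrite /conv mulr_sumr.
  by apply: eq_bigr => i _; rewrite sq_L_even chZ; ring.
ring.
Qed.

(** ** Finite generation *)

Section Generated.
Variables (I : finType) (e : I -> V).

(** The span of the traces of the [e i] over the ring of q-series with subexponential
    coefficients.  The coefficients are the same for all powers j of the nilpotent part, so that
    a relation holds for all j at once. *)
Definition generated (F : nat -> nat -> C) := exists2 h : I -> nat -> C,
  (forall i, subexp (h i)) &
  forall j n, F j n = \sum_i conv (h i) (fun m => ch j m (e i)) n.

Lemma generated0 : generated (fun _ _ => 0).
Proof.
exists (fun _ _ => 0) => [i|j n]; first exact: subexp0.
rewrite big1// => i _; by rewrite /conv big1// => m _; rewrite mul0r.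
Qed.

Lemma generatedD F G : generated F -> generated G -> generated (fun j n => F j n + G j n).
Proof.
move=> [h sh hF] [h' sh' hG]; exists (fun i n => h i n + h' i n) => [i|j n]; first exact: subexpD.
by rewrite hF hG -big_split; apply: eq_bigr => i _; rewrite /= convDl.
Qed.

Lemma generatedZ c F : generated F -> generated (fun j n => c * F j n).
Proof.
move=> [h sh hF]; exists (fun i n => c * h i n) => [i|j n]; first exact: subexpZ.
by rewrite hF mulr_sumr; apply: eq_bigr => i _; rewrite convZl.
Qed.

Lemma generated_ext F G : generated F -> (forall j n, G j n = F j n) -> generated G.
Proof. by move=> [h sh hF] GF; exists h => // j n; rewrite GF hF. Qed.

Lemma generated_sum (X : Type) (s : seq X) (p : pred X) (F : X -> nat -> nat -> C) :
  (forall x, p x -> generated (F x)) -> generated (fun j n => \sum_(x <- s | p x) F x j n).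
Proof.
move=> h; elim: s => [|x s IH].
  by apply: generated_ext generated0 _ => j n; rewrite big_nil.
case px: (p x); last by apply: generated_ext IH _ => j n; rewrite big_cons px.
by apply: generated_ext (generatedD (h x px) IH) _ => j n; rewrite big_cons px.
Qed.

Lemma generated_conv f F : subexp f -> generated F -> generated (fun j n => conv f (F j) n).
Proof.
move=> sf [h sh hF]; exists (fun i => conv f (h i)) => [i|j n]; first exact: subexp_conv.
rewrite (eq_conv _ _ (hF j)) conv_sumr; apply: eq_bigr => i _; exact: convA.
Qed.

Lemma generated_generator i : generated (fun j n => ch j n (e i)).
Proof.
exists (fun i' m => (i' == i)%:R *+ (m == 0%N)) => [i'|j n]; first exact: subexp_delta.
rewrite (bigD1 i)//= big1 ?addr0 => [|i' /negbTE ii'].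
  by rewrite conv_delta eqxx mul1r.
by rewrite conv_delta ii' mul0r.
Qed.

Definition gen_vec v := generated (fun j n => ch j n v).

Lemma gen_vec0 : gen_vec 0.
Proof. by apply: generated_ext generated0 _ => j n; rewrite ch0. Qed.

Lemma gen_vec_sum (X : Type) (s : seq X) (F : X -> V) :
  (forall x, gen_vec (F x)) -> gen_vec (\sum_(x <- s) F x).
Proof.
move=> h; apply: generated_ext (@generated_sum _ s xpredT _ (fun x _ => h x)) _ => j n.
by rewrite ch_sum.
Qed.

Lemma gen_vecZ c v : gen_vec v -> gen_vec (c *: v).
Proof. by move=> h; apply: generated_ext (generatedZ c h) _ => j n; rewrite chZ. Qed.

Lemma gen_vecB v w : gen_vec v -> gen_vec w -> gen_vec (v - w).
Proof.
move=> hv hw; apply: generated_ext (generatedD hv (generatedZ (-1) hw)) _ => j n.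
by rewrite chD -scaleN1r chZ.
Qed.

(** a_(-2) b is a_[-2] b up to terms of lower weight, and by [trace_sqm2] the trace of a_[-2] b is
    a combination of those of a_[2p] b, whose components have lower weight, too. *)
Lemma gen_C2 k l a b : homogeneous A k a -> homogeneous A l b ->
  (forall w v, (w < k + l + 1)%N -> homogeneous A w v -> gen_vec v) ->
  gen_vec (nprod A a (-2) b).
Proof.
move=> ha hb IH.
have low n : -1 <= n -> gen_vec (nprod A a n b).
  move=> n1; case: (ltrP (k%:Z + l%:Z - n - 1) 0) => hw.
    by rewrite (prod_neg ha hb hw); exact: gen_vec0.
  apply: (IH `|(k%:Z + l%:Z - n - 1)%R|%N); first by lia.
  by rewrite /homogeneous (prod_weight n _ ha hb) ifT//; apply/eqP; lia.
have loww n : -1 <= n -> gen_vec (wprod A k a n b).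
  move=> n1; have [N hN] := prod_trunc A a b n; rewrite (wprodE k hN).
  by apply: gen_vec_sum => i; apply: gen_vecZ; apply: low; lia.
have [N hN] := prod_trunc A a b (-2).
have -> : nprod A a (-2) b = wprod A k a (-2) b -
   \sum_(j < N) exp_coef R (- (-2 + j.+1%:Z) - 1) k j.+1 *: nprod A a (-2 + j.+1%:Z) b.
  rewrite (@wprodE _ _ _ _ _ _ _ N.+1); last by move=> j Nj; apply: hN; lia.
  by rewrite big_ord_recl /= exp_coef0 scale1r addr0 addrK.
apply: gen_vecB; last first.
  by apply: gen_vec_sum => i; apply: gen_vecZ; apply: low; lia.
have [K hK] := trace_sqm2 b ha.
apply: generated_ext (_ : generated (fun j n => -1 * \sum_(p < K) (2 * p).+1%:R *
       conv (eis R p.+1) (fun i => ch j i (wprod A k a (2 * p)%N b)) n)) _; last first.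
  by move=> j n; rewrite (hK K)// mulN1r.
apply: generatedZ; apply: generated_sum => p _; apply: generatedZ.
apply: (generated_conv (F := fun j n => ch j n (wprod A k a (2 * p)%N b))).
  exact: eis_subexp.
by apply: loww; lia.
Qed.

End Generated.

(** Induction on the weight: a vector of large weight is the component of that weight of an
    element of C_2(V), hence a combination of products a_(-2) b of homogeneous vectors. *)
Lemma zhu_generated : zhu_finite A -> exists (I : finType) (e : I -> V),
  forall v, gen_vec e v.
Proof.
move=> [n [g hg]].
have /choice [N hN] (i : 'I_n) : exists N, forall k, (N <= k)%N -> hcomp A k (g i) = 0.
  by have [N [hN _]] := hcomp_decomp A (g i); exists N.
have [I [e he]] := low_weights_span A (\max_i N i).
exists I, e.
have key k v : homogeneous A k v -> gen_vec e v.
  elim/ltn_ind: k v => k IH v hv.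
  case: (ltnP k (\max_i N i)) => kN.
    have [c ->] := he k v kN hv.
    by apply: gen_vec_sum => i; apply: gen_vecZ; exact: generated_generator.
  have [c [m [c' [y [hy Ey]]]]] := hg v.
  have -> : v = \sum_i c' i *: hcomp A k (y i).
    have := congr1 (hcomp A k) Ey; rewrite (linfB (comp_linear A k)) !(linf_sum (comp_linear A k)).
    rewrite hv big1 ?subr0 => [->|i _].
      by apply: eq_bigr => i _; rewrite (linfZ (comp_linear A k)).
    rewrite (linfZ (comp_linear A k)) (hN i) ?scaler0//.
    exact: leq_trans (leq_bigmax i) kN.
  apply: gen_vec_sum => i; apply: gen_vecZ; have [a [b ->]] := hy i.
  have [La [_ ha]] := hcomp_decomp A a; have [Lb [_ hb]] := hcomp_decomp A b.
  rewrite ha (act_suml (prod_weak_module A)) (linf_sum (comp_linear A k)).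
  apply: gen_vec_sum => p.
  rewrite hb (act_sumr (prod_weak_module A)) (linf_sum (comp_linear A k)).
  apply: gen_vec_sum => p'.
  rewrite (prod_weight _ _ (hcomp_homog A p a) (hcomp_homog A p' b)).
  case: eqP => E; last exact: gen_vec0.
  apply: (gen_C2 (hcomp_homog A p a) (hcomp_homog A p' b)) => w u hw; apply: IH; lia.
move=> v; have [L [_ ->]] := hcomp_decomp A v.
by apply: gen_vec_sum => k; apply: (key k); exact: hcomp_homog.
Qed.

(** Writing the square-bracket products in [trace_conf] in terms of the generators turns it into
    a first-order linear system for their traces, with the traces for j + 1 as inhomogeneous
    term; it is solved from j = d + 1, where the traces vanish, downwards. *)
Lemma ch_subexp : zhu_finite A -> forall j v, (j <= d.+1)%N -> subexp (fun n => ch j n v).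
Proof.
move=> /zhu_generated [I [e he]].
have gens j : (forall i, subexp (fun n => ch j n (e i))) -> forall v, subexp (fun n => ch j n v).
  move=> h v; have [f sf hf] := he v.
  have : subexp (fun n => \sum_i conv (f i) (fun m => ch j m (e i)) n).
    by apply: subexp_sum => i; exact: subexp_conv.
  by under [X in subexp X -> _]eq_fun do rewrite -hf.
have /choice [H hH] (i : I) : exists h : I -> nat -> C,
    (forall i', subexp (h i')) /\ forall j n,
     n%:R * ch j n (e i) = \sum_i' conv (h i') (fun m => ch j m (e i')) n - ch j.+1 n (e i).
  have [K hK] := trace_conf (e i).
  have : generated e (fun j n => two_pi_i R ^- 2 * (ch j n (sq_L A (-2) (e i)) +
     -1 * \sum_(p < K) two_pi_i R ^+ (2 * p.+1) *
      conv (eis R p.+1) (fun m => ch j m (sq_L A (2 * p)%N (e i))) n) +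
      (Defs.charge A / 24 - r) * ch j n (e i)).
    apply: generatedD; last by apply: generatedZ; exact: he.
    apply: generatedZ; apply: generatedD; first exact: he.
    apply: generatedZ; apply: generated_sum => p _; apply: generatedZ.
    apply: (generated_conv (F := fun j n => ch j n (sq_L A (2 * p)%N (e i)))); last exact: he.
    exact: eis_subexp.
  move=> [h sh hh]; exists h; split=> // j n; rewrite -hh (hK K)//.
  have u0 := two_pi_i_neq0 R.
  set S := \sum_(p < K) _; field; exact: u0.
suff H' m : forall v, subexp (fun n => ch (d.+1 - m)%N n v).
  by move=> j v jd; have := H' (d.+1 - j)%N v; rewrite subKn.
elim: m => [|m IH] v.
  by rewrite subn0; under eq_fun do rewrite ch_top; exact: subexp0.
case: (leqP d.+1 m) => dm.
  have -> : (d.+1 - m.+1 = d.+1 - m)%N by lia.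
  exact: IH.
apply: gens => {v} i.
apply: (@subexp_system R I (fun i n => ch (d.+1 - m.+1)%N n (e i))
   (fun i n => - ch (d.+1 - m)%N n (e i)) H) => // [i' i''|i'|i' n].
- by case: (hH i').
- by under eq_fun do rewrite -mulN1r; apply: subexpZ; exact: IH.
- have [_ ->] := hH i'; congr (_ - ch _ _ _); lia.
Qed.

(** ** Convergence *)

Hypothesis Z : zhu_finite A.

Local Notation u := (two_pi_i R).
Local Notation H := (upper_half R).
Local Notation kappa := (r - Defs.charge A / 24).

Definition qser j (a : V) (tau : H) : C :=
  summability.sum (fun n => ch j n a * qq tau ^+ n : C^o).

Lemma qser_summable j a tau : (j <= d.+1)%N -> abs_summable (fun n => ch j n a * qq tau ^+ n).
Proof. by move=> jd; apply: subexp_summable (cabs_qq tau); exact: ch_subexp. Qed.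

Lemma has_sum_qser j a tau : (j <= d.+1)%N ->
  has_sum (fun n => ch j n a * qq tau ^+ n) (qser j a tau).
Proof. by move=> jd; apply: has_sum_sum; exact: qser_summable. Qed.

Lemma qser_linear j tau : (j <= d.+1)%N -> scalar (fun a => qser j a tau).
Proof.
move=> jd c a b; apply: (has_sum_unique (has_sum_qser _ tau jd)).
apply: eq_has_sum (has_sumD (has_sumZ c (has_sum_qser a tau jd)) (has_sum_qser b tau jd)) => n.
by rewrite /= ch_linear; ring.
Qed.

Lemma qser_top a tau : qser d.+1 a tau = 0.
Proof.
apply: (has_sum_unique (has_sum_qser a tau (leqnn _))).
by apply: eq_has_sum (has_sum0 _) => n; rewrite ch_top mul0r.
Qed.

(** The q-expansion of the Eisenstein series turns convolutions into products of functions. *)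
Lemma eisenstein_qser j a tau p : (j <= d.+1)%N ->
  has_sum (fun n => u ^+ (2 * p.+1) * conv (eis R p.+1) (fun i => ch j i a) n * qq tau ^+ n)
    (eisenstein p.+1 tau * qser j a tau).
Proof.
move=> jd; have hE := eisenstein_q tau (ltn0Sn p).
have sE : abs_summable (fun n => u ^+ (2 * p.+1) * eis R p.+1 n * qq tau ^+ n).
  apply: subexp_summable (cabs_qq tau); apply: subexpZ; exact: eis_subexp.
apply: eq_has_sum (has_sum_conv sE (qser_summable a tau jd) hE (has_sum_qser a tau jd)) => n.
by rewrite convZl.
Qed.

Definition logpow j (tau : H) : C := (u * val tau) ^+ j / (j`!)%:R.

(** The pseudo-trace function, regrouped as q^kappa times a polynomial in tau whose coefficients
    are q-series. *)
Definition ptrace (a : V) (tau : H) : C :=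
  qpow tau kappa * \sum_(j < d.+1) logpow j tau * qser j a tau.

Lemma ptrace_linear tau : scalar (fun a => ptrace a tau).
Proof.
move=> c a b; rewrite /ptrace mulrCA -mulrDr; congr (_ * _); rewrite mulr_sumr -big_split /=.
apply: eq_bigr => j _; rewrite /= (qser_linear tau (ltnW (ltn_ord j))); ring.
Qed.

Lemma qL0_piece n tau w : piece n w -> piece n (qL0 A act r d n tau w).
Proof.
move=> hw; have pZ c v : piece n v -> piece n (c *: v).
  by move=> hv; rewrite -[c *: v]addr0; apply: (piece_lin W gr) => //; exact: piece0.
apply: (pZ); elim/big_ind: _ => [|x y hx hy|j _]; first exact: piece0.
  by rewrite -[x]scale1r; exact: (piece_lin W gr).
by apply: (pZ); exact: iterNil_piece.
Qed.

Lemma qL0_rho_linear n tau : rho_linear_map rho (qL0 A act r d n tau).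
Proof.
move=> x w v; have rl := rho_End pc.1 x.
rewrite /qL0 (linfZ rl) (linf_sum rl) -scalerDr -big_split; congr (_ *: _).
apply: eq_bigr => j _ /=.
by rewrite (iterNil_rho_linear r W pc) (linfZ rl) scalerDr.
Qed.

Lemma J_qL0_piece n a tau w : piece n w -> piece n (J 0 a (qL0 A act r d n tau w)).
Proof. by move=> hw; apply: (J_piece W a (_ : n%:Z = n%:Z - 0)); [rewrite subr0|exact: qL0_piece]. Qed.

Lemma J_qL0_rho_linear n a tau :
  rho_linear_map rho (fun w => J 0 a (qL0 A act r d n tau w)).
Proof. by move=> x w v; rewrite qL0_rho_linear (J_rho_linear W pc). Qed.

Lemma ptrace_qseries a tau :
  has_sum (fun n => T n (fun w => J 0 a (qL0 A act r d n tau w))) (ptrace a tau).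
Proof.
have h := has_sumZ (qpow tau kappa) (has_sum_big (fun j : 'I_d.+1 =>
   has_sumZ (logpow j tau) (has_sum_qser a tau (ltnW (ltn_ord j))))).
apply: eq_has_sum h => n /=.
have -> : T n (fun w => J 0 a (qL0 A act r d n tau w)) =
   T n (fun w => \sum_(j < d.+1) (qpow tau (- (Defs.charge A / 24)) *
    ((j`!)%:R^-1 * qpow tau (r + n%:R) * (u * val tau) ^+ j)) *: J 0 a (iter j (Nil n) w)).
  apply: Te => w _; rewrite /qL0 (linfZ (J_linearr W 0 a)) (linf_sum (J_linearr W 0 a)).
  rewrite scaler_sumr; apply: eq_bigr => j _.
  by rewrite (linfZ (J_linearr W 0 a)) scalerA.
rewrite T_sum mulr_sumr; apply: eq_bigr => j _.
rewrite -/(tr j n (J 0 a)) -/(ch j n a) /logpow.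
have -> : qpow tau kappa = qpow tau r * qpow tau (- (Defs.charge A / 24)).
  by rewrite /qpow mulrDr cexpD.
have -> : qpow tau (r + n%:R) = qpow tau r * qq tau ^+ n.
  by rewrite /qpow mulrDr cexpD [_ * n%:R]mulrC cexp_natM.
ring.
Qed.

(** ** The one-point function conditions *)

Lemma has_ddtau_logpow j tau :
  has_ddtau (logpow j) tau (u * (if j is i.+1 then logpow i tau else 0)).
Proof.
case: j => [|j].
  rewrite mulr0 /logpow; under eq_fun do rewrite expr0 mul1r.
  exact: has_ddtau_cst.
have h := has_ddtauM (has_ddtauX j (has_ddtauM (has_ddtau_cst u tau) (has_ddtau_id tau)))
  (has_ddtau_cst ((j.+1)`!%:R^-1) tau).
move: h; rewrite /logpow; congr has_ddtau.
have := fact_neq0 R j.+1; rewrite factS natrM mulf_eq0 negb_or => /andP[h1 h2].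
rewrite mul0r add0r mulr1 mulr0 addr0.
by move: (_ ^+ j) (j.+1%:R) (_`!%:R) h1 h2 => y x f h1 h2; field; rewrite h1 h2.
Qed.

(** The product rule; differentiating the factor (2 pi i tau)^j / j! lowers j by one. *)
Lemma has_ddtau_ptrace a tau : exists2 s : nat -> C,
  forall j, (j <= d)%N -> has_sum (fun n => n%:R * ch j n a * qq tau ^+ n) (s j) &
  has_ddtau (ptrace a) tau (u * (qpow tau kappa * \sum_(j < d.+1)
    (logpow j tau * (kappa * qser j a tau + s j) +
     (if j : nat is i.+1 then logpow i tau else 0) * qser j a tau))).
Proof.
have /choice [s hs] (j : nat) : exists s, (j <= d)%N ->
    has_sum (fun n => n%:R * ch j n a * qq tau ^+ n) s.
  case: (leqP j d) => jd; last by exists 0.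
  have [s hs] := abs_summable_has_sum (subexp_summable
    (subexpMn (ch_subexp Z a (leqW jd))) (cabs_qq tau)).
  by exists s.
exists s => //.
have h1 (j : 'I_d.+1) : has_ddtau (fun t => logpow j t * qser j a t) tau
    (u * (if j : nat is i.+1 then logpow i tau else 0) * qser j a tau +
     logpow j tau * (u * s j)).
  apply: has_ddtauM (has_ddtau_logpow j tau) _.
  apply: (has_ddtau_qseries (ch_subexp Z a (ltnW (ltn_ord j)))).
    by move=> t; apply: has_sum_qser; exact: ltnW.
  by apply: hs; rewrite -ltnS.
have h2 := has_ddtau_cexp (u * kappa) tau.
have h3 : has_ddtau (fun t => qpow t kappa) tau (u * kappa * qpow tau kappa).
  rewrite (_ : (fun t => qpow t kappa) = (fun t => cexp (u * kappa * val t))).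
    by rewrite /qpow [_ * val tau * _]mulrAC.
  by apply/funext => t; rewrite /qpow mulrAC.
have h4 := has_ddtauM h3 (has_ddtau_sum (index_enum _) h1).
apply: (has_ddtau_eq _ h4).
rewrite !mulr_sumr -big_split; apply: eq_bigr => j _ /=; ring.
Qed.

Lemma ptrace_sq0 k a b tau : homogeneous A k a -> ptrace (sq_prod A a 0 b) tau = 0.
Proof.
move=> ha; rewrite /ptrace big1 ?mulr0// => j _.
suff -> : qser j (sq_prod A a 0 b) tau = 0 by rewrite mulr0.
apply: (has_sum_unique (has_sum_qser _ tau (ltnW (ltn_ord j)))).
apply: eq_has_sum (has_sum0 _) => n.
by rewrite (sq_prod_homog _ _ ha) chZ (trace_sq0 _ _ _ ha) mulr0 mul0r.
Qed.

Lemma ptrace0 tau : ptrace 0 tau = 0.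
Proof. by have := ptrace_linear tau (-1) 0 0; rewrite scaleN1r addNr mulN1r addNr. Qed.

Lemma ptraceD tau a b : ptrace (a + b) tau = ptrace a tau + ptrace b tau.
Proof. by have := ptrace_linear tau 1 a b; rewrite scale1r mul1r. Qed.

Lemma ptraceZ tau c a : ptrace (c *: a) tau = c * ptrace a tau.
Proof. by have := ptrace_linear tau c a 0; rewrite !addr0 ptrace0 addr0. Qed.

Lemma ptrace_sum tau (I : Type) (s : seq I) (F : I -> V) :
  ptrace (\sum_(i <- s) F i) tau = \sum_(i <- s) ptrace (F i) tau.
Proof.
by elim: s => [|i s IH]; rewrite ?big_nil ?ptrace0// !big_cons ptraceD IH.
Qed.

Lemma ptrace_Eisenstein (c : nat -> C) v (w : nat -> V) (v' : V) (K : nat) tau :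
  (forall j, (j <= d)%N -> qser j v tau = qser j v' tau +
     \sum_(p < K) c p * (eisenstein p.+1 tau * qser j (w p) tau)) ->
  ptrace v tau = ptrace v' tau +
     \sum_(p < K) c p * (eisenstein p.+1 tau * ptrace (w p) tau).
Proof.
move=> h; have hp p : c p * (eisenstein p.+1 tau * ptrace (w p) tau) =
    qpow tau kappa * \sum_(j < d.+1) logpow j tau * (c p * (eisenstein p.+1 tau * qser j (w p) tau)).
  by rewrite /ptrace !mulr_sumr; apply: eq_bigr => j _; ring.
under eq_bigr do rewrite hp.
rewrite -mulr_sumr -mulrDr exchange_big -big_split /=; congr (_ * _).
by apply: eq_bigr => j _ /=; rewrite (h _ (ltnSE (ltn_ord j))) mulrDr mulr_sumr.
Qed.

(** The sum over p that [trace_sqm2] provides has an additional term p = 0, involving G_2 and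
    a_[0] b, which vanishes by [ptrace_sq0]. *)
Lemma ptrace_Oq k a b tau : homogeneous A k a ->
  ptrace (sq_prod A a (-2) b + \sum_(l \in [set l | (2 <= l)%N])
    ((2 * l - 1)%:R * eisenstein l tau) *: sq_prod A a (2 * l%:Z - 2) b) tau = 0.
Proof.
move=> ha; have [K0 hK0] := trace_sqm2 b ha; have [N hN] := prod_trunc A a b 0.
pose K := maxn K0 N.
have sq0 p : (K <= p)%N -> sq_prod A a (2 * p)%N b = 0.
  move=> Kp; rewrite (sq_prod_homog _ _ ha) (@wprodE _ _ _ _ _ _ _ 0) ?big_ord0 ?scaler0// => i _.
  rewrite -PoszD -[_%:Z]add0r; apply: hN.
  by move: Kp; rewrite geq_max => /andP[_ h]; lia.
rewrite (fsum_from (K := K)) => [|p hp]; last first.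
  rewrite (_ : 2 * (p + 2)%N%:Z - 2 = (2 * p.+1)%N); last by lia.
  by rewrite sq0 ?scaler0//; lia.
pose g p := ((2 * p).+1%:R * eisenstein p.+1 tau) *: sq_prod A a (2 * p)%N b.
have -> : \sum_(p < K) ((2 * (p + 2) - 1)%:R * eisenstein (p + 2) tau) *:
     sq_prod A a (2 * (p + 2)%N%:Z - 2) b = \sum_(p < K.+1) g p - g 0%N.
  rewrite big_ord_recl addrC addKr; apply: eq_bigr => p _.
  rewrite /g lift0 addn2 (_ : (2 * p.+2 - 1 = (2 * p.+1).+1)%N); last by lia.
  by rewrite (_ : 2 * p.+2%:Z - 2 = (2 * p.+1)%N)//; lia.
rewrite addrA ptraceD -[- g _]scaleN1r ptraceZ [ptrace (g 0%N) _]ptraceZ.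
rewrite muln0 (ptrace_sq0 _ _ ha) !mulr0 addr0 ptraceD (ptrace_sum tau (index_enum _) (fun p : 'I_K.+1 => g p)).
rewrite (ptrace_Eisenstein (v := sq_prod A a (-2) b) (v' := 0) (K := K.+1) (c := fun p => - (2 * p).+1%:R)
   (w := fun p => sq_prod A a (2 * p)%N b)).
  rewrite ptrace0 add0r -big_split big1// => p _ /=.
  by rewrite ptraceZ; ring.
move=> j jd; have jd' := leqW jd.
have -> : qser j 0 tau = 0.
  apply: (has_sum_unique (has_sum_qser _ tau jd')).
  by apply: eq_has_sum (has_sum0 _) => n; rewrite ch0 mul0r.
rewrite add0r.
apply: (has_sum_unique (has_sum_qser _ tau jd')).
apply: eq_has_sum (has_sum_big (fun p : 'I_K.+1 => has_sumZ (- (2 * p).+1%:R)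
  (eisenstein_qser (sq_prod A a (2 * p)%N b) tau p jd'))) => n /=.
rewrite (sq_prod_homog (-2) b ha) chZ (hK0 K.+1); last by rewrite /K; lia.
rewrite mulrN mulNr mulr_sumr mulr_suml -sumrN; apply: eq_bigr => p _.
rewrite mulNr mulrA; congr (- (_ * _)).
rewrite (sq_prod_homog _ b ha) [RHS]mulrCA; congr (_ * _).
rewrite (eq_conv _ _ (_ : _ =1 fun i => u ^ (- (2 * p)%N%:Z - 1) * ch j i (wprod A k a (2 * p)%N b))).
  rewrite convC convZl convC mulrA exprnP -expfzDr ?two_pi_i_neq0//.
  by congr (_ ^ _ * _); lia.
by move=> i; rewrite chZ.
Qed.

(** [trace_conf] summed over n and j.  The term with the index j + 1 matches the derivative of
    (2 pi i tau)^(j+1) / (j+1)!; at the upper end it vanishes by [qser_top]. *)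
Lemma ptrace_qddq a tau : ptrace (sq_L A (-2) a) tau = u ^+ 2 * qddq (ptrace a) tau +
  \sum_(k \in [set k | (1 <= k)%N]) eisenstein k tau * ptrace (sq_L A (2 * k%:Z - 2) a) tau.
Proof.
have [K0 hK0] := trace_conf a.
have [s hs hD] := has_ddtau_ptrace a tau.
rewrite (has_ddtau_qddq hD).
have [N hN] := prod_trunc A (conf A) a 0.
pose K := maxn K0 N.
rewrite (fsum_from (K := K)) => [|p hp]; last first.
  rewrite (_ : 2 * (p + 1)%N%:Z - 2 = (2 * p)%N); last by lia.
  have /eqP := sq_L_even A p a.
  rewrite (@wprodE _ _ _ _ _ _ _ 0) ?big_ord0 => [|i _]; last first.
    by rewrite -PoszD -[_%:Z]add0r; apply: hN; move: hp; rewrite geq_max => /andP[_ h]; lia.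
  rewrite eq_sym scaler_eq0 expf_eq0 (negbTE (two_pi_i_neq0 R)) andbF /= => /eqP ->.
  by rewrite ptrace0 mulr0.
have hj (j : nat) : (j <= d)%N -> qser j (sq_L A (-2) a) tau =
   u ^+ 2 * (kappa * qser j a tau + s j + qser j.+1 a tau) +
   \sum_(p < K) eisenstein p.+1 tau * qser j (sq_L A (2 * p)%N a) tau.
  move=> jd; have jd' := leqW jd.
  apply: (has_sum_unique (has_sum_qser _ tau jd')).
  have h1 := has_sumZ (u ^+ 2) (has_sumD (has_sumD (has_sumZ kappa (has_sum_qser a tau jd'))
     (hs j jd)) (has_sum_qser a tau (_ : (j.+1 <= d.+1)%N))).
  have h2 := has_sum_big (fun p : 'I_K => eisenstein_qser (sq_L A (2 * p)%N a) tau p jd').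
  apply: eq_has_sum (has_sumD (h1 jd) h2) => n /=.
  rewrite (hK0 K) ?leq_maxl// [RHS]mulrDl [X in _ = _ + X]mulr_suml; congr (_ + _); ring.
rewrite /ptrace; under [in LHS]eq_bigr => j _ do rewrite (hj _ (ltnSE (ltn_ord j))) mulrDr.
rewrite big_split mulrDr /=; congr (_ + _).
  rewrite mulrCA; congr (_ * _).
  under [LHS]eq_bigr do rewrite mulrCA mulrDr.
  rewrite -mulr_sumr.
  congr (_ * _).
  rewrite !big_split /=; congr (_ + _).
  rewrite big_ord_recr /= qser_top mulr0 addr0 [RHS]big_ord_recl /= mul0r add0r.
  by apply: eq_bigr => j _.
under eq_bigr do rewrite mulr_sumr.
rewrite exchange_big /= mulr_sumr; apply: eq_bigr => p _.
rewrite (_ : 2 * (p + 1)%N%:Z - 2 = (2 * p)%N) ?addn1; last by lia.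
by rewrite [RHS]mulrCA; congr (_ * _); rewrite mulr_sumr; apply: eq_bigr => j _; rewrite mulrCA.
Qed.

End Recursion.

Theorem theorem4p3p4 (R : realType) (V : lmodType R[i]) (A : voa V)
    (M : lmodType R[i]) (act : V -> int -> M -> M) (r : R[i]) (d : nat)
    (P : algType R[i]) (rho : P -> M -> M) (phi : {scalar P}) :
  zhu_finite A ->
  is_module A act ->
  is_graded A act r d ->
  projective_commutant act rho ->
  (forall x y : P, phi (x * y) = phi (y * x)) ->
  (forall (a : V) (tau : upper_half R),
     cvg (series (pseudo_trace_term A act rho phi r d a tau) @ \oo)) /\
  one_point_function A (pseudo_trace_function_ext A act rho phi r d).
Proof.
move=> Z [W _ _] gr pc phiC.
have [T [TE Tl Te Tc]] := trace_functionals W gr pc phiC.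
pose S := ptrace A act r d T.
have term a tau : has_sum (pseudo_trace_term A act rho phi r d a tau) (S a tau).
  apply: eq_has_sum (ptrace_qseries W gr pc Tl Te Tc Z a tau) => n.
  rewrite /pseudo_trace_term TE//; first exact: J_qL0_rho_linear.
  by move=> w; exact: (J_qL0_piece W gr).
have SE a tau : pseudo_trace_function A act rho phi r d a tau = S a tau.
  exact: (cvg_lim (@norm_hausdorff _ (R[i])^o) (has_sum_series (term a tau))).
have S_sum tau (I : Type) (s : seq I) (F : I -> V) :
    S (\sum_(i <- s) F i) tau = \sum_(i <- s) S (F i) tau.
  exact: (ptrace_sum W gr pc Tl Te Tc Z).
have SZ tau c a : S (c *: a) tau = c * S a tau by exact: (ptraceZ W gr pc Tl Te Tc Z).
split=> [a tau|]; first by apply/cvg_ex; exists (S a tau); exact: has_sum_series.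
split.
- move=> v [n [a [f [hf ->]]]] tau.
  have /choice [l hl] i : exists l, has_ddtau (f i) tau l := modular_has_ddtau tau (hf i).
  have /choice [m hm] i : exists m, has_ddtau (S (a i)) tau m.
    by have [s _ h] := has_ddtau_ptrace W gr pc Tl Te Tc Z (a i) tau; eexists; exact: h.
  rewrite (_ : pseudo_trace_function_ext _ _ _ _ _ _ _ =
    fun t => \sum_i f i t * S (a i) t); last first.
    by apply/funext => t; rewrite /pseudo_trace_function_ext SE S_sum; apply: eq_bigr => i _; rewrite SZ.
  exact: has_ddtau_derivable (has_ddtau_sum _ (fun i => has_ddtauM (hl i) (hm i))).
- move=> n a f _ tau; rewrite /pseudo_trace_function_ext SE S_sum.
  by apply: eq_bigr => i _; rewrite SZ SE.
- move=> v [n [f [g [hg ->]]]] tau; rewrite /pseudo_trace_function_ext SE S_sum big1// => i _.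
  rewrite SZ /S; have [_ [k [a [b [ha [->|->]]]]]] := hg i.
    by rewrite (ptrace_sq0 W gr pc Tl Te Tc Z _ _ ha) mulr0.
  by rewrite (ptrace_Oq W gr pc Tl Te Tc Z _ _ ha) mulr0.
- move=> n a _ tau; rewrite /pseudo_trace_function_ext SE.
  rewrite (_ : (fun t => pseudo_trace_function A act rho phi r d a t) = S a); last first.
    by apply/funext => t; rewrite SE.
  rewrite /S (ptrace_qddq W gr pc Tl Te Tc Z); congr (_ + _).
  by apply: eq_fsbigr => k _; rewrite SE.
Qed.
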